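(* Let $K$ satisfy Assumption K with order $p$, with support in $[-1,1]^d$, and let $f,\phi$ satisfy Assumption R3 (both stated in the context). Let the randomizing density be $\ell(l)=\frac{1}{(2h)^d}\mathbf{1}_{[-h,h]^d}(l)$, where $h=h_N>0$ is the bandwidth, and let $$\hat\beta_N^u:=\frac{2^d}{Nh}\sum_{i=1}^N\phi(Z_i)\nabla K\Big(\frac{\lambda^0-\Lambda_i}{h}\Big),\qquad\Sigma_u:=2^d\,\mathbb{E}[\phi^2(Z^0)]\int_{\mathbb{R}^d}\nabla K(l)\nabla K(l)'\,dl.$$ (i) Assume that $h\to0$ and $Nh^2\to\infty$ as $N\to\infty$. Then $$\sqrt{Nh^2}\,(\hat\beta_N^u-\mathbb{E}[\hat\beta_N^u])\longrightarrow\mathcal{N}(0,\Sigma_u)\quad\text{in distribution.}$$ (ii) If, in addition, $Nh^{2p+2}\to0$, then the bias vanishes, i.e. $\sqrt{Nh^2}\,(\mathbb{E}[\hat\beta_N^u]-\beta)\to0$, and $$\sqrt{Nh^2}\,(\hat\beta_N^u-\beta)\longrightarrow\mathcal{N}(0,\Sigma_u)\quad\text{in distribution.}$$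
   Context: Setting. For each parameter $\lambda\in\mathbb{R}^d$, $Z(\lambda)$ is an $\mathbb{R}^n$-valued random variable with density $z\mapsto f(\lambda,z)$ with respect to Lebesgue measure; $\phi\in\mathbb{L}^\infty(\mathbb{R}^n,\mathbb{R})$; $V^\phi(\lambda):=\mathbb{E}[\phi(Z(\lambda))]$. Fix $\lambda^0\in\mathbb{R}^d$, put $Z^0:=Z(\lambda^0)$ and $\beta:=\nabla_\lambda V^\phi(\lambda^0)\in\mathbb{R}^d$. Write $f_\lambda:=\nabla_\lambda f$ and $s(\lambda,z):=\nabla_\lambda\ln f(\lambda,z)$. Standing assumptions: $f$ is smooth enough in $\lambda$ that $\beta=\mathbb{E}[\phi(Z^0)s(\lambda^0,Z^0)]=\int\phi(z)f_\lambda(\lambda^0,z)\,dz$, and $\mathbb{E}|s(\lambda^0,Z^0)|^2<\infty$. Randomization. For each $N$, with the density $\ell$ of the claim (depending on $h=h_N$), $(\Lambda_i,Z_i)_{1\le i\le N}$ are $N$ independent random pairs in $\mathbb{R}^d\times\mathbb{R}^n$ with common density $\varphi(\lambda,z):=\ell(\lambda^0-\lambda)f(\lambda,z)$. The prime denotes transpose. Order of a kernel. For $K:\mathbb{R}^d\to\mathbb{R}$, the order is the smallest nonzero integer $p$ for which there are $j_1,\dots,j_p\in\{1,\dots,d\}$ with $\int l_{j_1}\cdots l_{j_p}K(l)\,dl\neq0$, and $\int l_{\alpha_1}\cdots l_{\alpha_r}K(l)\,dl=0$ for all $0<r<p$ and $\alpha_k\in\{1,\dots,d\}$. Assumption K.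 $K:\mathbb{R}^d\to\mathbb{R}$ is $C^1$, compactly supported, satisfies $\int K=1$, and is of order $p\ge2$. Assumption R3. For every $z$, the function $f(\cdot,z)$ is $p+1$ times differentiable, and for every integer $i\le p+1$ the function $\lambda\mapsto\nabla_\lambda^if(\lambda,z)$ is continuous at $\lambda^0$ uniformly with respect to $z\in S$, for some subset $S\subset\mathbb{R}^n$ such that $\mathrm{Supp}(\phi)\subset\mathrm{int}(S)$.
   Formalization: Part (ii) fails as stated when S has infinite measure; it is proved assuming also that, for λ near λ⁰, |φ(z)| |∇^{p+1}f(λ,z) − ∇^{p+1}f(λ⁰,z)| is bounded by a Lebesgue-integrable function of z (automatic if φ is integrable, e.g. S of finite measure). *)

(* Defs.v *)
From HB Require Import structures.
From mathcomp Require Import all_boot all_order all_algebra.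
From mathcomp Require Import all_classical all_reals all_analysis.

Set Implicit Arguments.
Unset Strict Implicit.
Unset Printing Implicit Defensive.

Import Order.TTheory GRing.Theory Num.Theory.
Import numFieldNormedType.Exports.

Local Open Scope classical_set_scope.
Local Open Scope ring_scope.

Definition measure_rV_display : measure_display -> measure_display.
Proof. exact. Qed.

(* As for [n.-tuple T] in the library: the sigma-algebra generated by the
   coordinates, i.e. the Borel sigma-algebra when [T] is the real line. *)
Section measurable_rV.
Context {d} {T : measurableType d}.
Variable n : nat.

Let coors : 'I_n -> 'rV[T]_n -> T := fun i x => x ord0 i.

Let rV_set0 : g_sigma_preimage coors set0.
Proof. exact: sigma_algebra0. Qed.

Let rV_setC A : g_sigma_preimage coors A -> g_sigma_preimage coors (~` A).
Proof. exact: sigma_algebraC. Qed.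

Let rV_bigcup (F : _^nat) : (forall i, g_sigma_preimage coors (F i)) ->
  g_sigma_preimage coors (\bigcup_i (F i)).
Proof. exact: sigma_algebra_bigcup. Qed.

HB.instance Definition _ := @isMeasurable.Build (measure_rV_display d)
  'rV[T]_n (g_sigma_preimage coors) rV_set0 rV_setC rV_bigcup.

End measurable_rV.

Section lebesgue_rV.
Context {R : realType}.
Local Open Scope ereal_scope.

Lemma measurable_coord n (i : 'I_n) :
  measurable_fun [set: 'rV[R]_n] (fun x : 'rV[R]_n => x ord0 i : R).
Proof.
move=> _ Y mY; rewrite setTI; apply: sub_sigma_algebra => /=.
rewrite -bigcup_seq/=; exists i => /=; first by rewrite mem_index_enum.
by exists Y => //; rewrite setTI.
Qed.

Lemma measurable_fun_rVP d (T : measurableType d) n (f : T -> 'rV[R]_n) :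
  measurable_fun [set: T] f <->
  forall i, measurable_fun [set: T] (fun t => f t ord0 i : R).
Proof.
split=> [mf i|mf].
  exact: (measurableT_comp (measurable_coord i) mf).
suff h : g_sigma_preimage (fun (i : 'I_n) (x : 'rV[R]_n) => x ord0 i : R)
    `<=` [set A | measurable (f @^-1` A)].
  by move=> _ A mA; rewrite setTI; exact: h.
apply: smallest_sub.
  split=> [|A mA|F mF] /=.
  - by rewrite preimage_set0.
  - by rewrite setTD preimage_setC; exact: measurableC.
  - by rewrite preimage_bigcup; apply: bigcupT_measurable => k; exact: mF.
rewrite -bigcup_seq => A [/= i _ [B mB <-]] /=.
by have := mf i measurableT B mB; rewrite !setTI.
Qed.

Definition rV_cons n (xv : measurableTypeR R * 'rV[R]_n) : 'rV[R]_n.+1 :=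
  \row_i (if unlift ord0 i is Some j then xv.2 ord0 j else xv.1).

Lemma measurable_rV_cons n : measurable_fun [set: measurableTypeR R * 'rV[R]_n] (@rV_cons n).
Proof.
apply/measurable_fun_rVP => i; under eq_fun do rewrite mxE.
case: unliftP => [j _|_]; last exact: measurable_fst.
exact: measurableT_comp (measurable_coord j) measurable_snd.
Qed.

HB.instance Definition _ n := isMeasurableFun.Build _ _ _ _
  (@rV_cons n) (@measurable_rV_cons n).

Section step.
Variables (n : nat) (mu : {sigma_finite_measure set 'rV[R]_n -> \bar R}).

Definition lebesgue_rV_step : set 'rV[R]_n.+1 -> \bar R :=
  pushforward (lebesgue_measure \x mu) (@rV_cons n).

Let step0 : lebesgue_rV_step set0 = 0.
Proof. by rewrite /lebesgue_rV_step /pushforward preimage_set0 measure0. Qed.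

Let step_ge0 A : 0 <= lebesgue_rV_step A.
Proof. exact: measure_ge0. Qed.

Let step_sigma_additive : semi_sigma_additive lebesgue_rV_step.
Proof.
move=> F mF tF mUF; rewrite /lebesgue_rV_step /pushforward preimage_bigcup.
apply: measure_semi_sigma_additive.
- by move=> k; rewrite -[X in measurable X]setTI; exact: measurable_rV_cons.
- apply/trivIsetP => /= i j _ _ ij; rewrite -preimage_setI.
  by move/trivIsetP : tF => /(_ _ _ _ _ ij) ->//; rewrite preimage_set0.
- rewrite -preimage_bigcup -[X in measurable X]setTI.
  exact: measurable_rV_cons.
Qed.

HB.instance Definition _ := isMeasure.Build _ _ _ lebesgue_rV_step
  step0 step_ge0 step_sigma_additive.

Let step_sigma_finite : sigma_finite setT lebesgue_rV_step.
Proof.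
have /sigma_finiteP[F [TF ndF Foo]] :=
  sigma_finiteT (lebesgue_measure :
    {sigma_finite_measure set (measurableTypeR R) -> \bar R}).
have /sigma_finiteP[G [TG ndG Goo]] := sigma_finiteT mu.
pose g (v : 'rV[R]_n.+1) : measurableTypeR R * 'rV[R]_n :=
  (v ord0 ord0, \row_j v ord0 (lift ord0 j)).
have gK : cancel (@rV_cons n) g.
  move=> [x v]; congr pair; first by rewrite mxE unlift_none.
  by apply/rowP => j; rewrite !mxE liftK.
have mg : measurable_fun setT g.
  apply/measurable_fun_pairP; split; first exact: measurable_coord.
  apply/measurable_fun_rVP => j; rewrite /comp/=.
  under eq_fun do rewrite mxE; exact: measurable_coord.
exists (fun k => g @^-1` (F k `*` G k)).
  apply/esym; rewrite -subTset => v _.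
  have [i _ Fi] : (\bigcup_k F k) (g v).1 by rewrite -TF.
  have [j _ Gj] : (\bigcup_k G k) (g v).2 by rewrite -TG.
  exists (maxn i j) => //; split.
  - by apply: (subsetPset _ _ (ndF _ _ (leq_maxl i j))).
  - by apply: (subsetPset _ _ (ndG _ _ (leq_maxr i j))).
move=> k; have [mF Foo_k] := Foo k; have [mG Goo_k] := Goo k; split.
  by rewrite -[X in measurable X]setTI; apply: mg => //; exact: measurableX.
rewrite /lebesgue_rV_step /pushforward -comp_preimage.
rewrite (_ : g \o _ = idfun); last by apply/funext => xv; exact: gK.
by rewrite preimage_id product_measure1E// lte_mul_pinfty// ge0_fin_numE.
Qed.

HB.instance Definition _ := Measure_isSigmaFinite.Build _ _ _ lebesgue_rV_step
  step_sigma_finite.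

End step.

Fixpoint lebesgue_rV n : {sigma_finite_measure set 'rV[R]_n -> \bar R} :=
  if n is n'.+1 then lebesgue_rV_step (lebesgue_rV n')
  else \d_(0%R : 'rV[R]_0).

Lemma lebesgue_rV_box n (A : 'I_n -> set R) : (forall i, measurable (A i)) ->
  lebesgue_rV n [set x | forall i, A i (x ord0 i)] =
  \prod_(i < n) lebesgue_measure (A i).
Proof.
elim: n A => [|n IH] A mA.
  by rewrite big_ord0 /= diracE mem_set// => -[].
rewrite big_ord_recl -IH// /= /lebesgue_rV_step /pushforward.
set B := [set x : 'rV[R]_n | forall i, A (lift ord0 i) (x ord0 i)].
have mB : measurable B.
  rewrite (_ : B = \bigcap_(i in [set: 'I_n])
      ((fun x : 'rV[R]_n => x ord0 i : R) @^-1` A (lift ord0 i))).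
    apply: fin_bigcap_measurable => [|i _]; first exact: finite_finset.
    by rewrite -[X in measurable X]setTI; exact: measurable_coord.
  by apply/seteqP; split=> x /= Bx i => [_|]; exact: Bx.
rewrite (_ : _ @^-1` _ = A ord0 `*` B); last first.
  apply/seteqP; split=> -[x v] /=.
  - move=> h; split=> [|i]; first by have := h ord0; rewrite mxE unlift_none.
    by have := h (lift ord0 i); rewrite mxE liftK.
  - by move=> [Ax Bv] i; rewrite mxE; case: unliftP => [j ->|->]; [exact: Bv|].
by rewrite product_measure1E//; exact: mA.
Qed.

End lebesgue_rV.

Section calculus.
Context {R : realType} {d : nat}.
Implicit Types (g : 'rV[R]_d -> R) (js : seq 'I_d).

Definition partial (j : 'I_d) g : 'rV[R]_d -> R :=
  fun x => 'D_(delta_mx ord0 j) g x.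

Definition grad g (x : 'rV[R]_d) : 'rV[R]_d := \row_j partial j g x.

(* For [js] of size [i], the entry of the tensor [\nabla^i g] indexed by [js]. *)
Definition iter_partial js g : 'rV[R]_d -> R := foldr partial g js.

(* [k] times Frechet differentiable on R^d: the differential takes values in a
   finite-dimensional space, so it is differentiable iff its entries, the
   partial derivatives, are. *)
Fixpoint times_differentiable (k : nat) g : Prop :=
  if k is k'.+1 then
    (forall x, differentiable g x) /\
    (forall j, times_differentiable k' (partial j g))
  else True.

Definition C1 g : Prop :=
  (forall x, differentiable g x) /\ (forall j, continuous (partial j g)).

Definition supp g : set 'rV[R]_d := closure [set x | g x != 0].

(* Support of an element of L^oo: complement of the largest open set on which
   it vanishes almost everywhere. It depends only on the class of [g], and is
   contained in [supp g]. *)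
Definition ess_supp g : set 'rV[R]_d :=
  [set x | forall U, nbhs x U ->
     ~ {ae lebesgue_rV d, forall y, U y -> g y = 0}].

Definition cube (h : R) : set 'rV[R]_d :=
  [set l | forall j, - h <= l ord0 j <= h].

End calculus.

Section assumptions.
Context {R : realType} {d n : nat}.

Definition moment (K : 'rV[R]_d -> R) (js : seq 'I_d) : R :=
  \int[lebesgue_rV d]_l ((\prod_(j <- js) l ord0 j) * K l).

Definition kernel_order (K : 'rV[R]_d -> R) (p : nat) : Prop :=
  [/\ (0 < p)%N,
      (exists2 js, size js = p & moment K js != 0) &
      (forall js, (0 < size js < p)%N -> moment K js = 0)].

Definition assumptionK (K : 'rV[R]_d -> R) (p : nat) : Prop :=
  [/\ C1 K, compact (supp K),
      (\int[lebesgue_rV d]_l (K l)%:E = 1)%E,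
      kernel_order K p & (2 <= p)%N].

Definition assumptionR3 (p : nat) (f : 'rV[R]_d -> 'rV[R]_n -> R)
    (phi : 'rV[R]_n -> R) (l0 : 'rV[R]_d) : Prop :=
  (forall z, times_differentiable p.+1 (f ^~ z)) /\
  exists2 S : set 'rV[R]_n, ess_supp phi `<=` interior S &
    forall js, (size js <= p.+1)%N -> forall e, 0 < e ->
      \forall l \near l0, forall z, S z ->
        `|iter_partial js (f ^~ z) l - iter_partial js (f ^~ z) l0| < e.

(* Near [l0], the modulus of continuity of [\nabla_l^(p+1) f] at [l0], weighted
   by [phi], is dominated by an integrable function. Under [assumptionR3] this
   is automatic when [phi] is integrable (take [g = |phi|]), for
   instance when the set [S] has finite Lebesgue measure. *)
Definition dominated_modulus (p : nat) (f : 'rV[R]_d -> 'rV[R]_n -> R)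
    (phi : 'rV[R]_n -> R) (l0 : 'rV[R]_d) : Prop :=
  exists2 g : 'rV[R]_n -> R,
    (lebesgue_rV n).-integrable setT (EFin \o g) &
    exists2 U, nbhs l0 U &
      {ae lebesgue_rV n, forall z, forall js l, size js = p.+1 -> U l ->
        `|phi z| *
          `|iter_partial js (f ^~ z) l - iter_partial js (f ^~ z) l0| <= g z}.

Definition score (f : 'rV[R]_d -> 'rV[R]_n -> R) (l : 'rV[R]_d)
    (z : 'rV[R]_n) : 'rV[R]_d :=
  grad (fun l' => ln (f l' z)) l.

Definition cube_pdf (h : R) (l : 'rV[R]_d) : R :=
  ((2 * h) ^+ d)^-1 * \1_(cube h) l.

End assumptions.

Section probability.
Context {dO : measure_display} {O : measurableType dO} {R : realType}.
Variable P : probability O R.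

Definition has_density (dT : measure_display) (T : measurableType dT)
    (nu : set T -> \bar R) (X : {RV P >-> T}) (g : T -> R) : Prop :=
  [/\ measurable_fun setT g, (forall x, 0 <= g x) &
      forall A, measurable A ->
        distribution P X A = (\int[nu]_(x in A) (g x)%:E)%E].

Definition independent_RVs (dT : measure_display) (T : measurableType dT)
    (I : finType) (X : I -> {RV P >-> T}) : Prop :=
  forall (J : {set I}) (A : I -> set T), (forall i, measurable (A i)) ->
    P (\bigcap_(i in [set` J]) (X i @^-1` A i)) =
    (\prod_(i in J) P (X i @^-1` A i))%E.

Definition expectation_rV d (Y : O -> 'rV[R]_d) : 'rV[R]_d :=
  \row_j fine 'E_P[fun w => Y w ord0 j]%E.

(* [normal_prob m 0] is the library's default value, not the Dirac mass. *)
Definition normal_law (m v : R) : set R -> \bar R :=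
  if v == 0 then \d_m else normal_prob m (Num.sqrt v).

(* [nu] is N(m, S): every linear functional [x |-> <u, x>] has law
   N(<u, m>, u S u') under [nu]. *)
Definition is_normal_rV d (m : 'rV[R]_d) (S : 'M[R]_d)
    (nu : set 'rV[R]_d -> \bar R) : Prop :=
  forall (u : 'rV[R]_d) (A : set R), measurable A ->
    nu [set x | A ((u *m x^T) ord0 ord0)] =
    normal_law ((u *m m^T) ord0 ord0) ((u *m S *m u^T) ord0 ord0) A.

Definition cvg_in_distribution d (Y : nat -> O -> 'rV[R]_d)
    (nu : set 'rV[R]_d -> \bar R) : Prop :=
  forall g : 'rV[R]_d -> R, continuous g -> bounded_fun g ->
    'E_P[fun w => g (Y N w)]%E @[N --> \oo] --> (\int[nu]_x (g x)%:E)%E.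

Definition cvg_to_normal d (Y : nat -> O -> 'rV[R]_d) (m : 'rV[R]_d)
    (S : 'M[R]_d) : Prop :=
  exists2 nu : probability 'rV[R]_d R,
    is_normal_rV m S nu & cvg_in_distribution Y nu.

Context {d n : nat}.

Definition value (Z : 'rV[R]_d -> {RV P >-> 'rV[R]_n}) (phi : 'rV[R]_n -> R)
    (l : 'rV[R]_d) : R :=
  fine 'E_P[fun w => phi (Z l w)]%E.

Definition beta_hat (K : 'rV[R]_d -> R) (phi : 'rV[R]_n -> R) (l0 : 'rV[R]_d)
    (h : R) (N : nat) (X : 'I_N -> O -> 'rV[R]_d * 'rV[R]_n) (w : O) :
    'rV[R]_d :=
  (2 ^+ d / (N%:R * h)) *:
    \sum_(i < N) phi (X i w).2 *: grad K (h^-1 *: (l0 - (X i w).1)).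

Definition Sigma_u (K : 'rV[R]_d -> R) (phi : 'rV[R]_n -> R)
    (Z0 : O -> 'rV[R]_n) : 'M[R]_d :=
  (2 ^+ d * fine 'E_P[fun w => (phi (Z0 w) ^+ 2)%R]%E) *:
    \matrix_(j, k) \int[lebesgue_rV d]_l (((grad K l)^T *m grad K l) j k).

End probability.

(* Main.v *)
Require Import Defs.
From HB Require Import structures.
From mathcomp Require Import all_boot all_order all_algebra.
From mathcomp Require Import all_classical all_reals all_analysis.
From mathcomp Require Import measurable_realfun lebesgue_integral ess_sup_inf.
From mathcomp Require Import lra ring.

(** Rescale the sample: with [L = (lambda0 - Lambda) / h] the estimator is
    [2 ^ d / (N h)] times the sum of the independent terms [phi Z * grad K L], and the
    pair [(L, Z)] has density [2 ^- d * f (lambda0 - h l) z] on the product of the cube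
    of half side [1] with the space of [z] ([rescaled_law]). As [h] tends to [0] this
    density tends to that of a uniform variable and an independent copy of
    [Z(lambda0)]. The mean of a term therefore tends to [0], since [grad K] has
    integral [0], and its second moments converge ([kernel_limit], by Scheffe's
    lemma). Multiplied by [sqrt (N h ^ 2)], the centred estimator is a sum of [N]
    independent, centred and identically distributed terms of size
    [O (N ^ (- 1 / 2))] whose total covariance tends to [Sigma_u]
    ([row_variance_cvg]).

    Such sums are asymptotically normal ([array_clt]). For a fixed direction [u] the
    expectation of [cos (b + <u, Y>)] is computed by integrating out the summands one
    at a time; each step may be replaced by multiplication with the characteristic
    function of a normal variable of variance [v / N] at a cost [o (1 / N)]
    ([expectation_cos_sum], [cos_sum_normal]), and the [N]-th power of that function is
    the one of variance [v], as normal laws are stable under convolution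
    ([normal_measure_add]). The limit law exists: a normal vector is built one
    coordinate at a time with Schur complements ([exists_normal_rV]). Convergence of
    the expectations of all shifted cosines, together with tightness, gives
    convergence in distribution ([cvg_in_distribution_cos]), because on a large cube a
    bounded continuous function is a uniform limit of trigonometric polynomials that
    obey the same bound everywhere: Bernstein polynomials in the sines of the
    coordinates ([trig_poly_dense]).

    For the bias, the expectation of the estimator is [1 / h] times the integral of
    [phi z * grad K l * f (lambda0 - h l) z]. Expand [f] around [lambda0] to order
    [p + 1]. Integrating by parts, the moments of [grad K] of degree [k] are those of
    [K] of degree [k - 1]: degree [1] produces [h * beta], degrees [2] to [p] vanish
    ([moment_partial_words]), and the term of degree [p + 1] and the remainder are
    [O (h ^ (p + 1))] ([bias_bound]). The bias is thus [O (h ^ p)], and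
    [sqrt (N h ^ 2) h ^ p = sqrt (N h ^ (2 p + 2))] tends to [0]. *)

Set Implicit Arguments.
Unset Strict Implicit.
Unset Printing Implicit Defensive.

Import Order.TTheory GRing.Theory Num.Theory.
Import numFieldNormedType.Exports.

Local Open Scope classical_set_scope.
Local Open Scope ring_scope.

(** * Borel sets and Lebesgue integrals on row vectors *)

Section rV_borel.
Context {R : realType}.

Lemma rV_ballP d (x y : 'rV[R]_d) (e : R) : 0 < e ->
  (forall j, `|x ord0 j - y ord0 j| < e) -> ball x e y.
Proof.
move=> e0 xy; split=> // i j; rewrite ord1; exact: xy.
Qed.

Lemma measurable_rV_box d (A : 'I_d -> set R) : (forall i, measurable (A i)) ->
  measurable [set x : 'rV[R]_d | forall i, A i (x ord0 i)].
Proof.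
move=> mA; rewrite (_ : mkset _ = \bigcap_(i in [set: 'I_d])
    ((fun x : 'rV[R]_d => x ord0 i : R) @^-1` A i)); last first.
  by apply/seteqP; split=> x /= Bx i => [_|]; exact: Bx.
apply: fin_bigcap_measurable => [|i _]; first exact: finite_finset.
by rewrite -[X in measurable X]setTI; exact: measurable_coord.
Qed.

(** Boxes with rational centres and sides form a countable base of the topology,
    and they belong to the sigma-algebra generated by the coordinates. *)
Lemma open_measurable_rV d (U : set 'rV[R]_d) : open U -> measurable U.
Proof.
move=> oU.
pose box (i : 'rV[rat]_d * nat) := [set x : 'rV[R]_d |
  forall j, `](ratr (i.1 ord0 j) - i.2.+1%:R^-1), (ratr (i.1 ord0 j) + i.2.+1%:R^-1)[%classic (x ord0 j)].
pose F i := if `[< box i `<=` U >] then box i else set0.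
have -> : U = \bigcup_i F i.
  apply/seteqP; split=> [x Ux|x [i _]]; last first.
    by rewrite /F; case: asboolP => // h; exact: h.
  have /nbhs_ballP[e /= e0 xeU] : nbhs x U by exact: open_nbhs_nbhs.
  have [k ke] : exists k : nat, k.+1%:R^-1 < e / 2.
    have /cvgrPdist_lt /(_ (e / 2)) := @cvg_harmonic R.
    rewrite divr_gt0// => /(_ isT)[k _ /(_ k (leqnn _))] /=.
    by rewrite sub0r normrN ger0_norm//; exists k.
  have k0 : 0 < k.+1%:R^-1 :> R by rewrite invr_gt0.
  have /(_ _)/cid rc : forall j, exists q : rat, ratr q \in `](x ord0 j - k.+1%:R^-1), (x ord0 j + k.+1%:R^-1)[.
    move=> j; by apply: rat_in_itvoo; rewrite ltrBlDr -addrA ltrDl addr_gt0.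
  pose c : 'rV[rat]_d := \row_j sval (rc j).
  have cE j : `|x ord0 j - ratr (c ord0 j)| < k.+1%:R^-1.
    rewrite mxE; case: (rc j) => /= q; rewrite in_itv/=.
    by rewrite distrC ltr_distl.
  have bU : box (c, k) `<=` U.
    move=> y yb; apply: xeU; apply: rV_ballP => // j.
    have := yb j; have := cE j; rewrite /= in_itv/= -ltr_distl => h1 h2.
    rewrite (le_lt_trans (ler_distD (ratr (c ord0 j)) _ _))// (splitr e).
    by rewrite ltrD// ?(lt_trans h1)// distrC (lt_trans h2).
  exists (c, k) => //; rewrite /F; case: asboolP => // _ j /=.
  by have := cE j; rewrite in_itv/= ltr_distl.
apply: countable_bigcupT_measurable => [|i].
  exact: countableP.
rewrite /F; case: ifP => // _; apply: (@measurable_rV_box _ (fun j =>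
  `](ratr (i.1 ord0 j) - i.2.+1%:R^-1), (ratr (i.1 ord0 j) + i.2.+1%:R^-1)[%classic)) => j.
exact: measurable_itv.
Qed.

Lemma continuous_measurable_rV d (g : 'rV[R]_d -> R) :
  continuous g -> measurable_fun [set: 'rV[R]_d] g.
Proof.
move=> /continuousP cg.
apply: (measurability (measurable_realfun.RGenOpens.G (R:=R))).
  exact: measurable_realfun.RGenOpens.measurableE.
move=> _ [_ [a [b ->] <-]]; rewrite setTI; apply: open_measurable_rV.
exact/cg/interval_open.
Qed.

End rV_borel.

Section integral_toolkit.
Context {dT : measure_display} {T : measurableType dT} {R : realType}.
Implicit Types (mu : {measure set T -> \bar R}) (f g : T -> R).

Lemma EFin_Rintegral mu f : mu.-integrable setT (EFin \o f) ->
  (\int[mu]_x f x)%:E = (\int[mu]_x (f x)%:E)%E.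
Proof. by move=> fi; rewrite fineK//; exact: integrable_fin_num. Qed.

Lemma integrable_bounded_mul mu f g (M : R) : measurable_fun setT g ->
  (forall x, `|g x| <= M) -> mu.-integrable setT (EFin \o f) ->
  mu.-integrable setT (EFin \o (fun x => g x * f x)).
Proof.
move=> mg gM fi.
have h : mu.-integrable setT ((EFin \o g) \* (EFin \o f))%E.
  apply: integrableMr => //; exists M; split; first by rewrite num_real.
  by move=> x Mx y _ /=; apply: le_trans (gM y) (ltW Mx).
by apply: eq_integrable h => // x _ /=; rewrite EFinM.
Qed.

Lemma integrable_bounded (mu : {finite_measure set T -> \bar R}) f (M : R) :
  measurable_fun setT f -> (forall x, `|f x| <= M) ->
  mu.-integrable setT (EFin \o f).
Proof.
move=> mf fM; apply: measurable_bounded_integrable => //.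
  exact: fin_num_fun_lty.
exists M; split; first by rewrite num_real.
by move=> x Mx y _ /=; apply: le_trans (fM y) (ltW Mx).
Qed.

Lemma integrable_addr mu f g : mu.-integrable setT (EFin \o f) ->
  mu.-integrable setT (EFin \o g) ->
  mu.-integrable setT (EFin \o (fun x => f x + g x)).
Proof. by move=> fi gi; apply: eq_integrable (integrableD _ fi gi). Qed.

Lemma integrable_subr mu f g : mu.-integrable setT (EFin \o f) ->
  mu.-integrable setT (EFin \o g) ->
  mu.-integrable setT (EFin \o (fun x => f x - g x)).
Proof. by move=> fi gi; apply: eq_integrable (integrableB _ fi gi). Qed.

Lemma integrable_scaler mu f (c : R) : mu.-integrable setT (EFin \o f) ->
  mu.-integrable setT (EFin \o (fun x => c * f x)).
Proof. by move=> fi; apply: eq_integrable (integrableZl _ c fi). Qed.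

Lemma integrable_sumr mu (I : Type) (s : seq I) (Q : pred I) (F : I -> T -> R) :
  (forall i, Q i -> mu.-integrable setT (EFin \o F i)) ->
  mu.-integrable setT (EFin \o (fun x => \sum_(i <- s | Q i) F i x)).
Proof.
move=> Fi; have := @integrable_sum _ _ _ mu setT measurableT I s Q (fun i => EFin \o F i) Fi.
by apply: eq_integrable => // x _ /=; rewrite sumEFin.
Qed.

Lemma Rintegral_sumr mu (I : Type) (s : seq I) (Q : pred I) (F : I -> T -> R) :
  (forall i, Q i -> mu.-integrable setT (EFin \o F i)) ->
  \int[mu]_x (\sum_(i <- s | Q i) F i x) = \sum_(i <- s | Q i) \int[mu]_x F i x.
Proof.
move=> Fi; elim: s => [|i s IH].
  by under eq_Rintegral do rewrite big_nil; rewrite big_nil Rintegral_cst// mul0r.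
rewrite big_cons; case: ifPn => Qi; last first.
  by rewrite -IH; apply: eq_Rintegral => x _; rewrite big_cons (negbTE Qi).
rewrite -IH -RintegralD//; [|exact: Fi|exact: integrable_sumr].
by apply: eq_Rintegral => x _; rewrite big_cons Qi.
Qed.

Lemma le_normr_Rintegral_le mu f g : mu.-integrable setT (EFin \o f) ->
  mu.-integrable setT (EFin \o g) -> (forall x, `|f x| <= g x) ->
  `|\int[mu]_x f x| <= \int[mu]_x g x.
Proof.
move=> fi gi fg; apply: le_trans (le_normr_Rintegral _ fi) _ => //.
by apply: le_Rintegral => //; exact: integrable_norm.
Qed.

Lemma Rintegral_dominated_cvg mu (fk : nat -> T -> R) f g :
  (forall k, measurable_fun setT (fk k)) -> measurable_fun setT f ->
  (forall x, fk k x @[k --> \oo] --> f x) -> mu.-integrable setT (EFin \o g) ->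
  (forall k x, `|fk k x| <= g x) ->
  \int[mu]_x fk k x @[k --> \oo] --> \int[mu]_x f x.
Proof.
move=> mfk mf cf gi fg.
have [] := @dominated_convergence _ _ _ mu setT measurableT (fun k => EFin \o fk k)
    (EFin \o f) (EFin \o g).
- by move=> k; apply/measurable_EFinP.
- exact/measurable_EFinP.
- by apply: aeW => x _; apply: cvg_EFin; [near=> k|exact: cf].
- exact: gi.
- by apply: aeW => x k _; rewrite lee_fin.
by move=> fi _; rewrite -EFin_Rintegral//; exact: fine_cvg.
Unshelve. all: by end_near. Qed.

End integral_toolkit.

(** Splitting [f] into its positive and negative parts carries a change of
    variables over from nonnegative functions to integrable ones. It serves for
    affine maps of R^d and for the rescaling of a sample point. *)
Lemma change_of_variables {R : realType} (d1 d2 : measure_display) (T1 : measurableType d1)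
    (T2 : measurableType d2) (m1 : {measure set T1 -> \bar R})
    (m2 : {measure set T2 -> \bar R}) (phi : T2 -> T1) (c : R) (f : T1 -> R) :
  measurable_fun setT phi -> 0 < c ->
  (forall F : T1 -> \bar R, measurable_fun setT F -> (forall x, 0 <= F x)%E ->
    (\int[m1]_x F x = c%:E * \int[m2]_l F (phi l))%E) ->
  m1.-integrable setT (EFin \o f) ->
  m2.-integrable setT (EFin \o (f \o phi)) /\
  \int[m1]_x f x = c * \int[m2]_l f (phi l).
Proof.
move=> mphi c0 cv fi.
have mf : measurable_fun setT f by apply/measurable_EFinP; exact: measurable_int fi.
have mfa : measurable_fun setT (f \o phi) by exact: measurableT_comp.
have gi : m2.-integrable setT (EFin \o (f \o phi)).
  apply/integrableP; split; first exact/measurable_EFinP.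
  have /integrableP[_] := fi.
  rewrite (cv (fun x => `|(f x)%:E|%E))//; last first.
    by apply: measurableT_comp => //; exact/measurable_EFinP.
  set I := (X in (_ * X)%E); have I0 : (0 <= I)%E by exact: integral_ge0.
  rewrite -/I; case: I I0 => [r|//|] // _; rewrite ?ltry// gt0_muley//.
split=> //; apply: EFin_inj; rewrite EFinM !EFin_Rintegral//.
rewrite [in LHS]integralE [in RHS]integralE.
rewrite (cv ((EFin \o f)^\+)%E)//; last first.
  by apply: measurable_funepos; exact/measurable_EFinP.
rewrite (cv ((EFin \o f)^\-)%E)//; last first.
  by apply: measurable_funeneg; exact/measurable_EFinP.
set P := (X in (_ * X - _)%E = _); set N := (X in (_ * _ - _ * X)%E = _).
have PE : P = (\int[m2]_x (EFin \o (f \o phi))^\+ x)%E.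
  by apply: eq_integral => x _; rewrite !funeposE.
have NE : N = (\int[m2]_x (EFin \o (f \o phi))^\- x)%E.
  by apply: eq_integral => x _; rewrite !funenegE.
have Pf : P \is a fin_num by rewrite PE; exact: integrable_pos_fin_num.
have := @muleBr R c%:E P N isT (fin_num_adde_defr _ Pf).
by move=> <-; rewrite PE NE.
Qed.

Section affine.
Context {R : realType}.

Definition affine1 (a b : R) (l : measurableTypeR R) : measurableTypeR R := b + a * l.

Lemma measurable_affine1 a b : measurable_fun setT (affine1 a b).
Proof. by apply: measurable_funD => //; exact: measurable_funM. Qed.

HB.instance Definition _ a b := isMeasurableFun.Build _ _ _ _
  (affine1 a b) (@measurable_affine1 a b).

(** A multiple of the image measure has the right values on intervals, and these
    determine Lebesgue measure. *)
Lemma lebesgue_measure_affine (a b : R) (A : set (measurableTypeR R)) : a != 0 -> measurable A ->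
  lebesgue_measure A =
  (`|a|%:E * pushforward lebesgue_measure (affine1 a b) A)%E.
Proof.
move=> a0 mA.
have na : 0 <= `|a| by [].
have : lebesgue_measure A = mscale (NngNum na) (pushforward lebesgue_measure (affine1 a b)) A.
  move=> maff; apply: lebesgue_measure_unique => // _ [[x y]] _ <-.
  rewrite lebesgue_measure_itv/= /mscale/= /pushforward/=.
  have [a_gt0|a_lt0] : 0 < a \/ a < 0 by move: a0; rewrite neq_lt => /orP[]; tauto.
    rewrite (_ : affine1 a b @^-1` _ = `](x - b) / a, (y - b) / a]%classic); last first.
      apply/seteqP; split=> l /=; rewrite /affine1 !in_itv/= ltr_pdivrMr// ler_pdivlMr//;
        move=> /andP[? ?]; apply/andP; split; lra.
    rewrite [in RHS]lebesgue_measure_itv/= !lte_fin ltr_pM2r ?invr_gt0// ltrD2r.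
    case: ifPn; rewrite ?mule0// => xy; rewrite -!EFinD -EFinM; congr EFin.
    by rewrite gtr0_norm//; field; rewrite gt_eqF.
  rewrite (_ : affine1 a b @^-1` _ = `[(y - b) / a, (x - b) / a[%classic); last first.
    apply/seteqP; split=> l /=; rewrite /affine1 !in_itv/= ltr_ndivlMr// ler_ndivrMr//;
      move=> /andP[? ?]; apply/andP; split; lra.
  rewrite [in RHS]lebesgue_measure_itv/= !lte_fin ltr_nM2r ?invr_lt0// ltrD2r.
  case: ifPn; rewrite ?mule0// => xy; rewrite -!EFinD -EFinM; congr EFin.
  by rewrite ltr0_norm//; field; rewrite lt_eqF.
by move=> /(_ (measurable_affine1 a b)).
Qed.

Lemma ge0_integral_affine1 (a b : R) (F : measurableTypeR R -> \bar R) : a != 0 ->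
  measurable_fun setT F -> (forall x, 0 <= F x)%E ->
  (\int[lebesgue_measure]_x F x =
   `|a|%:E * \int[lebesgue_measure]_l F (affine1 a b l))%E.
Proof.
move=> a0 mF F0; have na : 0 <= `|a| by [].
have /(_ (measurable_affine1 a b)) -> : (\int[lebesgue_measure]_x F x =
    \int[mscale (NngNum na) (pushforward lebesgue_measure (affine1 a b))]_x F x)%E.
  by move=> maff; apply: eq_measure_integral => A mA _; exact: lebesgue_measure_affine.
rewrite ge0_integral_mscale//=; congr (_ * _)%E.
by rewrite ge0_integral_pushforward.
Qed.

Lemma ge0_integral_rVS d (F : 'rV[R]_d.+1 -> \bar R) :
  measurable_fun setT F -> (forall x, 0 <= F x)%E ->
  (\int[lebesgue_rV d.+1]_x F x =
   \int[lebesgue_measure]_x \int[lebesgue_rV d]_v F (rV_cons (x, v)))%E.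
Proof.
move=> mF F0.
rewrite [LHS](@ge0_integral_pushforward _ _ _ _ _ (@rV_cons R d) _ (lebesgue_measure \x lebesgue_rV d)%E setT F)//.
rewrite preimage_setT fubini_tonelli1//=.
by apply: measurableT_comp => //; exact: measurable_rV_cons.
Qed.

Lemma measurable_affine d (a : R) (b : 'rV[R]_d) :
  measurable_fun setT (fun l : 'rV[R]_d => b + a *: l).
Proof.
apply/measurable_fun_rVP => i; under eq_fun do rewrite !mxE.
by apply: measurable_funD => //; apply: measurable_funM => //; exact: measurable_coord.
Qed.

(** One coordinate at a time, by Tonelli. *)
Lemma ge0_integral_affine d (a : R) (b : 'rV[R]_d) (F : 'rV[R]_d -> \bar R) : a != 0 ->
  measurable_fun setT F -> (forall x, 0 <= F x)%E ->
  (\int[lebesgue_rV d]_x F x =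
   (`|a| ^+ d)%:E * \int[lebesgue_rV d]_l F (b + a *: l)%R)%E.
Proof.
move=> a0; elim: d b F => [|d IH] b F mF F0.
  rewrite expr0 mul1e; apply: eq_integral => x _; congr F.
  by apply/rowP => -[].
have mFa : measurable_fun setT (fun l : 'rV[R]_d.+1 => F (b + a *: l)).
  by apply: measurableT_comp => //; exact: measurable_affine.
rewrite !ge0_integral_rVS//.
have mFc : measurable_fun setT (F \o (@rV_cons R d)).
  by apply: measurableT_comp => //; exact: measurable_rV_cons.
have mI : measurable_fun setT (fun x : measurableTypeR R => \int[lebesgue_rV d]_v F (rV_cons (x, v)))%E.
  apply: (@measurable_fun_fubini_tonelli_F _ _ _ _ _ (lebesgue_rV d) (F \o (@rV_cons R d))) => //.
  by move=> x; exact: F0.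
rewrite [LHS](ge0_integral_affine1 (b ord0 ord0) a0 mI); last first.
  by move=> x; apply: integral_ge0.
pose b' := \row_(j < d) b ord0 (lift ord0 j).
rewrite exprS EFinM -muleA; congr (_ * _)%E.
rewrite -ge0_integralZl//; first last.
- by move=> x _; apply: integral_ge0.
- apply: (@measurable_fun_fubini_tonelli_F _ _ _ _ _ (lebesgue_rV d) ((fun l : 'rV[R]_d.+1 => F (b + a *: l)) \o (@rV_cons R d))) => [|x]; last exact: F0.
  exact: (measurableT_comp mFa (@measurable_rV_cons R d)).
apply: eq_integral => x _.
rewrite (IH b' (fun v => F (rV_cons (affine1 a (b ord0 ord0) x, v))))//; last first.
  exact: (measurableT_comp mFc (measurable_pair1 _)).
congr (_ * _)%E; apply: eq_integral => v _; congr F.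
apply/rowP => i; rewrite !mxE; case: unliftP => [j ->|->]; rewrite ?mxE//.
Qed.

Lemma integral_affine d (a : R) (b : 'rV[R]_d) (f : 'rV[R]_d -> R) : a != 0 ->
  (lebesgue_rV d).-integrable setT (EFin \o f) ->
  (lebesgue_rV d).-integrable setT (EFin \o (fun l => f (b + a *: l))) /\
  \int[lebesgue_rV d]_x f x = `|a| ^+ d * \int[lebesgue_rV d]_l f (b + a *: l).
Proof.
move=> a0; apply: change_of_variables; first exact: measurable_affine.
  by rewrite exprn_gt0// normr_gt0.
by move=> F mF F0; exact: ge0_integral_affine.
Qed.

End affine.

Section line_derivative.
Context {R : realType}.

Lemma is_derive_line d (g : 'rV[R]_d -> R) (x v : 'rV[R]_d) (t : R) :
  derivable g (x + t *: v) v ->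
  is_derive t 1 (fun s : R => g (x + s *: v)) ('D_v g (x + t *: v)).
Proof.
have E : (fun h : R => h^-1 *: ((fun s : R => g (x + s *: v)) (h *: (1 : R) + t) - g (x + t *: v))) =
         (fun h : R => h^-1 *: (g (h *: v + (x + t *: v)) - g (x + t *: v))).
  apply/funext => h; congr (_ *: (g _ - _)).
  by rewrite [h *: 1]mulr1 scalerDl addrA [in RHS]addrC -!addrA; congr (_ + _); rewrite addrC.
move=> dg; apply: DeriveDef; first by rewrite /derivable E.
by rewrite /derive E.
Qed.

(** The derivative as the limit of a sequence: measurability of limits and
    dominated convergence are about sequences. *)
Lemma cvg_diff_quotient d (g : 'rV[R]_d -> R) (x v : 'rV[R]_d) :
  derivable g x v ->
  k.+1%:R * (g (x + k.+1%:R^-1 *: v) - g x) @[k --> \oo] --> 'D_v g x.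
Proof.
move=> dg.
have h0 : (@harmonic R) n @[n --> \oo] --> 0^'.
  move=> A A0; have H : \forall n \near \oo, (harmonic n != 0 :> R -> A (harmonic n)) :=
    @cvg_harmonic R (fun y => y != 0 -> A y) A0.
  by apply: filterS H => n; apply; rewrite gt_eqF// invr_gt0.
have := cvg_comp _ _ h0 dg.
apply: cvg_trans; apply: near_eq_cvg; near=> k => /=.
by rewrite invrK; congr (_ *: (g _ - _)); rewrite addrC.
Unshelve. all: by end_near. Qed.

Lemma compact_cube d (r : R) : compact (@cube R d r).
Proof.
have -> : @cube R d r = [set v | forall i, `[- r, r]%classic (v ord0 i)].
  by apply/seteqP; split=> v /= h i; have := h i; rewrite in_itv.
by apply: (@rV_compact R d (fun=> `[- r, r]%classic)) => i; exact: segment_compact.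
Qed.

Lemma closed_cube d (r : R) : closed (@cube R d r).
Proof. by apply: compact_closed; [exact: norm_hausdorff|exact: compact_cube]. Qed.

Lemma measurable_cube d (r : R) : measurable (@cube R d r).
Proof.
have -> : @cube R d r = [set v | forall i, `[- r, r]%classic (v ord0 i)].
  by apply/seteqP; split=> v /= h i; have := h i; rewrite in_itv.
by apply: (@measurable_rV_box R d (fun=> `[- r, r]%classic)) => i; exact: measurable_itv.
Qed.

Lemma lebesgue_cube_lty d (r : R) : (lebesgue_rV d (@cube R d r) < +oo)%E.
Proof.
have -> : @cube R d r = [set v | forall i, `[- r, r]%classic (v ord0 i)].
  by apply/seteqP; split=> v /= h i; have := h i; rewrite in_itv.
rewrite (@lebesgue_rV_box R d (fun=> `[- r, r]%classic))//.
rewrite (eq_bigr (fun=> (fine (lebesgue_measure `[- r, r]%classic))%:E)); last first.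
  move=> i _; rewrite fineK// lebesgue_measure_itv/=; case: ifPn => //.
by rewrite prodEFin ltry.
Qed.

Lemma integrable_cube d (r M : R) :
  (lebesgue_rV d).-integrable setT (EFin \o (fun x => M * \1_(cube r) x)).
Proof.
have mc := @measurable_cube d r.
have ic : (lebesgue_rV d).-integrable setT (EFin \o \1_(@cube R d r)).
  apply/integrableP; split; first by apply/measurable_EFinP; exact: measurable_indic.
  under eq_integral do rewrite /= ger0_norm//.
  by rewrite integral_indic//= setIT lebesgue_cube_lty.
by apply: eq_integrable (integrableZl measurableT M ic).
Qed.

Lemma bounded_on_cube d (g : 'rV[R]_d -> R) (r : R) : continuous g ->
  (forall x, ~ cube r x -> g x = 0) -> exists2 M, 0 <= M & forall x, `|g x| <= M * \1_(cube r) x.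
Proof.
move=> cg g0.
have /compact_bounded [M0 [_ MP]] : compact (g @` cube r).
  apply: continuous_compact; last exact: compact_cube.
  exact: continuous_subspaceT.
exists (`|M0| + 1) => [|x]; first by rewrite addr_ge0.
have [xr|xr] := pselect (cube r x); last first.
  by rewrite g0// normr0 mulr_ge0// addr_ge0.
rewrite indicE mem_set// mulr1; apply: (MP (`|M0| + 1)); last by exists x.
by rewrite (le_lt_trans (ler_norm _))// ltrDl.
Qed.

Lemma integrable_on_cube d (g : 'rV[R]_d -> R) (r : R) : continuous g ->
  (forall x, ~ cube r x -> g x = 0) -> (lebesgue_rV d).-integrable setT (EFin \o g).
Proof.
move=> cg g0; have [M M0 gM] := bounded_on_cube cg g0.
apply: (le_integrable _ _ _ (integrable_cube d r M)) => //.
  by apply/measurable_EFinP; exact: continuous_measurable_rV.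
by move=> x _ /=; rewrite lee_fin [leRHS]ger0_norm// mulr_ge0.
Qed.

Lemma partial_eq0 d (g : 'rV[R]_d -> R) (r : R) j :
  (forall x, ~ cube r x -> g x = 0) -> forall x, ~ cube r x -> partial j g x = 0.
Proof.
move=> g0 x xr; rewrite /partial.
rewrite (@near_eq_derive _ _ _ _ (cst 0)) ?derive_cst//.
have : nbhs x (~` cube r).
  by apply: open_nbhs_nbhs; split=> //; rewrite openC; exact: closed_cube.
by apply: filterS => y /g0.
Qed.

(** Differentiate the translation-invariant quantity [\int g (x + t e_j) dx]
    at [t = 0]. *)
Lemma integral_partial_eq0 d (g : 'rV[R]_d -> R) (r : R) j : 0 <= r -> C1 g ->
  (forall x, ~ cube r x -> g x = 0) -> \int[lebesgue_rV d]_x partial j g x = 0.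
Proof.
move=> r0 [dg cpg] g0.
have cg : continuous g by move=> x; exact: differentiable_continuous.
have [M M0 gM] := bounded_on_cube (cpg j) (@partial_eq0 d g r j g0).
have gi := integrable_on_cube cg g0.
have pgi := integrable_on_cube (cpg j) (@partial_eq0 d g r j g0).
pose e : 'rV[R]_d := delta_mx ord0 j.
(* Steps at most [1], so that all difference quotients vanish off one cube. *)
pose D (k : nat) (x : 'rV[R]_d) := k.+1%:R * (g (x + k.+1%:R^-1 *: e) - g x).
have mg : measurable_fun setT g by exact: continuous_measurable_rV.
have gti k : (lebesgue_rV d).-integrable setT (EFin \o (fun x => g (x + k.+1%:R^-1 *: e))) /\
    \int[lebesgue_rV d]_x g (x + k.+1%:R^-1 *: e) = \int[lebesgue_rV d]_x g x.
  have [] := @integral_affine R d 1 (k.+1%:R^-1 *: e) g (oner_neq0 _) gi.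
  rewrite normr1 expr1n mul1r (_ : (fun l => g (_ + 1 *: l)) = (fun x => g (x + k.+1%:R^-1 *: e))); last first.
    by apply/funext => l; rewrite scale1r addrC.
  by move=> ? ->.
have mD k : measurable_fun setT (D k).
  apply: measurable_funM => //; apply: measurable_funB => //.
  by apply/measurable_EFinP; have [/measurable_int] := gti k.
have ID k : \int[lebesgue_rV d]_x D k x = 0.
  rewrite /D RintegralZl//.
    by rewrite RintegralB// ?(gti k).2 ?subrr ?mulr0//; exact: (gti k).1.
  by apply: integrable_subr => //; exact: (gti k).1.
have DM k x : `|D k x| <= M * \1_(cube (r + 1)) x.
  have k0 : 0 < k.+1%:R^-1 :> R by rewrite invr_gt0.
  have [c /[!in_itv]/= /andP[c0 ck] Ec] : exists2 c, c \in `[0, k.+1%:R^-1] &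
      g (x + k.+1%:R^-1 *: e) - g (x + 0 *: e) = partial j g (x + c *: e) * (k.+1%:R^-1 - 0).
    have isd (t : R) : is_derive t 1 (fun s : R => g (x + s *: e)) (partial j g (x + t *: e)).
      by apply: is_derive_line; exact: diff_derivable.
    apply: (@MVT_segment R (fun s : R => g (x + s *: e)) (fun s : R => partial j g (x + s *: e)) 0 k.+1%:R^-1 (ltW k0)).
    apply: continuous_subspaceT => t.
    by apply: differentiable_continuous; apply/derivable1_diffP; have [] := isd t.
  rewrite /D; move: Ec; rewrite scale0r addr0 subr0 => ->.
  rewrite mulrCA mulfV// mulr1 (le_trans (gM _))// ler_wpM2l//.
  have [xc|xc] := pselect (cube r (x + c *: e)); last by rewrite indicE memNset.
  rewrite !indicE !mem_set// => i; have := xc i; rewrite !mxE eqxx/=.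
  have c1 : c <= 1 by rewrite (le_trans ck)// invf_le1// ler1n.
  by case: (i == j); rewrite ?mulr1 ?mulr0 => /andP[? ?]; apply/andP; split; lra.
have : \int[lebesgue_rV d]_x D k x @[k --> \oo] --> \int[lebesgue_rV d]_x partial j g x.
  apply: (Rintegral_dominated_cvg _ _ _ (integrable_cube d (r + 1) M) DM) => //.
  - exact: continuous_measurable_rV.
  - by move=> x; apply: cvg_diff_quotient; exact: diff_derivable.
under eq_fun do rewrite ID.
by move=> /(cvg_lim (@Rhausdorff R)); rewrite lim_cst.
Qed.

End line_derivative.

(** * Densities *)

Section weighted_integral.
Context {R : realType} {dT : measure_display} {T : measurableType dT}.

Section one_side.
Context {dS : measure_display} {S : measurableType dS}.
Variables (m : {measure set S -> \bar R}) (X : S -> T) (W : S -> R).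
Hypotheses (mX : measurable_fun setT X) (mW : measurable_fun setT W)
  (W0 : forall s, 0 <= W s).

Import HBNNSimple.

Lemma measurable_nnsfun_preimage (h : {nnsfun T >-> R}) y : measurable (h @^-1` [set y]).
Proof. by []. Qed.

Lemma weighted_integral_nnsfun (h : {nnsfun T >-> R}) :
  (\int[m]_s (h (X s) * W s)%:E =
   \sum_(y \in range h) y%:E * \int[m]_s (\1_(h @^-1` [set y]) (X s) * W s)%:E)%E.
Proof.
transitivity (\int[m]_s (\sum_(y \in range h)
    (y%:E * (\1_(h @^-1` [set y]) (X s) * W s)%:E)))%E.
  apply: eq_integral => s _; rewrite fimfunE EFinM -fsumEFin// ge0_mule_fsuml.
    by apply: eq_fsbigr => y _; rewrite -!EFinM mulrA.
  by move=> y; exact: nnfun_muleindic_ge0.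
have mI y : measurable_fun setT (fun s => (\1_(h @^-1` [set y]) (X s) * W s)%:E).
  apply/measurable_EFinP/measurable_funM => //.
  by apply: measurableT_comp => //; exact: measurable_indic.
rewrite ge0_integral_fsum//.
- apply: eq_fsbigr => r; rewrite inE => -[t _ <-].
  rewrite ge0_integralZl ?lee_fin//.
  by move=> s _; rewrite lee_fin mulr_ge0.
- by move=> y; apply: measurable_funeM.
- move=> y s _; rewrite EFinM muleA mule_ge0 ?lee_fin//.
  exact: nnfun_muleindic_ge0.
Qed.

Lemma weighted_integral_approx (f : T -> \bar R) (mf : measurable_fun setT f) :
  (forall x, 0 <= f x)%E ->
  (\int[m]_s (f (X s) * (W s)%:E) =
   limn (fun n => \int[m]_s (nnsfun_approx measurableT mf n (X s) * W s)%:E))%E.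
Proof.
move=> f0; pose h := nnsfun_approx measurableT mf.
rewrite -monotone_convergence//.
- apply: eq_integral => s _; apply/esym/cvg_lim => //.
  under eq_fun do rewrite EFinM.
  by apply: cvgeZr => //; exact: cvg_nnsfun_approx.
- move=> n; apply/measurable_EFinP/measurable_funM => //.
  by apply: measurableT_comp.
- by move=> n s _; rewrite lee_fin mulr_ge0.
- move=> s _ a b ab; rewrite lee_fin ler_wpM2r//.
  exact/lefP/nd_nnsfun_approx.
Qed.

End one_side.

Context {d1 d2 : measure_display} {S1 : measurableType d1} {S2 : measurableType d2}.
Variables (m1 : {measure set S1 -> \bar R}) (m2 : {measure set S2 -> \bar R}).
Variables (X1 : S1 -> T) (X2 : S2 -> T) (W1 : S1 -> R) (W2 : S2 -> R).
Hypotheses (mX1 : measurable_fun setT X1) (mX2 : measurable_fun setT X2).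
Hypotheses (mW1 : measurable_fun setT W1) (mW2 : measurable_fun setT W2).
Hypotheses (W10 : forall s, 0 <= W1 s) (W20 : forall s, 0 <= W2 s).
Hypothesis eqI : forall A, measurable A ->
  (\int[m1]_s (\1_A (X1 s) * W1 s)%:E = \int[m2]_s (\1_A (X2 s) * W2 s)%:E)%E.

(** Change of variables for two weighted images of measures at once, by simple
    functions. With weight [1] on one side and a density on the other it computes
    expectations; with weight [1] on both sides it compares laws. *)
Lemma ge0_weighted_integral_ext (f : T -> \bar R) :
  measurable_fun setT f -> (forall x, 0 <= f x)%E ->
  (\int[m1]_s (f (X1 s) * (W1 s)%:E) = \int[m2]_s (f (X2 s) * (W2 s)%:E))%E.
Proof.
move=> mf f0; rewrite !(weighted_integral_approx _ _ _ _ mf)//.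
congr (limn _); apply/funext => n; rewrite !weighted_integral_nnsfun//.
apply: eq_fsbigr => y _; rewrite eqI//.
exact: measurable_nnsfun_preimage.
Qed.

(** Adding [M] to [f] makes it nonnegative. *)
Lemma weighted_integral_ext (f : T -> R) (M : R) :
  m1.-integrable setT (EFin \o W1) -> m2.-integrable setT (EFin \o W2) ->
  measurable_fun setT f -> (forall x, `|f x| <= M) ->
  \int[m1]_s (f (X1 s) * W1 s) = \int[m2]_s (f (X2 s) * W2 s).
Proof.
move=> W1i W2i mf fM.
have fX1 : m1.-integrable setT (EFin \o (fun s => f (X1 s) * W1 s)).
  by apply: (@integrable_bounded_mul _ _ _ _ _ _ M) => //; exact: measurableT_comp.
have fX2 : m2.-integrable setT (EFin \o (fun s => f (X2 s) * W2 s)).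
  by apply: (@integrable_bounded_mul _ _ _ _ _ _ M) => //; exact: measurableT_comp.
have EW : \int[m1]_s W1 s = \int[m2]_s W2 s.
  have := eqI measurableT; rewrite /Rintegral => H; congr fine.
  transitivity (\int[m1]_s (\1_[set: T] (X1 s) * W1 s)%:E)%E.
    by apply: eq_integral => s _; rewrite indicT mul1r.
  by rewrite H; apply: eq_integral => s _; rewrite indicT mul1r.
have : \int[m1]_s (f (X1 s) * W1 s + M * W1 s) = \int[m2]_s (f (X2 s) * W2 s + M * W2 s).
  have := ge0_weighted_integral_ext (f := fun x => (f x + M)%:E).
  rewrite /Rintegral => H; congr fine.
  transitivity (\int[m1]_s ((f (X1 s) + M)%:E * (W1 s)%:E))%E.
    by apply: eq_integral => s _; rewrite -EFinM mulrDl.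
  rewrite H.
  - by apply: eq_integral => s _; rewrite -EFinM mulrDl.
  - by apply/measurable_EFinP; apply: measurable_funD.
  - by move=> x; rewrite lee_fin -lerBlDr sub0r; have := fM x; rewrite ler_norml => /andP[].
rewrite !RintegralD//; try exact: integrable_scaler.
by rewrite !RintegralZl// EW => /addIr.
Qed.

End weighted_integral.

Section density.
Context {R : realType} {dO : measure_display} {O : measurableType dO} (P : probability O R).
Context {dT : measure_display} {T : measurableType dT} (nu : {measure set T -> \bar R}).
Variables (X : {RV P >-> T}) (g : T -> R).
Hypothesis Xg : has_density nu X g.

Lemma density_integrable : nu.-integrable setT (EFin \o g) /\ \int[nu]_x g x = 1.
Proof.
have [mg g0 gE] := Xg.
have := gE _ measurableT; rewrite probability_setT => /esym E1.
split; last by rewrite /Rintegral E1.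
apply/integrableP; split; first exact/measurable_EFinP.
under eq_integral do rewrite /= ger0_norm//.
by rewrite E1 ltry.
Qed.

Lemma expectation_density (F : T -> R) (M : R) :
  measurable_fun setT F -> (forall x, `|F x| <= M) ->
  \int[P]_w F (X w) = \int[nu]_x (F x * g x).
Proof.
move=> mF FM; have [mg g0 gE] := Xg; have [gi _] := density_integrable.
rewrite -(@weighted_integral_ext R dT T _ _ O T P nu X id (cst 1) g _ _ _ _ _ _ _ F M)//.
- by apply: eq_Rintegral => w _; rewrite mulr1.
- move=> A mA.
  transitivity (\int[nu]_(x in A) (g x)%:E)%E.
    rewrite -gE//; transitivity (\int[P]_s (\1_(X @^-1` A) s)%:E)%E.
      by apply: eq_integral => w _; rewrite mulr1 !indicE; congr (_ %:R%:E); apply/idP/idP; rewrite !inE.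
    by rewrite integral_indic//= ?setIT// -[X in measurable X]setTI; exact: measurable_funP.
  rewrite integral_mkcond; apply: eq_integral => x _.
  by rewrite patchE indicE; case: ifPn; rewrite ?mul1r ?mul0r.
- exact: finite_measure_integrable_cst.
Qed.

End density.

Section scheffe.
Context {R : realType} {dT : measure_display} {T : measurableType dT}.
Variable nu : {measure set T -> \bar R}.

(** Scheffe: the positive part [max (f0 - fk) 0] is dominated by [f0], and the
    two parts of [f0 - fk] have the same integral. *)
Lemma scheffe (fk : nat -> T -> R) (f0 : T -> R) (psi : T -> R) (M : R) :
  (forall k x, 0 <= fk k x) -> (forall x, 0 <= f0 x) ->
  (forall k, nu.-integrable setT (EFin \o fk k)) -> nu.-integrable setT (EFin \o f0) ->
  (forall k, \int[nu]_x fk k x = \int[nu]_x f0 x) ->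
  (forall x, fk k x @[k --> \oo] --> f0 x) ->
  measurable_fun setT psi -> (forall x, `|psi x| <= M) ->
  \int[nu]_x (psi x * fk k x) @[k --> \oo] --> \int[nu]_x (psi x * f0 x).
Proof.
move=> fk0 f00 fki f0i If cf mpsi psiM.
have [M0|M0] := ltP M 0.
  have noT (x : T) : False by have := le_lt_trans (psiM x) M0; rewrite normr_lt0.
  rewrite (_ : (fun k => _) = cst (\int[nu]_x (psi x * f0 x))); first exact: cvg_cst.
  by apply/funext => k; apply: eq_Rintegral => x _; case: (noT x).
pose g k x := Num.max (f0 x - fk k x) 0.
have mfk k : measurable_fun setT (fk k) by apply/measurable_EFinP; exact: measurable_int (fki k).
have mf0 : measurable_fun setT f0 by apply/measurable_EFinP; exact: measurable_int f0i.
have mg k : measurable_fun setT (g k).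
  by apply: measurable_maxr => //; exact: measurable_funB.
have gf0 k x : `|g k x| <= f0 x.
  rewrite ger0_norm ?le_max ?lexx ?orbT//.
  by rewrite ge_max f00 andbT gerBl.
have gi k : nu.-integrable setT (EFin \o g k).
  apply: le_integrable f0i => //; first exact/measurable_EFinP.
  by move=> x _; rewrite lee_fin (le_trans (gf0 k x))// ler_norm.
have Ig : \int[nu]_x g k x @[k --> \oo] --> 0.
  rewrite [X in _ --> X](_ : 0 = \int[nu]_x (cst 0 x)); last by rewrite Rintegral_cst// mul0r.
  apply: (Rintegral_dominated_cvg _ _ _ f0i gf0) => // x.
  apply/cvgrPdist_le => e e0; move/cvgrPdist_le : (cf x) => /(_ e e0).
  apply: filterS => k H; rewrite sub0r normrN /=.
  rewrite [`|g k x|]ger0_norm ?le_max ?lexx ?orbT//.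
  by rewrite ge_max (ltW e0) andbT (le_trans (ler_norm _)).
apply/cvgrPdist_le => e e0.
move/cvgrPdist_le : Ig => /(_ (e / (2 * (M + 1)))) /= [|N _ HN].
  by rewrite divr_gt0// mulr_gt0// ltr_wpDl.
exists N => //= k /HN; rewrite sub0r normrN => Hk.
have di : nu.-integrable setT (EFin \o (fun x => f0 x - fk k x)) by exact: integrable_subr.
have pi h : nu.-integrable setT (EFin \o h) -> nu.-integrable setT (EFin \o (fun x => psi x * h x)).
  exact: integrable_bounded_mul.
rewrite -RintegralB//; [|exact: pi|exact: pi].
apply: (@le_trans _ _ (\int[nu]_x (M * (2 * g k x - (f0 x - fk k x))))).
  apply: le_normr_Rintegral_le.
  - by apply: integrable_subr; exact: pi.
  - by apply/integrable_scaler/integrable_subr => //; exact: integrable_scaler.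
  move=> x; rewrite -mulrBr normrM ler_pM//.
  rewrite /g; case: (leP (f0 x - fk k x) 0) => h; [rewrite ler0_norm//|rewrite gtr0_norm//]; lra.
rewrite RintegralZl//; last by apply: integrable_subr => //; exact: integrable_scaler.
rewrite RintegralB//; last exact: integrable_scaler.
rewrite RintegralZl// [X in _ - X]RintegralB// If subrr subr0.
have I0 : 0 <= \int[nu]_x g k x by apply: Rintegral_ge0 => x _; rewrite le_max lexx orbT.
move: Hk; rewrite ger0_norm// ler_pdivlMr ?mulr_gt0 ?ltr_wpDl// => Hk.
by apply: le_trans Hk; nra.
Qed.

End scheffe.

Section sample_law.
Context {R : realType} {d n : nat} {dO : measure_display} {O : measurableType dO}.
Variable P : probability O R.
Variables (f : 'rV[R]_d -> 'rV[R]_n -> R) (lambda0 : 'rV[R]_d) (h : R).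
Variable X : {RV P >-> ('rV[R]_d * 'rV[R]_n)%type}.
Hypothesis h0 : 0 < h.
Hypothesis Xdens : has_density (lebesgue_rV d \x lebesgue_rV n)%E X
        (fun lz => cube_pdf h (lambda0 - lz.1) * f lz.1 lz.2).

Local Notation mu := (@lebesgue_rV R d \x @lebesgue_rV R n)%E.

(** Up to the factor [2 ^- d], the density of the pair formed by the rescaled
    parameter [(lambda0 - Lambda) / h] and [Z]. *)
Definition rescaled_density (lz : 'rV[R]_d * 'rV[R]_n) : R :=
  \1_(cube 1) lz.1 * f (lambda0 - h *: lz.1) lz.2.

Definition rescaled_parameter (lz : 'rV[R]_d * 'rV[R]_n) : 'rV[R]_d * 'rV[R]_n :=
  (h^-1 *: (lambda0 - lz.1), lz.2).

Let unscale (lz : 'rV[R]_d * 'rV[R]_n) : 'rV[R]_d * 'rV[R]_n :=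
  (lambda0 - h *: lz.1, lz.2).

Let measurable_unscale : measurable_fun setT unscale.
Proof.
apply/measurable_fun_pairP; split; last exact: measurable_snd.
rewrite (_ : _ \o _ = (fun l => lambda0 + (- h) *: l) \o fst).
  by apply: measurableT_comp; [exact: measurable_affine|exact: measurable_fst].
by apply/funext => -[l z] /=; rewrite scaleNr.
Qed.

Lemma measurable_rescaled_parameter : measurable_fun setT rescaled_parameter.
Proof.
apply/measurable_fun_pairP; split; last exact: measurable_snd.
rewrite (_ : _ \o _ = (fun l => h^-1 *: lambda0 + (- h^-1) *: l) \o fst).
  by apply: measurableT_comp; [exact: measurable_affine|exact: measurable_fst].
by apply/funext => -[l z] /=; rewrite scaleNr scalerBr.
Qed.

Lemma cube_pdf_unscale (l : 'rV[R]_d) : cube_pdf h (h *: l) = ((2 * h) ^+ d)^-1 * \1_(cube 1) l.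
Proof.
rewrite /cube_pdf !indicE; congr (_ * (nat_of_bool _)%:R); apply/idP/idP; rewrite !inE => H j.
  have := H j; rewrite mxE => /andP[h1 h2]; apply/andP; split.
    by rewrite -(ler_pM2l h0) mulrN1.
  by rewrite -(ler_pM2l h0) mulr1.
have := H j; rewrite mxE => /andP[h1 h2]; apply/andP; split.
  by rewrite -mulrN1 ler_pM2l.
by rewrite -[leRHS]mulr1 ler_pM2l.
Qed.

(** The Jacobian [h ^ d] of the rescaling cancels the normalization [(2 h) ^- d]
    of the uniform density, except for the constant [2 ^- d]. *)
Lemma rescaled_law :
  mu.-integrable setT (EFin \o rescaled_density) /\
  forall (F : 'rV[R]_d * 'rV[R]_n -> R) (M : R), measurable_fun setT F ->
    (forall x, `|F x| <= M) ->
    \int[P]_w F (rescaled_parameter (X w)) =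
    2 ^- d * \int[mu]_lz (F lz * rescaled_density lz).
Proof.
have [gi _] := density_integrable Xdens.
have hd0 : 0 < h ^+ d by rewrite exprn_gt0.
have cv F : measurable_fun setT F -> (forall x, 0 <= F x)%E ->
    (\int[mu]_x F x = (h ^+ d)%:E * \int[mu]_l F (unscale l))%E.
  move=> mF F0; have mFu : measurable_fun setT (F \o unscale) by exact: measurableT_comp.
  rewrite fubini_tonelli2// [in RHS]fubini_tonelli2//.
  rewrite -ge0_integralZl ?lee_fin//; last 3 first.
  - by apply: measurable_fun_fubini_tonelli_G => // x; exact: F0.
  - by move=> x _; apply: integral_ge0.
  - exact: ltW.
  apply: eq_integral => z _; rewrite /fubini_G.
  rewrite (@ge0_integral_affine R d (- h) lambda0 (fun l => F (l, z)))//.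
  - rewrite normrN gtr0_norm//; congr (_ * _)%E; apply: eq_integral => l _.
    by rewrite /unscale/= scaleNr.
  - by rewrite oppr_eq0 gt_eqF.
  - exact: (measurableT_comp mF (measurable_pair2 _)).
have gE lz : cube_pdf h (lambda0 - (unscale lz).1) * f (unscale lz).1 (unscale lz).2 =
    ((2 * h) ^+ d)^-1 * rescaled_density lz.
  by rewrite /unscale/= opprB addrC subrK cube_pdf_unscale mulrA.
have E2 : h ^+ d * ((2 * h) ^+ d)^-1 = 2 ^- d.
  by rewrite exprMn invfM mulrCA mulfV ?mulr1// gt_eqF.
have wi : mu.-integrable setT (EFin \o rescaled_density).
  have [gui _] := change_of_variables measurable_unscale hd0 cv gi.
  have := integrable_scaler ((2 * h) ^+ d) gui.
  apply: eq_integrable => // lz _ /=; rewrite gE mulrA mulfV ?mul1r//.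
  by rewrite gt_eqF// exprn_gt0// mulr_gt0.
split=> // F M mF FM.
rewrite (expectation_density Xdens (F := F \o rescaled_parameter) (M := M))//; last first.
- by move=> x; exact: FM.
- by apply: measurableT_comp => //; exact: measurable_rescaled_parameter.
have FGi : mu.-integrable setT (EFin \o (fun x => (F \o rescaled_parameter) x * (cube_pdf h (lambda0 - x.1) * f x.1 x.2))).
  apply: (@integrable_bounded_mul _ _ _ _ _ _ M) => //; last by move=> x; exact: FM.
  by apply: measurableT_comp => //; exact: measurable_rescaled_parameter.
have [_ ->] := change_of_variables measurable_unscale hd0 cv FGi.
rewrite -E2 -mulrA; congr (_ * _).
rewrite -RintegralZl//; last exact: (@integrable_bounded_mul _ _ _ _ _ _ M).
apply: eq_Rintegral => lz _; rewrite gE mulrCA; congr (_ * (F _ * _)).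
rewrite /rescaled_parameter /unscale /= opprB addrC subrK scalerA mulVf ?scale1r ?gt_eqF//.
by case: lz.
Qed.

End sample_law.

(** * Independent samples *)

Section independence.
Context {R : realType} {dO : measure_display} {O : measurableType dO} (P : probability O R).
Context {dT : measure_display} {T : measurableType dT}.

Lemma Rintegral_prob_cst (r : R) : \int[P]_w r = r.
Proof. rewrite Rintegral_cst//.
rewrite [fine _](_ : _ = fine 1%E) ?mulr1//; congr fine; exact: probability_setT. Qed.

Lemma Rintegral_indic_preimage (X : {RV P >-> T}) A : measurable A ->
  \int[P]_w \1_A (X w) = fine (P (X @^-1` A)).
Proof.
move=> mA; have mXA : measurable (X @^-1` A).
  by rewrite -[_ @^-1` _]setTI; apply: measurable_funP.
rewrite /Rintegral -[X @^-1` A]setIT -(@integral_indic _ _ R)//; congr fine.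
Qed.

(** Knowing how [W] correlates with the indicators of [X], one knows how it
    correlates with every bounded function of [X]: after adding [M] to [W] and to
    [c], both sides are integrals against nonnegative weights. *)
Lemma expectation_factor_ext (X : {RV P >-> T}) (W : O -> R) (c M : R) :
  measurable_fun setT W -> (forall w, `|W w| <= M) ->
  (forall A, measurable A -> \int[P]_w (\1_A (X w) * W w) = c * \int[P]_w \1_A (X w)) ->
  forall (F : T -> R) (B : R), measurable_fun setT F -> (forall x, `|F x| <= B) ->
  \int[P]_w (F (X w) * W w) = c * \int[P]_w F (X w).
Proof.
move=> mW WM H F B mF FB.
have Wi : P.-integrable setT (EFin \o W) by exact: integrable_bounded WM.
have FXi : P.-integrable setT (EFin \o (F \o X)).
  by apply: (@integrable_bounded _ _ _ _ _ B) => // [|w]; [exact: measurableT_comp|exact: FB].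
have cM : `|c| <= M.
  have := H _ measurableT.
  under eq_Rintegral do rewrite indicT mul1r.
  under [X in _ = _ * X]eq_Rintegral do rewrite indicT.
  rewrite [X in _ * X](_ : _ = 1) ?mulr1 => [<-|]; last exact: Rintegral_prob_cst.
  have Mi : P.-integrable setT (EFin \o cst M) by exact: finite_measure_integrable_cst.
  have := le_normr_Rintegral_le Wi Mi WM.
  by rewrite (Rintegral_prob_cst M).
have i1 A : measurable A -> P.-integrable setT (EFin \o (fun w => (\1_A (X w) : R))).
  move=> mA; apply: (@integrable_bounded _ _ _ _ _ 1) => [|w].
    by apply: measurableT_comp => //; exact: measurable_indic.
  by rewrite ger0_norm// indicE; case: (_ \in _).
have i2 A : measurable A -> P.-integrable setT (EFin \o (fun w => \1_A (X w) * W w)).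
  move=> mA; apply: (@integrable_bounded_mul _ _ _ _ _ _ 1) => // [|w].
    by apply: measurableT_comp => //; exact: measurable_indic.
  by rewrite ger0_norm// indicE; case: (_ \in _).
have i3 : P.-integrable setT (EFin \o (fun w => F (X w) * W w)).
  by apply: (@integrable_bounded_mul _ _ _ _ _ _ B) => //; exact: measurableT_comp.
have cst_i (r : R) : P.-integrable setT (EFin \o cst r) by exact: finite_measure_integrable_cst.
have : \int[P]_w (F (X w) * (W w + M)) = \int[P]_w (F (X w) * (c + M)).
  apply: (@weighted_integral_ext R dT T _ _ O O P P X X (fun w => W w + M) (cst (c + M)) _ _ _ _ _ _ _ F B) => //.
  - exact: measurable_funD.
  - by move=> w; rewrite -lerBlDr sub0r; have := WM w; rewrite ler_norml => /andP[].
  - by move=> w; rewrite -lerBlDr sub0r; have := cM; rewrite ler_norml => /andP[].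
  - move=> A mA.
    have ii1 : P.-integrable setT (EFin \o (fun w => \1_A (X w) * (W w + M))).
      apply: eq_integrable (integrable_addr (i2 A mA) (integrable_scaler M (i1 A mA))) => // w _ /=.
      by rewrite mulrDr [M * _]mulrC.
    have ii2 : P.-integrable setT (EFin \o (fun w => \1_A (X w) * cst (c + M) w)).
      by apply: eq_integrable (integrable_scaler (c + M) (i1 A mA)) => // w _ /=; rewrite mulrC.
    rewrite -!EFin_Rintegral//; congr EFin.
    rewrite [RHS](_ : _ = (c + M) * \int[P]_w \1_A (X w)); last first.
      by rewrite -RintegralZl//; [apply: eq_Rintegral => w _; rewrite mulrC|exact: i1].
    rewrite mulrDl -H// -[X in _ + X]RintegralZl//; last exact: i1.
    rewrite -RintegralD//; [|exact: i2|exact/integrable_scaler/i1].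
    by apply: eq_Rintegral => w _; rewrite mulrDr [M * _]mulrC.
  - exact: integrable_addr Wi (cst_i M).
under [X in X = _ -> _]eq_Rintegral do rewrite mulrDr.
rewrite RintegralD// ?RintegralZr//; last first.
  by apply: eq_integrable (integrable_scaler M FXi) => // w _ /=; rewrite mulrC.
by rewrite mulrDr => /addIr ->; rewrite mulrC.
Qed.

Variables (N : nat) (X : 'I_N -> {RV P >-> T}).
Hypothesis indepX : independent_RVs X.

Definition bmeas (F : T -> R) := measurable_fun setT F /\ exists M, forall x, `|F x| <= M.

Lemma bmeas_cst (r : R) : bmeas (cst r).
Proof. by split; [exact: measurable_cst|exists `|r|]. Qed.

Lemma bmeas_indic A : measurable A -> bmeas \1_A.
Proof.
move=> mA; split; first exact: measurable_indic.
by exists 1 => x; rewrite ger0_norm// indicE; case: (_ \in _).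
Qed.

Lemma bmeas_prod (F : 'I_N -> T -> R) (Q : pred 'I_N) : (forall i, bmeas (F i)) ->
  measurable_fun setT (fun w => \prod_(i | Q i) F i (X i w)) /\
  exists M, forall w, `|\prod_(i | Q i) F i (X i w)| <= M.
Proof.
move=> bF; split.
  under eq_fun do rewrite big_mkcond.
  apply: measurable_prod => i _; case: (Q i) => //.
  by apply: measurableT_comp => //; exact: (bF i).1.
have /choice[M MP] : forall i, exists M, forall x, `|F i x| <= M.
  by move=> i; have [_] := bF i.
exists (\prod_(i | Q i) M i) => w; rewrite normr_prod.
by apply: ler_prod => i _; rewrite normr_ge0 MP.
Qed.

(** The factors are released one at a time from indicators to bounded
    functions. *)
Lemma expectation_prod (F : 'I_N -> T -> R) : (forall i, bmeas (F i)) ->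
  \int[P]_w (\prod_i F i (X i w)) = \prod_i \int[P]_w F i (X i w).
Proof.
move=> bF.
suff H k : (k <= N)%N -> forall F : 'I_N -> T -> R, (forall i, bmeas (F i)) ->
    (forall i : 'I_N, (k <= i)%N -> exists2 A, measurable A & F i = \1_A) ->
    \int[P]_w (\prod_i F i (X i w)) = \prod_i \int[P]_w F i (X i w).
  by apply: (H N) => // i; rewrite leqNgt ltn_ord.
elim: k => [_|k IH kN] {bF} {}F bF FA.
  have /choice[A AP] : forall i, exists A, measurable A /\ F i = \1_A.
    by move=> i; have [A mA ->] := FA i isT; exists A.
  have := indepX [set: 'I_N]%SET (fun i => (AP i).1).
  set B := \bigcap_(i in _) _ => PB.
  have mXA i : measurable (X i @^-1` A i).
    by rewrite -[_ @^-1` _]setTI; apply: measurable_funP => //; exact: (AP i).1.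
  have E1 i : \int[P]_w F i (X i w) = fine (P (X i @^-1` A i)).
    by rewrite (AP i).2 Rintegral_indic_preimage//; exact: (AP i).1.
  have mB : measurable B.
    by apply: fin_bigcap_measurable => [|i _]; [exact: finite_finset|exact: mXA].
  rewrite (eq_bigr _ (fun i _ => E1 i)).
  transitivity (fine (P B)).
    rewrite /Rintegral -[B]setIT -(@integral_indic _ _ R)//; congr fine; apply: eq_integral => w _.
    congr EFin; rewrite indicE; have [wB|wB] := pselect (B w).
      rewrite (mem_set wB) big1// => i _; rewrite (AP i).2 indicE mem_set//.
      by apply: wB; rewrite /= inE.
    have [i wi] : exists i, ~ (X i @^-1` A i) w.
      by apply/existsNP => H; apply: wB => i _; exact: H.
    by rewrite (memNset wB) (bigD1 i)//= (AP i).2 indicE memNset// mul0r.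
  rewrite PB.
  have -> : (\prod_(i in [set: 'I_N]%SET) P (X i @^-1` A i) =
      \prod_i (fine (P (X i @^-1` A i)))%:E)%E.
    apply: eq_big => [i|i _]; first by rewrite inE.
    by rewrite fineK//; exact: fin_num_measure.
  by rewrite prodEFin.
pose i0 := Ordinal kN.
have [mF0 [M0 F0M]] := bF i0.
have [mW [MW WM]] := bmeas_prod (fun i => i != i0) bF.
rewrite (bigD1 i0)//= mulrC.
transitivity (\int[P]_w (F i0 (X i0 w) * \prod_(i | i != i0) F i (X i w))).
  by apply: eq_Rintegral => w _; rewrite (bigD1 i0).
apply: (expectation_factor_ext mW WM _ mF0 F0M) => A mA.
pose F' i := if i == i0 then \1_A else F i.
have F'0 : F' i0 = \1_A by rewrite /F' eqxx.
have F'n i : i != i0 -> F' i = F i by rewrite /F' => /negbTE ->.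
have := IH (ltnW kN) F'; rewrite (bigD1 i0)//= F'0 => H.
rewrite mulrC.
transitivity (\int[P]_w (\prod_i F' i (X i w))).
  apply: eq_Rintegral => w _; rewrite [in RHS](bigD1 i0)//= F'0; congr (_ * _).
  by apply: eq_bigr => i ii0; rewrite F'n.
rewrite H; first by congr (_ * _); apply: eq_bigr => i ii0; rewrite F'n.
  by move=> i; rewrite /F'; case: ifP => // _; exact: bmeas_indic.
move=> i; rewrite leq_eqVlt => /predU1P[ki|ki]; rewrite /F'.
  by have -> : i = i0; [exact/val_inj|rewrite eqxx; exists A].
rewrite ifF; first exact: FA.
by apply/eqP => ii0; move: ki; rewrite ii0 ltnn.
Qed.

(** The cross terms vanish by independence. *)
Lemma expectation_sum_sq (c : T -> R) : bmeas c ->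
  (forall i, \int[P]_w c (X i w) = 0) ->
  \int[P]_w (\sum_i c (X i w)) ^+ 2 = \sum_i \int[P]_w (c (X i w)) ^+ 2.
Proof.
move=> bc c0; have [mc [M cM]] := bc.
have ii i j : P.-integrable setT (EFin \o (fun w => c (X i w) * c (X j w))).
  have mci i' : measurable_fun setT (fun w => c (X i' w)) by exact: measurableT_comp.
  apply: (@integrable_bounded _ _ _ _ _ (M * M)) => [|w]; first exact: measurable_funM.
  by rewrite normrM ler_pM.
transitivity (\int[P]_w (\sum_i \sum_j (c (X i w) * c (X j w)))).
  by apply: eq_Rintegral => w _; rewrite expr2 big_distrlr.
rewrite Rintegral_sumr; last by move=> i _; apply: integrable_sumr => j _; exact: ii.
apply: eq_bigr => i _; rewrite Rintegral_sumr// (bigD1 i)//= big1 ?addr0 => [|j ji].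
  by apply: eq_Rintegral => w _; rewrite expr2.
pose F k := if (k == i) || (k == j) then c else cst 1.
have Fi : F i = c by rewrite /F eqxx.
have Fj : F j = c by rewrite /F eqxx orbT.
have := @expectation_prod F; rewrite (bigD1 i)//= Fi c0 mul0r => <-.
  apply: eq_Rintegral => w _; rewrite (bigD1 i)//= (bigD1 j)//= Fi Fj mulrA big1 ?mulr1// /F.
  by move=> k /andP[/negbTE -> /negbTE ->].
by move=> k; rewrite /F; case: ifP => // _; exact: bmeas_cst.
Qed.

Section cos_sum.
Variables (c : T -> R) (r s : R).
Hypothesis mc : measurable_fun setT c.
Hypothesis rE : forall i, \int[P]_w cos (c (X i w)) = r.
Hypothesis sE : forall i, \int[P]_w sin (c (X i w)) = s.

(** What is left of the expectation of [cos (b + S)] when the summands of [S] are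
    integrated out one after the other; a sine is a cosine shifted by [pi / 2]. *)
Fixpoint cos_rec (k : nat) (b : R) : R :=
  if k is k'.+1 then r * cos_rec k' b - s * cos_rec k' (b - pi / 2) else cos b.

Lemma bmeas_cos (b : R) : bmeas (fun x => cos (b + c x)).
Proof.
split; last by exists 1 => x; exact: cos_max.
apply: measurableT_comp; last exact: measurable_funD.
by apply: continuous_measurable_fun; exact: continuous_cos.
Qed.

Lemma bmeas_cosc : bmeas (cos \o c).
Proof. by have := bmeas_cos 0; under eq_fun do rewrite add0r. Qed.

Lemma bmeas_sinc : bmeas (sin \o c).
Proof.
have := bmeas_cos (- (pi / 2)).
by under eq_fun do rewrite addrC cosBpihalf.
Qed.

Definition partial_sum (k : nat) (w : O) := \sum_(i < N | (i < k)%N) c (X i w).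

Lemma measurable_cos_partial k b : measurable_fun setT (fun w => cos (b + partial_sum k w)).
Proof.
apply: measurableT_comp.
  by apply: continuous_measurable_fun; exact: continuous_cos.
apply: measurable_funD => //; rewrite /partial_sum.
under eq_fun do rewrite big_mkcond.
by apply: measurable_sum => i; case: (i < k)%N => //; exact: measurableT_comp.
Qed.

(** The product over the remaining indices makes the induction go through: the
    addition formula turns the last summand into one more factor of it. *)
Lemma cos_partial_sum (k : nat) : (k <= N)%N -> forall (b : R) (F : 'I_N -> T -> R),
  (forall i, bmeas (F i)) ->
  \int[P]_w (cos (b + partial_sum k w) * \prod_(i < N | (k <= i)%N) F i (X i w)) =
  cos_rec k b * \prod_(i < N | (k <= i)%N) \int[P]_w F i (X i w).
Proof.
elim: k => [_|k IH kN] b F bF.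
  have [mp [M pM]] := bmeas_prod predT bF.
  rewrite /= -expectation_prod// -RintegralZl//; last exact: integrable_bounded pM.
  have ps0 w : partial_sum 0 w = 0 by rewrite /partial_sum big_pred0.
  by apply: eq_Rintegral => w _; rewrite ps0 addr0.
pose i0 := Ordinal kN.
pose F1 i := if i == i0 then cos \o c else F i.
pose F2 i := if i == i0 then sin \o c else F i.
have F10 : F1 i0 = cos \o c by rewrite /F1 eqxx.
have F20 : F2 i0 = sin \o c by rewrite /F2 eqxx.
have bF1 i : bmeas (F1 i) by rewrite /F1; case: ifP => // _; exact: bmeas_cosc.
have bF2 i : bmeas (F2 i) by rewrite /F2; case: ifP => // _; exact: bmeas_sinc.
have splitI : (fun i : 'I_N => (k <= i)%N && (i != i0)) =1 (fun i => (k < i)%N).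
  by move=> i; rewrite ltn_neqAle andbC eq_sym.
have prodE (G : 'I_N -> R) : \prod_(i < N | (k <= i)%N) G i = G i0 * \prod_(i < N | (k < i)%N) G i.
  by rewrite (bigD1 i0) ?leqnn//=; congr (_ * _); exact: eq_bigl.
have ne (i : 'I_N) : (k < i)%N -> (i == i0) = false.
  by move=> ki; apply/eqP => ii0; move: ki; rewrite ii0 ltnn.
have sumE w : partial_sum k.+1 w = partial_sum k w + c (X i0 w).
  rewrite /partial_sum (bigD1 i0)//= addrC; congr (_ + _); apply: eq_bigl => i.
  by rewrite ltnS andbC [in RHS]ltn_neqAle.
have H1 := IH (ltnW kN) b F1 bF1.
have H2 := IH (ltnW kN) (b - pi / 2) F2 bF2.
have ci (G : 'I_N -> T -> R) b' : (forall i, bmeas (G i)) ->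
    P.-integrable setT (EFin \o (fun w => cos (b' + partial_sum k w) * \prod_(i < N | (k <= i)%N) G i (X i w))).
  move=> bG; have [mp [M pM]] := bmeas_prod (fun i => (k <= i)%N) bG.
  apply: (@integrable_bounded_mul _ _ _ _ _ _ 1) => [|w|].
  - exact: measurable_cos_partial.
  - exact: cos_max.
  - exact: integrable_bounded pM.
transitivity (\int[P]_w (cos (b + partial_sum k w) * \prod_(i < N | (k <= i)%N) F1 i (X i w)) -
    \int[P]_w (cos (b - pi / 2 + partial_sum k w) * \prod_(i < N | (k <= i)%N) F2 i (X i w))).
  rewrite -RintegralB//; [|exact: ci|exact: ci].
  apply: eq_Rintegral => w _; rewrite !prodE F10 F20/=.
  have -> : \prod_(i < N | (k < i)%N) F1 i (X i w) = \prod_(i < N | (k < i)%N) F i (X i w).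
    by apply: eq_bigr => i ki; rewrite /F1 ne.
  have -> : \prod_(i < N | (k < i)%N) F2 i (X i w) = \prod_(i < N | (k < i)%N) F i (X i w).
    by apply: eq_bigr => i ki; rewrite /F2 ne.
  have -> : cos (b + partial_sum k.+1 w) = cos (b + partial_sum k w) * cos (c (X i0 w)) -
      cos (b - pi / 2 + partial_sum k w) * sin (c (X i0 w)).
    have -> : b - pi / 2 + partial_sum k w = b + partial_sum k w - pi / 2 by ring.
    rewrite cosBpihalf sumE addrA. exact: cosD.
  by ring.
rewrite H1 H2 !prodE F10 F20/= rE sE.
rewrite (eq_bigr (fun i => \int[P]_w F i (X i w))); last by move=> i ki; rewrite /F1 ne.
rewrite [X in _ - _ * (_ * X)](eq_bigr (fun i => \int[P]_w F i (X i w))); last by move=> i ki; rewrite /F2 ne.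
by ring.
Qed.

Lemma expectation_cos_partial k b : (k <= N)%N ->
  \int[P]_w cos (b + partial_sum k w) = cos_rec k b.
Proof.
move=> kN; have := cos_partial_sum kN b (fun=> bmeas_cst 1).
rewrite [X in _ * X]big1 ?mulr1 => [<-|i _]; last first.
  exact: Rintegral_prob_cst.
by apply: eq_Rintegral => w _; rewrite big1// mulr1.
Qed.

(** Replacing the summands one by one: each replacement of the pair [(r, s)] by
    [(rho, 0)] costs at most [|r - rho| + |s|]. *)
Lemma expectation_cos_sum (rho b : R) : `|rho| <= 1 ->
  `|\int[P]_w cos (b + \sum_i c (X i w)) - rho ^+ N * cos b| <= N%:R * (`|r - rho| + `|s|).
Proof.
move=> rho1.
have -> : \int[P]_w cos (b + \sum_i c (X i w)) = cos_rec N b.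
  rewrite -expectation_cos_partial//; apply: eq_Rintegral => w _.
  by congr (cos (_ + _)); apply: eq_bigl => i; rewrite ltn_ord.
suff : forall k, (k <= N)%N -> forall b, `|cos_rec k b - rho ^+ k * cos b| <= k%:R * (`|r - rho| + `|s|).
  by apply.
elim=> [_ b'|k IH kN b' /=]; first by rewrite expr0 mul1r subrr normr0 mul0r.
have C1 b'' : `|cos_rec k b''| <= 1.
  rewrite -expectation_cos_partial//; last exact: ltnW.
  have ci1 : P.-integrable setT (EFin \o cst 1) by exact: finite_measure_integrable_cst.
  have ci2 : P.-integrable setT (EFin \o (fun w => cos (b'' + partial_sum k w))).
    apply: (@integrable_bounded _ _ _ _ _ 1) => [|w]; [exact: measurable_cos_partial|exact: cos_max].
  have := le_normr_Rintegral_le ci2 ci1 (fun w => cos_max _).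
  by rewrite (Rintegral_prob_cst 1).
have -> : r * cos_rec k b' - s * cos_rec k (b' - pi / 2) - rho ^+ k.+1 * cos b' =
    (r - rho) * cos_rec k b' - s * cos_rec k (b' - pi / 2) + rho * (cos_rec k b' - rho ^+ k * cos b').
  by rewrite exprS; ring.
have -> : k.+1%:R * (`|r - rho| + `|s|) = `|r - rho| + `|s| + k%:R * (`|r - rho| + `|s|).
  by rewrite -natr1; ring.
rewrite (le_trans (ler_normD _ _))// lerD//; last first.
  rewrite normrM (le_trans _ (IH (ltnW kN) b'))//.
  by rewrite ler_piMl.
rewrite (le_trans (ler_normB _ _))// !normrM lerD// ler_piMr//.
Qed.

End cos_sum.
End independence.

(** * Normal distributions *)

Section trig_bounds.
Context {R : realType}.

Lemma mvt_bound0 (F F' : R -> R) (B x : R) :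
  (forall c : R, is_derive c 1 F (F' c)) -> (forall c, `|c| <= `|x| -> `|F' c| <= B) ->
  `|F x - F 0| <= B * `|x|.
Proof.
move=> dF F'B.
have cF a b : {within `[a, b], continuous F}.
  apply: continuous_subspaceT => t.
  by apply: differentiable_continuous; apply/derivable1_diffP; have [] := dF t.
have [x0|x0] := leP 0 x.
  have [c] := MVT_segment x0 (fun t _ => dF t) (cF _ _).
  rewrite in_itv/= subr0 => /andP[c0 cx] ->.
  by rewrite normrM ler_wpM2r// F'B// !ger0_norm.
have [c] := MVT_segment (ltW x0) (fun t _ => dF t) (cF _ _).
rewrite in_itv/= sub0r => /andP[c0 cx] E.
by rewrite distrC E normrM normrN ler_wpM2r// F'B// (ler0_norm cx) (ltr0_norm x0) lerN2.
Qed.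

Lemma ler_norm_sin (x : R) : `|sin x| <= `|x|.
Proof.
have d (c : R) : is_derive c 1 sin (cos c) by exact: is_derive_sin.
have := @mvt_bound0 sin cos 1 x d (fun c _ => cos_max c).
by rewrite sin0 subr0 mul1r.
Qed.

Lemma ler_norm_cos1 (x : R) : `|cos x - 1| <= `|x| ^+ 2.
Proof.
have d (c : R) : is_derive c 1 cos (- sin c) by exact: is_derive_cos.
have := mvt_bound0 d (B := `|x|) (x := x); rewrite cos0 expr2; apply => c cx.
by rewrite normrN (le_trans (ler_norm_sin c)).
Qed.

Lemma ler_norm_sin_id (x : R) : `|sin x - x| <= `|x| ^+ 3.
Proof.
have d (c : R) : is_derive c 1 (fun c => sin c - c) (cos c - 1) by exact: is_deriveB.
have := mvt_bound0 d (B := `|x| ^+ 2) (x := x).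
rewrite sin0 subrr subr0 -exprSr; apply => c cx.
by rewrite (le_trans (ler_norm_cos1 c))// lerXn2r ?nnegrE.
Qed.

Lemma ler_norm_cos_quad (x : R) : `|cos x - 1 + x ^+ 2 / 2| <= `|x| ^+ 4.
Proof.
have d (c : R) : is_derive c 1 (fun c => cos c - 1 + c ^+ 2 / 2) (- (sin c - c)).
  apply: is_derive_eq.
  by rewrite /GRing.scale/=; field.
have := mvt_bound0 d (B := `|x| ^+ 3) (x := x).
rewrite cos0 subrr add0r expr0n/= mul0r subr0 -exprSr; apply => c cx.
by rewrite normrN (le_trans (ler_norm_sin_id c))// lerXn2r ?nnegrE.
Qed.

End trig_bounds.

Section normal_pdf_facts.
Context {R : realType}.
Implicit Types (v w x y : R).

Local Notation pdf v := (normal_pdf 0 (Num.sqrt v)).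

Lemma normal_pdf_var v x : 0 < v ->
  pdf v x = (Num.sqrt (v * pi *+ 2))^-1 * expR (- x ^+ 2 / (v *+ 2)).
Proof.
move=> v0; rewrite normal_pdfE; last by rewrite gt_eqF// sqrtr_gt0.
by rewrite /normal_peak /normal_fun subr0 sqr_sqrtr// ltW.
Qed.

(** Completing the square. *)
Lemma normal_pdf_conv v w x y : 0 < v -> 0 < w ->
  pdf v x * pdf w (y - x) =
  pdf (v + w) y * normal_pdf (v * y / (v + w)) (Num.sqrt (v * w / (v + w))) x.
Proof.
move=> v0 w0; have vw0 : 0 < v + w by rewrite addr_gt0.
have s0 : 0 < v * w / (v + w) by rewrite divr_gt0// mulr_gt0.
rewrite !normal_pdf_var// normal_pdfE; last by rewrite gt_eqF// sqrtr_gt0.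
rewrite /normal_peak /normal_fun sqr_sqrtr; last exact: ltW.
rewrite mulrACA [in RHS]mulrACA -!expRD -!invfM -!sqrtrM; last 2 first.
- by rewrite mulrn_wge0// mulr_ge0 ?pi_ge0// ltW.
- by rewrite mulrn_wge0// mulr_ge0 ?pi_ge0// ltW.
congr (_^-1 * expR _); last by field; rewrite !gt_eqF.
by congr (Num.sqrt _); field; rewrite gt_eqF.
Qed.

Lemma normal_pdf_scale v (c : R) x : 0 < v -> c != 0 ->
  `|c| * pdf (c ^+ 2 * v) (c * x) = pdf v x.
Proof.
move=> v0 c0; have c20 : 0 < c ^+ 2 by rewrite exprn_even_gt0.
rewrite !normal_pdf_var//; last by rewrite mulr_gt0.
rewrite -mulrA -mulrnAr sqrtrM ?sqr_ge0// sqrtr_sqr invfM mulrA mulrA mulfV ?mul1r ?normr_eq0//.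
by congr (_ * expR _); field; rewrite gt_eqF//= c0.
Qed.

End normal_pdf_facts.

Section same_law.
Context {R : realType} {d1 d2 dU : measure_display} {T1 : measurableType d1}
  {T2 : measurableType d2} {U : measurableType dU}.
Variables (P : probability T1 R) (Q : probability T2 R) (a : T1 -> U) (b : T2 -> U).
Hypotheses (ma : measurable_fun setT a) (mb : measurable_fun setT b).
Hypothesis lawE : forall A, measurable A -> P (a @^-1` A) = Q (b @^-1` A).

Let indicE A : measurable A ->
  (\int[P]_s (\1_A (a s) * (cst 1 s : R))%:E = \int[Q]_s (\1_A (b s) * (cst 1 s : R))%:E)%E.
Proof.
move=> mA; have maA : measurable (a @^-1` A) by rewrite -[_ @^-1` _]setTI; exact: ma.
have mbA : measurable (b @^-1` A) by rewrite -[_ @^-1` _]setTI; exact: mb.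
transitivity (P (a @^-1` A)).
  rewrite -[X in P X]setIT -(@integral_indic _ _ R)//.
  by apply: eq_integral => s _; rewrite mulr1.
rewrite lawE// -[X in Q X]setIT -(@integral_indic _ _ R)//.
by apply: eq_integral => s _; rewrite mulr1.
Qed.

Lemma ge0_integral_same_law (F : U -> \bar R) : measurable_fun setT F ->
  (forall x, 0 <= F x)%E -> (\int[P]_s F (a s) = \int[Q]_s F (b s))%E.
Proof.
move=> mF F0.
transitivity (\int[P]_s (F (a s) * (cst (1 : R) s)%:E))%E.
  by apply: eq_integral => s _; rewrite mule1.
transitivity (\int[Q]_s (F (b s) * (cst (1 : R) s)%:E))%E; last first.
  by apply: eq_integral => s _; rewrite mule1.
exact: (@ge0_weighted_integral_ext R _ U _ _ _ _ P Q a b (cst 1) (cst 1)).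
Qed.

Lemma Rintegral_same_law (F : U -> R) (M : R) : measurable_fun setT F ->
  (forall x, `|F x| <= M) -> \int[P]_s F (a s) = \int[Q]_s F (b s).
Proof.
move=> mF FM.
transitivity (\int[P]_s (F (a s) * cst 1 s)).
  by apply: eq_Rintegral => s _; rewrite mulr1.
transitivity (\int[Q]_s (F (b s) * cst 1 s)); last first.
  by apply: eq_Rintegral => s _; rewrite mulr1.
apply: (@weighted_integral_ext R _ U _ _ _ _ P Q a b (cst 1) (cst 1) _ _ _ _ _ _ _ F M) => //.
- exact: finite_measure_integrable_cst.
- exact: finite_measure_integrable_cst.
Qed.

End same_law.

Section normal_measure.
Context {R : realType}.
Implicit Types (v w : R).

Lemma normal_measure_subproof v :
  {m : probability (measurableTypeR R) R | forall A, m A = normal_law 0 v A}.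
Proof.
case: (eqVneq v 0) => [->|v0].
  by exists (\d_(0 : measurableTypeR R)) => A; rewrite /normal_law eqxx.
by exists (normal_prob 0 (Num.sqrt v)) => A; rewrite /normal_law (negbTE v0).
Qed.

(** The existence proof is opaque, so that only the values on sets can be used:
    otherwise conversion would unfold normal densities. *)
Definition normal_measure v : probability (measurableTypeR R) R :=
  sval (normal_measure_subproof v).

Lemma normal_measureE v (A : set R) : normal_measure v A = normal_law 0 v A.
Proof. exact: (svalP (normal_measure_subproof v)). Qed.

Local Notation pdf v := (normal_pdf 0 (Num.sqrt v)).

Lemma ge0_integral_normal v (F : R -> \bar R) : 0 < v -> measurable_fun setT F ->
  (forall x, 0 <= F x)%E ->
  (\int[normal_measure v]_x F x = \int[lebesgue_measure]_x (F x * (pdf v x)%:E))%E.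
Proof.
move=> v0 mF F0.
transitivity (\int[normal_prob 0 (Num.sqrt v)]_x F x)%E.
  apply: eq_measure_integral => A mA _; apply: (etrans (normal_measureE v A)).
  by rewrite /normal_law gt_eqF.
transitivity (\int[normal_prob 0 (Num.sqrt v)]_x (F x * (cst 1 x)%:E))%E.
  by apply: eq_integral => x _; rewrite mule1.
apply: (@ge0_weighted_integral_ext R _ (measurableTypeR R) _ _ _ _
  (normal_prob 0 (Num.sqrt v)) lebesgue_measure id id (cst 1) (pdf v)) => //.
- exact: measurable_normal_pdf.
- by move=> x; exact: normal_pdf_ge0.
- move=> A mA.
  transitivity (normal_prob 0 (Num.sqrt v) A).
    under eq_integral do rewrite mulr1.
    by rewrite integral_indic//= setIT.
  transitivity (\int[lebesgue_measure]_(x in A) (pdf v x)%:E)%E; first by [].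
  rewrite [LHS]integral_mkcond; apply: eq_integral => x _.
  by rewrite patchE indicE; case: ifPn; rewrite ?mul1r ?mul0r.
Qed.

Lemma normal_measure_set v A : 0 < v -> measurable A ->
  normal_measure v A = (\int[lebesgue_measure]_x (\1_A x * pdf v x)%:E)%E.
Proof.
move=> v0 mA; transitivity (\int[normal_measure v]_x (\1_A x)%:E)%E.
  by rewrite integral_indic//= setIT.
rewrite ge0_integral_normal//.
by apply/measurable_EFinP; exact: measurable_indic.
Qed.

Lemma normal_measure0 A : normal_measure 0 A = \d_(0 : R) A.
Proof. by rewrite normal_measureE /normal_law eqxx. Qed.

Lemma integral_normal0 (F : R -> \bar R) : measurable_fun setT F ->
  (\int[normal_measure 0]_x F x)%E = F 0.
Proof.
move=> mF; transitivity (\int[\d_((0 : R)%R : measurableTypeR R)]_x F x)%E.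
  by apply: eq_measure_integral => A mA _; exact: (normal_measure0 A).
by rewrite integral_dirac// diracT mul1e.
Qed.

Lemma normal_measure_scale v (c : R) A : 0 <= v -> measurable A ->
  normal_measure v [set x | A (c * x)] = normal_measure (c ^+ 2 * v) A.
Proof.
move=> v0 mA.
have [->|c0] := eqVneq c 0.
  have -> : 0 ^+ 2 * v = 0 by rewrite expr0n mul0r.
  rewrite [RHS]normal_measure0.
  have [A0|A0] := pselect (A 0).
    rewrite (_ : mkset _ = setT); first by rewrite probability_setT diracE mem_set.
    by apply/seteqP; split=> // x _ /=; rewrite mul0r.
  rewrite (_ : mkset _ = set0); first by rewrite measure0 diracE memNset.
  by apply/seteqP; split=> // x /=; rewrite mul0r.
have [->|v1] := eqVneq v 0.
  by rewrite mulr0 !normal_measure0 !diracE; congr (nat_of_bool _)%:R%:E; apply/idP/idP; rewrite !inE /= mulr0.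
have {}v0 : 0 < v by rewrite lt_neqAle eq_sym v1.
have mcA : measurable [set x | A (c * x)].
  rewrite [X in measurable X](_ : _ = setT `&` (fun x : R => c * x) @^-1` A); last by rewrite setTI.
  by apply: (@measurable_funM _ _ _ _ (cst c) id) => //.
have cv0 : 0 < c ^+ 2 * v by rewrite mulr_gt0// exprn_even_gt0.
rewrite [LHS](normal_measure_set v0 mcA) [RHS](normal_measure_set cv0 mA).
rewrite [RHS](@ge0_integral_affine1 R c 0)//; last 2 first.
- apply/measurable_EFinP/measurable_funM; first exact: measurable_indic.
  exact: measurable_normal_pdf.
- by move=> x; rewrite lee_fin mulr_ge0 ?normal_pdf_ge0.
rewrite -ge0_integralZl//; first last.
- by move=> x _; rewrite lee_fin mulr_ge0 ?normal_pdf_ge0.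
- apply/measurable_EFinP/measurable_funM.
    apply: measurableT_comp; first exact: measurable_indic.
    exact: measurable_affine1.
  apply: measurableT_comp; first exact: measurable_normal_pdf.
  exact: measurable_affine1.
apply: eq_integral => x _; rewrite -EFinM; congr EFin.
by rewrite /affine1 add0r mulrCA normal_pdf_scale//; congr (_ * _).
Qed.

(** Completing the square turns the convolution into the density of the sum
    times a normal density, which integrates to one. *)
Lemma normal_measure_add v w A : 0 <= v -> 0 <= w -> measurable A ->
  (normal_measure v \x normal_measure w)%E [set p : measurableTypeR R * measurableTypeR R | A (p.1 + p.2)] =
  normal_measure (v + w) A.
Proof.
move=> v0 w0 mA.
have mS : measurable [set p : measurableTypeR R * measurableTypeR R | A (p.1 + p.2)].
  rewrite [X in measurable X](_ : _ = setT `&` (fun p : measurableTypeR R * measurableTypeR R => p.1 + p.2) @^-1` A); last by rewrite setTI.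
  by apply: (@measurable_funD _ _ _ _ fst snd) => //.
have mSx x : measurable [set y : R | A (x + y)].
  rewrite [X in measurable X](_ : _ = setT `&` (fun y : R => x + y) @^-1` A); last by rewrite setTI.
  by apply: (@measurable_funD _ _ _ _ (cst x) id) => //.
have xsE x : xsection [set p : measurableTypeR R * measurableTypeR R | A (p.1 + p.2)] x = [set y | A (x + y)].
  by apply/seteqP; split=> y; rewrite /xsection/= inE.
rewrite /product_measure1/=; under eq_integral do rewrite xsE.
have [->|v1] := eqVneq v 0.
  rewrite add0r integral_normal0; last first.
    apply: (eq_measurable_fun (fun x => normal_measure w (xsection [set p : measurableTypeR R * measurableTypeR R | A (p.1 + p.2)] x))).
      by move=> x _; rewrite xsE.
    exact: measurable_fun_xsection.
  congr (normal_measure w _).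
  by apply/seteqP; split=> y /=; rewrite add0r.
have {}v0 : 0 < v by rewrite lt_neqAle eq_sym v1.
have [->|w1] := eqVneq w 0.
  rewrite addr0; transitivity (\int[normal_measure v]_x (\1_A x)%:E)%E.
    by apply: eq_integral => x _; rewrite normal_measure0 diracE indicE; congr (nat_of_bool _)%:R%:E; apply/idP/idP; rewrite !inE/= addr0.
  by rewrite integral_indic//= setIT.
have {}w0 : 0 < w by rewrite lt_neqAle eq_sym w1.
have mpdf u : measurable_fun setT (fun x : measurableTypeR R => pdf u x) by exact: measurable_normal_pdf.
have msub x : measurable_fun setT (fun y : measurableTypeR R => pdf w (y - x)).
  rewrite (_ : (fun y => _) = (fun u => pdf w u) \o affine1 1 (- x)).
    exact: measurableT_comp (mpdf w) (measurable_affine1 _ _).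
  by apply/funext => y; rewrite /affine1/= mul1r addrC.
have msub2 : measurable_fun setT (fun p : measurableTypeR R * measurableTypeR R => pdf w (p.2 - p.1)).
  apply: (measurableT_comp (mpdf w)).
  exact: measurable_funB (@measurable_snd _ _ _ _) (@measurable_fst _ _ _ _).
have shift x : normal_measure w [set y | A (x + y)] = (\int[lebesgue_measure]_y (\1_A y * pdf w (y - x))%:E)%E.
  rewrite [LHS](normal_measure_set w0 (mSx x)).
  rewrite [RHS](@ge0_integral_affine1 R 1 x) ?oner_eq0//; last 2 first.
  - apply/measurable_EFinP/measurable_funM; first exact: measurable_indic.
    exact: msub.
  - by move=> y; rewrite lee_fin mulr_ge0 ?normal_pdf_ge0.
  rewrite normr1 mul1e; apply: eq_integral => y _; rewrite /affine1 mul1r addrAC subrr add0r.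
  by congr (_ * _)%:E; rewrite !indicE; congr (nat_of_bool _)%:R; apply/idP/idP; rewrite !inE.
under eq_integral do rewrite shift.
have mG : measurable_fun setT (fun p : measurableTypeR R * measurableTypeR R =>
    (\1_A p.2 * (pdf v p.1 * pdf w (p.2 - p.1)))%:E).
  apply/measurable_EFinP/measurable_funM.
    by apply: measurableT_comp; [exact: measurable_indic|exact: measurable_snd].
  apply: measurable_funM; first by apply: measurableT_comp => //; exact: measurable_fst.
  exact: msub2.
have mI : measurable_fun setT (fun x : measurableTypeR R => \int[lebesgue_measure]_y (\1_A y * pdf w (y - x))%:E)%E.
  apply: (@measurable_fun_fubini_tonelli_F _ _ _ _ _ lebesgue_measure (fun p : measurableTypeR R * measurableTypeR R => (\1_A p.2 * pdf w (p.2 - p.1))%:E)).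
    apply/measurable_EFinP/measurable_funM.
      by apply: measurableT_comp; [exact: measurable_indic|exact: measurable_snd].
    exact: msub2.
  by move=> p; rewrite lee_fin mulr_ge0 ?normal_pdf_ge0.
rewrite (ge0_integral_normal v0 mI); last first.
  by move=> x; apply: integral_ge0 => y _; rewrite lee_fin mulr_ge0 ?normal_pdf_ge0.
transitivity (\int[lebesgue_measure]_x \int[lebesgue_measure]_y
   (\1_A y * (pdf v x * pdf w (y - x)))%:E)%E.
  apply: eq_integral => x _; rewrite -ge0_integralZr//; last 3 first.
  - apply/measurable_EFinP/measurable_funM; first exact: measurable_indic.
    exact: msub.
  - by move=> y _; rewrite lee_fin mulr_ge0 ?normal_pdf_ge0.
  - by rewrite lee_fin normal_pdf_ge0.
  by apply: eq_integral => y _; rewrite -EFinM; congr EFin; ring.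
have G0 p : (0 <= (\1_A p.2 * (pdf v p.1 * pdf w (p.2 - p.1)))%:E)%E.
  by rewrite lee_fin !mulr_ge0 ?normal_pdf_ge0.
transitivity (\int[lebesgue_measure]_y \int[lebesgue_measure]_x
   (\1_A y * (pdf v x * pdf w (y - x)))%:E)%E.
  exact: (@fubini_tonelli _ _ (measurableTypeR R) (measurableTypeR R) R
    lebesgue_measure lebesgue_measure (fun p : measurableTypeR R * measurableTypeR R =>
    (\1_A p.2 * (pdf v p.1 * pdf w (p.2 - p.1)))%:E) mG G0).
rewrite [RHS](normal_measure_set (addr_gt0 v0 w0) mA); apply: eq_integral => y _ /=.
under eq_integral do rewrite normal_pdf_conv// mulrA EFinM.
rewrite ge0_integralZl//; last 3 first.
- by apply/measurable_EFinP; exact: measurable_normal_pdf.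
- by move=> x _; rewrite lee_fin normal_pdf_ge0.
- by rewrite lee_fin mulr_ge0 ?normal_pdf_ge0.
by rewrite integral_normal_pdf mule1.
Qed.

End normal_measure.

Lemma integrable_bounded_prob {dT : measure_display} {T : measurableType dT} {R : realType}
  (P : probability T R) (f : T -> R) (M : R) :
  measurable_fun setT f -> (forall x, `|f x| <= M) -> P.-integrable setT (EFin \o f).
Proof. exact: integrable_bounded. Qed.

Section product_probability.
Context {R : realType} {d1 d2 : measure_display} {T1 : measurableType d1}
  {T2 : measurableType d2}.
Variables (P : probability T1 R) (Q : probability T2 R).

Lemma Rintegral_prod_mul (a : T1 -> R) (b : T2 -> R) (A B : R) :
  measurable_fun setT a -> measurable_fun setT b ->
  (forall x, `|a x| <= A) -> (forall x, `|b x| <= B) ->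
  (P \x Q)%E.-integrable setT (EFin \o (fun p : T1 * T2 => a p.1 * b p.2)) /\
  \int[(P \x Q)%E]_p (a p.1 * b p.2) = \int[P]_x a x * \int[Q]_x b x.
Proof.
move=> ma mb aA bB.
have abi : (P \x Q)%E.-integrable setT (EFin \o (fun p : T1 * T2 => a p.1 * b p.2)).
  apply: (@integrable_bounded_prob _ (T1 * T2)%type R (P \x Q)%E (fun p : T1 * T2 => a p.1 * b p.2) (A * B)) => [|p]; last by rewrite normrM ler_pM.
  by apply: measurable_funM; apply: measurableT_comp.
have ai : P.-integrable setT (EFin \o a) by apply: (@integrable_bounded _ _ _ P a A).
have bi : Q.-integrable setT (EFin \o b) by apply: (@integrable_bounded _ _ _ Q b B).
split=> //; apply: EFin_inj; rewrite EFin_Rintegral// -integral12_prod_meas1//.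
rewrite EFinM (EFin_Rintegral ai) (EFin_Rintegral bi).
transitivity (\int[P]_x ((a x)%:E * \int[Q]_y (b y)%:E))%E.
  apply: eq_integral => x _; rewrite /fubini_F/= -integralZl//.
rewrite -(EFin_Rintegral bi); exact: integralZr.
Qed.

Lemma Rintegral_prod_mulB (a a' : T1 -> R) (b b' : T2 -> R) (M : R) :
  measurable_fun setT a -> measurable_fun setT b ->
  measurable_fun setT a' -> measurable_fun setT b' ->
  (forall x, `|a x| <= M) -> (forall x, `|b x| <= M) ->
  (forall x, `|a' x| <= M) -> (forall x, `|b' x| <= M) ->
  \int[(P \x Q)%E]_p (a p.1 * b p.2 - a' p.1 * b' p.2) =
  \int[P]_x a x * \int[Q]_x b x - \int[P]_x a' x * \int[Q]_x b' x.
Proof.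
move=> ma mb ma' mb' aM bM aM' bM'.
have [i1 E1] := Rintegral_prod_mul ma mb aM bM.
have [i2 E2] := Rintegral_prod_mul ma' mb' aM' bM'.
by rewrite RintegralB// E1 E2.
Qed.

End product_probability.

Section normal_integrals.
Context {R : realType}.
Implicit Types (v w : R).
Local Notation pdf v := (normal_pdf 0 (Num.sqrt v)).
Local Notation N := (@normal_measure R).

Lemma integral_normal_pdf_bounded v (F : measurableTypeR R -> R) (M : R) : 0 < v ->
  measurable_fun setT F -> (forall x, `|F x| <= M) ->
  \int[N v]_x F x = \int[lebesgue_measure]_x (F x * pdf v x).
Proof.
move=> v0 mF FM; transitivity (\int[N v]_x (F x * cst 1 x)).
  by apply: eq_Rintegral => x _; rewrite mulr1.
apply: (@weighted_integral_ext R _ (measurableTypeR R) _ _ _ _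
  (N v) lebesgue_measure id id (cst 1) (pdf v) _ _ _ _ _ _ _ F M) => //.
- exact: measurable_normal_pdf.
- by move=> x; exact: normal_pdf_ge0.
- move=> A mA; rewrite -(normal_measure_set v0 mA).
  under eq_integral do rewrite mulr1.
  by rewrite integral_indic//= setIT.
- exact: finite_measure_integrable_cst.
- exact: integrable_normal_pdf.
Qed.

Lemma integral_normal_scale v (c : R) (F : measurableTypeR R -> R) (M : R) : 0 <= v ->
  measurable_fun setT F -> (forall x, `|F x| <= M) ->
  \int[N v]_x F (c * x) = \int[N (c ^+ 2 * v)]_x F x.
Proof.
move=> v0 mF FM.
have mc : measurable_fun setT (fun x : measurableTypeR R => c * x : measurableTypeR R).
  by apply: (@measurable_funM _ _ _ _ (cst c) id).
apply: (@Rintegral_same_law R _ _ _ (measurableTypeR R) (measurableTypeR R) (measurableTypeR R)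
  (N v) (N (c ^+ 2 * v)) _ id mc (@measurable_id _ _ _) _ F M mF FM).
by move=> A mA; exact: normal_measure_scale.
Qed.

Lemma integral_normal_add v w (F : measurableTypeR R -> R) (M : R) : 0 <= v -> 0 <= w ->
  measurable_fun setT F -> (forall x, `|F x| <= M) ->
  \int[(N v \x N w)%E]_p F (p.1 + p.2) = \int[N (v + w)]_x F x.
Proof.
move=> v0 w0 mF FM.
have mD : measurable_fun setT (fun p : measurableTypeR R * measurableTypeR R => p.1 + p.2 : measurableTypeR R).
  exact: (measurable_funD (@measurable_fst _ _ _ _) (@measurable_snd _ _ _ _)).
apply: (@Rintegral_same_law R _ _ _ (measurableTypeR R * measurableTypeR R)%type
  (measurableTypeR R) (measurableTypeR R)
  (N v \x N w)%E (N (v + w)) _ id mD (@measurable_id _ _ _) _ F M mF FM).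
by move=> A mA; exact: normal_measure_add.
Qed.

Lemma measurable_cos : measurable_fun (@setT (measurableTypeR R)) (@cos R).
Proof. by apply: continuous_measurable_fun; exact: continuous_cos. Qed.

Lemma measurable_sin : measurable_fun (@setT (measurableTypeR R)) (@sin R).
Proof. by apply: continuous_measurable_fun; exact: continuous_sin. Qed.

Lemma integral_normal_sin v : 0 <= v -> \int[N v]_x sin x = 0.
Proof.
move=> v0; have := integral_normal_scale (-1) v0 measurable_sin (@sin_max R).
rewrite sqrrN expr1n mul1r; under eq_Rintegral do rewrite mulN1r sinN -mulN1r.
rewrite RintegralZl//; last exact: integrable_bounded measurable_sin (@sin_max R).
by rewrite mulN1r => /eqP; rewrite -subr_eq0 -opprD oppr_eq0 -mulr2n mulrn_eq0/= => /eqP.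
Qed.

Definition normal_cf v : R := \int[N v]_x cos x.

Lemma normal_cfD v w : 0 <= v -> 0 <= w -> normal_cf (v + w) = normal_cf v * normal_cf w.
Proof.
move=> v0 w0; rewrite /normal_cf -[LHS](integral_normal_add v0 w0 measurable_cos (@cos_max R)).
transitivity (\int[(N v \x N w)%E]_p (cos p.1 * cos p.2 - sin p.1 * sin p.2)).
  by apply: eq_Rintegral => p _; rewrite cosD.
apply: (etrans (Rintegral_prod_mulB (N v) (N w) measurable_cos measurable_cos measurable_sin
  measurable_sin (@cos_max R) (@cos_max R) (@sin_max R) (@sin_max R))).
have sin0E (x y z t : R) : z = 0 -> x * y - z * t = x * y by move=> ->; ring.
exact: sin0E (integral_normal_sin v0).
Qed.

(** Infinite divisibility, which provides the [N]-th root of the characteristic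
    function of a normal law. *)
Lemma expr_morphism (F : R -> R) : {in Num.nneg &, {morph F : x y / x + y >-> x * y}} ->
  forall (v : R) k, 0 <= v -> F (v / k.+1%:R) ^+ k.+1 = F v.
Proof.
move=> FD v k v0; set w := v / _.
have w0 : 0 <= w by rewrite divr_ge0.
have H j : F w ^+ j.+1 = F (w *+ j.+1).
  elim: j => [|j IH]; first by rewrite expr1.
  by rewrite exprS IH [w *+ _ in RHS]mulrS FD// ?nnegrE ?mulrn_wge0.
by rewrite H -mulr_natr divfK// pnatr_eq0.
Qed.

Lemma normal_cfX v k : 0 <= v -> normal_cf (v / k.+1%:R) ^+ k.+1 = normal_cf v.
Proof. by apply: expr_morphism => x y; rewrite !nnegrE; exact: normal_cfD. Qed.

Lemma normal_cf_le1 v : `|normal_cf v| <= 1.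
Proof.
have ci : (N v).-integrable setT (EFin \o cst 1) by exact: finite_measure_integrable_cst.
have := le_normr_Rintegral_le (integrable_bounded (N v) measurable_cos (@cos_max R)) ci (@cos_max R).
by rewrite Rintegral_prob_cst.
Qed.

Lemma integral_normal_cosD v b : 0 <= v -> \int[N v]_x cos (b + x) = normal_cf v * cos b.
Proof.
move=> v0; under eq_Rintegral do rewrite cosD.
rewrite RintegralB//; last 2 first.
- by apply: integrable_scaler; exact: integrable_bounded measurable_cos (@cos_max R).
- by apply: integrable_scaler; exact: integrable_bounded measurable_sin (@sin_max R).
rewrite !RintegralZl//; last 2 first.
- exact: integrable_bounded measurable_sin (@sin_max R).
- exact: integrable_bounded measurable_cos (@cos_max R).
by rewrite integral_normal_sin// mulr0 subr0 mulrC.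
Qed.

(** Tilting: [exp u >= 1 + u] compares the normal densities of variances [1]
    and [t ^ 2]. *)
Lemma normal_pdf_tilt (t x : R) : 0 < t ->
  pdf 1 x * (1 + x ^+ 2 / 2 * (1 - t ^- 2)) <= t * pdf (t ^+ 2) x.
Proof.
move=> t0; have t20 : 0 < t ^+ 2 by rewrite exprn_gt0.
rewrite !normal_pdf_var//.
have -> : t * ((Num.sqrt (t ^+ 2 * pi *+ 2))^-1 * expR (- x ^+ 2 / (t ^+ 2 *+ 2))) =
    (Num.sqrt (1 * pi *+ 2))^-1 * expR (- x ^+ 2 / (1 *+ 2)) * expR (x ^+ 2 / 2 * (1 - t ^- 2)).
  rewrite -mulrA -expRD mulrA; congr (_ * expR _).
    rewrite -mulrnAr sqrtrM ?sqr_ge0// sqrtr_sqr gtr0_norm// invfM mulrA mulfV ?gt_eqF// mul1r.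
    by rewrite mul1r.
  by field; rewrite gt_eqF.
by rewrite ler_wpM2l ?expR_ge1Dx// mulr_ge0 ?invr_ge0 ?sqrtr_ge0 ?expR_ge0.
Qed.

(** [expR (3 / 8 * x ^+ 2)] dominates a multiple of [x ^+ 4], by the inequality
    [1 + u <= expR u] applied to each of two equal factors. *)
Lemma normal_pdf_quartic (x : R) : x ^+ 4 * pdf 1 x <= 64 * pdf 4 x.
Proof.
rewrite !normal_pdf_var//.
have -> : Num.sqrt (4 * pi *+ 2) = 2 * Num.sqrt (1 * pi *+ 2) :> R.
  by rewrite -mulrnAr sqrtrM// (_ : 4 = 2 ^+ 2) ?sqrtr_sqr ?ger0_norm ?mul1r//; ring.
have -> : - x ^+ 2 / (4 *+ 2) = - x ^+ 2 / (1 *+ 2) + (3 / 16 * x ^+ 2 + 3 / 16 * x ^+ 2) by field.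
rewrite invfM expRD [expR (_ + _)]expRD.
set p := (Num.sqrt _)^-1; set e := expR (- _ / _).
have p0 : 0 <= p by rewrite invr_ge0 sqrtr_ge0.
have e0 : 0 <= e by exact: expR_ge0.
have h1 : 1 + 3 / 16 * x ^+ 2 <= expR (3 / 16 * x ^+ 2) by exact: expR_ge1Dx.
have h2 : 9 / 256 * x ^+ 4 <= expR (3 / 16 * x ^+ 2) * expR (3 / 16 * x ^+ 2).
  apply: (@le_trans _ _ ((1 + 3 / 16 * x ^+ 2) * (1 + 3 / 16 * x ^+ 2))).
    have := sqr_ge0 x; nra.
  by rewrite ler_pM//; have := sqr_ge0 x; lra.
have -> : x ^+ 4 * (p * e) = (p * e) * x ^+ 4 by ring.
have -> : 64 * (2^-1 * p * (e * (expR (3 / 16 * x ^+ 2) * expR (3 / 16 * x ^+ 2)))) =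
  (p * e) * (32 * (expR (3 / 16 * x ^+ 2) * expR (3 / 16 * x ^+ 2))) by field.
rewrite ler_wpM2l ?mulr_ge0//.
have := exprn_even_ge0 x (isT : ~~ odd 4); lra.
Qed.

Local Notation mu := (@lebesgue_measure R).

Lemma integrable_pdf v : mu.-integrable setT (EFin \o pdf v).
Proof. exact: integrable_normal_pdf. Qed.

Lemma integrable_quartic : mu.-integrable setT (EFin \o (fun x => x ^+ 4 * pdf 1 x)).
Proof.
apply: (le_integrable measurableT _ _ (integrable_scaler 64 (integrable_pdf 4))).
  apply/measurable_EFinP/measurable_funM; last exact: measurable_normal_pdf.
  exact: measurable_funX.
move=> x _ /=; rewrite lee_fin ger0_norm; last first.
  by rewrite mulr_ge0 ?normal_pdf_ge0// exprn_even_ge0.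
by rewrite ger0_norm ?mulr_ge0 ?normal_pdf_ge0// normal_pdf_quartic.
Qed.

Lemma integrable_quadratic : mu.-integrable setT (EFin \o (fun x => x ^+ 2 * pdf 1 x)).
Proof.
apply: (le_integrable measurableT _ _ (integrable_addr (integrable_pdf 1) integrable_quartic)).
  apply/measurable_EFinP/measurable_funM; last exact: measurable_normal_pdf.
  exact: measurable_funX.
have p0 (x : R) : 0 <= pdf 1 x by exact: normal_pdf_ge0.
move=> x _ /=; rewrite lee_fin ger0_norm; last by rewrite mulr_ge0 ?sqr_ge0 ?p0.
rewrite ger0_norm; last by rewrite addr_ge0// mulr_ge0// exprn_even_ge0.
rewrite -[X in _ <= X + _]mul1r -mulrDl ler_wpM2r//.
have := sqr_ge0 (x ^+ 2 - 1); rewrite sqrrB expr1n mulr1 -exprM/=; nra.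
Qed.

Definition normal_moment4 : R := \int[mu]_x (x ^+ 4 * pdf 1 x).

(** The integral of [normal_pdf_tilt] is an inequality between functions of [t]
    with equality at [t = 1], where their derivatives must therefore agree; this
    says that the second moment is [1]. *)
Lemma normal_moment2 : \int[mu]_x (x ^+ 2 * pdf 1 x) = 1.
Proof.
set m := \int[mu]_x _.
have m0 : 0 <= m by apply: Rintegral_ge0 => x _; rewrite mulr_ge0 ?sqr_ge0 ?normal_pdf_ge0.
have key t : 0 < t -> 1 + m * ((1 - t ^- 2) / 2) <= t.
  move=> t0.
  have i1 : mu.-integrable setT (EFin \o (fun x => (1 - t ^- 2) / 2 * (x ^+ 2 * pdf 1 x))).
    exact/integrable_scaler/integrable_quadratic.
  have : \int[mu]_x (pdf 1 x + (1 - t ^- 2) / 2 * (x ^+ 2 * pdf 1 x)) <= \int[mu]_x (t * pdf (t ^+ 2) x).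
    apply: le_Rintegral => //.
    - exact/integrable_addr/i1/integrable_pdf.
    - exact/integrable_scaler/integrable_pdf.
    - move=> x _; apply: le_trans (normal_pdf_tilt x t0).
      by rewrite le_eqVlt; apply/orP; left; apply/eqP; ring.
  rewrite RintegralD//; last exact: integrable_pdf.
  rewrite !RintegralZl//; [|exact: integrable_pdf|exact: integrable_quadratic].
  rewrite -/m /Rintegral !integral_normal_pdf/= mulr1.
  by move=> H; apply: le_trans H; rewrite [m * _]mulrC.
have [//|] := eqVneq m 1; rewrite neq_lt => m1.
(* A value of [t] on the side of [1] where the inequality would fail, close enough
   to [1] for the difference between [m] and [1] to be seen at first order. *)
pose s := (1 + m) / 2; pose t := Num.sqrt s.
have s0 : 0 < s by rewrite divr_gt0// ltr_wpDr.
have t0 : 0 < t by rewrite sqrtr_gt0.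
have tt : t ^+ 2 = s by rewrite sqr_sqrtr// ltW.
have := key t t0; rewrite tt => H.
have H2 : (t - 1) * (t + 1) = s - 1 by rewrite -subr_sqr tt expr1n.
have {}H : m * (s - 1) <= 2 * s * (t - 1).
  have : (1 + m * ((1 - s^-1) / 2)) * (2 * s) <= t * (2 * s) by rewrite ler_wpM2r// mulr_ge0// ltW.
  have -> : (1 + m * ((1 - s^-1) / 2)) * (2 * s) = 2 * s + m * (s - 1) by field; rewrite gt_eqF.
  lra.
have {}H : m * (t - 1) * (t + 1) <= 2 * s * (t - 1) by rewrite -mulrA H2.
exfalso; case/orP: m1 => m1.
  have s1 : s < 1 by rewrite /s; lra.
  have t1 : t < 1 by rewrite -(@ltr_pXn2r _ 2)// ?nnegrE ?ltW// tt expr1n.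
  have : 2 * s <= m * (t + 1).
    rewrite -(@ler_nM2r _ (t - 1)) ?subr_lt0//; move: H; rewrite mulrAC; lra.
  have ms : m < s by rewrite /s; lra.
  nra.
have s1 : 1 < s by rewrite /s; lra.
have t1 : 1 < t by rewrite -(@ltr_pXn2r _ 2)// ?nnegrE ?ltW// tt expr1n.
have : m * (t + 1) <= 2 * s.
  by rewrite -(@ler_pM2r _ (t - 1)) ?subr_gt0//; move: H; rewrite mulrAC.
have ms : s < m by rewrite /s; lra.
nra.
Qed.

Lemma normal_cf_quad v : 0 <= v -> `|normal_cf v - 1 + v / 2| <= normal_moment4 * v ^+ 2.
Proof.
move=> v0; pose c := Num.sqrt v.
have c2 : c ^+ 2 = v by rewrite sqr_sqrtr.
have mcc : measurable_fun setT (fun x : measurableTypeR R => cos (c * x)).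
  apply: (measurableT_comp measurable_cos).
  by apply: (@measurable_funM _ _ _ _ (cst c) id).
have -> : normal_cf v = \int[mu]_x (cos (c * x) * pdf 1 x).
  have b1 (x : R) : `|cos (c * x)| <= 1 by exact: cos_max.
  rewrite -[RHS](integral_normal_pdf_bounded ltr01 mcc b1).
  by rewrite [RHS](integral_normal_scale c ler01 measurable_cos (@cos_max R)) c2 mulr1.
have i1 : mu.-integrable setT (EFin \o (fun x => cos (c * x) * pdf 1 x)).
  apply: integrable_bounded_mul mcc _ (integrable_pdf 1) => x; exact: cos_max.
have I1 : \int[mu]_x pdf 1 x = 1 by rewrite /Rintegral integral_normal_pdf.
have -> : v / 2 = v / 2 * \int[mu]_x (x ^+ 2 * pdf 1 x) by rewrite normal_moment2 mulr1.
rewrite -[X in _ - X + _]I1.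
rewrite -RintegralZl//; last exact: integrable_quadratic.
rewrite -RintegralB//; last exact: integrable_pdf.
rewrite -RintegralD//; last 2 first.
- by apply: integrable_subr => //; exact: integrable_pdf.
- by apply: integrable_scaler; exact: integrable_quadratic.
rewrite [leRHS]mulrC /normal_moment4 -RintegralZl//; last exact: integrable_quartic.
apply: le_normr_Rintegral_le.
- apply: integrable_addr; last exact/integrable_scaler/integrable_quadratic.
  by apply: integrable_subr => //; exact: integrable_pdf.
- exact/integrable_scaler/integrable_quartic.
move=> x; have p0 := normal_pdf_ge0 0 (Num.sqrt 1) x.
have -> : cos (c * x) * pdf 1 x - pdf 1 x + v / 2 * (x ^+ 2 * pdf 1 x) =
    (cos (c * x) - 1 + (c * x) ^+ 2 / 2) * pdf 1 x by rewrite exprMn c2; ring.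
rewrite normrM (ger0_norm p0) mulrA ler_wpM2r// (le_trans (ler_norm_cos_quad _))//.
rewrite -c2 -exprM -exprMn -normrX ger0_norm//.
exact: exprn_even_ge0.
Qed.

End normal_integrals.


Section normal_vector.
Context {R : realType}.
Local Notation N := (@normal_measure R).

Definition dotmul d (u x : 'rV[R]_d) : R := (u *m x^T) ord0 ord0.

Lemma dotmulE d (u x : 'rV[R]_d) : dotmul u x = \sum_j u ord0 j * x ord0 j.
Proof. by rewrite /dotmul mxE; apply: eq_bigr => j _; rewrite mxE. Qed.

Lemma dotmulC d (u x : 'rV[R]_d) : dotmul u x = dotmul x u.
Proof. by rewrite !dotmulE; apply: eq_bigr => j _; rewrite mulrC. Qed.

Lemma measurable_dotmul d (u : 'rV[R]_d) :
  measurable_fun setT (fun x : 'rV[R]_d => dotmul u x : measurableTypeR R).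
Proof.
rewrite (_ : (fun _ => _) = (fun x : 'rV[R]_d => \sum_j u ord0 j * x ord0 j)); last first.
  by apply/funext => x; rewrite dotmulE.
apply: measurable_sum => j; apply: (@measurable_funM _ _ _ _ (cst (u ord0 j))) => //.
exact: measurable_coord.
Qed.

Definition psd d (S : 'M[R]_d) := S^T = S /\ forall u : 'rV[R]_d, 0 <= (u *m S *m u^T) ord0 ord0.

(** The Schur complement step: conditionally on its first coordinate [x], the
    rest of a normal vector is a smaller normal vector shifted linearly in [x]. *)
Lemma exists_normal_rV d (S : 'M[R]_d) : psd S ->
  exists nu : probability 'rV[R]_d R, is_normal_rV 0 S nu.
Proof.
elim: d S => [|d IH] S [St S0].
  exists (\d_(0 : 'rV[R]_0)) => u A mA.
  by rewrite /normal_law (thinmx0 u) !mul0mx mxE eqxx !diracE; congr (nat_of_bool _)%:R%:E;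
    apply/idP/idP; rewrite !inE /= mul0mx mxE.
move: S St S0; rewrite -[d.+1]/(1 + d)%N => S St S0.
pose a := S ord0 ord0; pose b : 'rV[R]_d := ursubmx S; pose C : 'M[R]_d := drsubmx S.
have bT : dlsubmx S = b^T by rewrite /b trmx_ursub St.
have aE : ulsubmx S = a%:M.
  by apply/matrixP => i j; rewrite !mxE !ord1 eqxx /a; congr (S _ _); apply/val_inj.
have SE : S = block_mx a%:M b b^T C by rewrite -aE -bT submxK.
have Ct : C^T = C by rewrite /C trmx_drsub St.
have quadE (x : R) (u : 'rV[R]_d) : (row_mx x%:M u *m S *m (row_mx x%:M u)^T) ord0 ord0 =
    x ^+ 2 * a + 2 * x * dotmul b u + (u *m C *m u^T) ord0 ord0.
  rewrite SE mul_row_block tr_row_mx mul_row_col !mulmxDl tr_scalar_mx -!scalar_mxM.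
  rewrite !mul_mx_scalar !mul_scalar_mx -!scalemxAl [u *m b^T]mx11_scalar.
  have e1 : \sum_j u ord0 j * b^T j ord0 = dotmul b u.
    by rewrite dotmulE; apply: eq_bigr => j _; rewrite mxE mulrC.
  have e2 : \sum_j b ord0 j * u^T j ord0 = dotmul b u by rewrite /dotmul [in RHS]mxE.
  rewrite !mxE eqxx e1 e2.
  by rewrite !mulr1n; ring.
have a0 : 0 <= a.
  by have := S0 (row_mx 1%:M 0); rewrite quadE mul0mx mul0mx /dotmul linear0 mulmx0 !mxE; rewrite expr1n; lra.
have bz : a = 0 -> forall u, dotmul b u = 0.
  move=> az u; apply/eqP; apply: contraT => bu0.
  pose q := (u *m C *m u^T) ord0 ord0.
  have := S0 (row_mx (- (q + 1) / (2 * dotmul b u))%:M u); rewrite quadE az mulr0 add0r -/q.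
  have -> : 2 * (- (q + 1) / (2 * dotmul b u)) * dotmul b u = - (q + 1) by field.
  lra.
have abE u : a * (a^-1 * dotmul b u) = dotmul b u.
  by have [az|an0] := eqVneq a 0; [rewrite bz// !mulr0|rewrite mulrA mulfV// mul1r].
(* When [a = 0] the inverse is [0] and so is [b], so that the formula for the Schur
   complement needs no case distinction. *)
pose C' := C - a^-1 *: (b^T *m b).
have C'E (u : 'rV[R]_d) : (u *m C' *m u^T) ord0 ord0 =
    (u *m C *m u^T) ord0 ord0 - a^-1 * dotmul b u ^+ 2.
  rewrite mulmxBr mulmxBl -scalemxAr -scalemxAl mulmxA -mulmxA [in LHS]mxE; congr (_ + _).
  have -> : u *m b^T *m b *m u^T = (dotmul b u ^+ 2)%:M.
    rewrite -mulmxA [u *m b^T]mx11_scalar [b *m u^T]mx11_scalar -scalar_mxM.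
    by rewrite -/(dotmul u b) -/(dotmul b u) dotmulC expr2.
  by rewrite !mxE eqxx mulr1n.
have psdC' : psd C'.
  split; first by rewrite linearB linearZ /= trmx_mul trmxK Ct.
  move=> u; have := S0 (row_mx (- (a^-1 * dotmul b u))%:M u); rewrite quadE C'E.
  have := abE u; set y := a^-1 * _ => ay.
  have -> : a^-1 * dotmul b u ^+ 2 = y * dotmul b u by rewrite /y; ring.
  by rewrite sqrrN -ay; lra.
have [nu' nu'N] := IH _ psdC'.
pose T (p : measurableTypeR R * 'rV[R]_d) : 'rV[R]_(1 + d) :=
  rV_cons (p.1, p.2 + p.1 *: (a^-1 *: b)).
have mT : measurable_fun setT T.
  apply: (measurableT_comp (@measurable_rV_cons R d)).
  apply/measurable_fun_pairP; split; first exact: measurable_fst.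
  apply/measurable_fun_rVP => j; rewrite /comp/=.
  under eq_fun do rewrite !mxE.
  apply: measurable_funD; first exact: measurableT_comp (measurable_coord j) measurable_snd.
  by apply: measurable_funM => //; exact: measurable_fst.
(* With a scalar [x] of variance [a] and an independent vector of covariance [C'],
   the image has the covariance blocks [a], [b] and [C' + b' b / a = C]. *)
pose P0 : probability _ R := (N a \x nu')%E.
pose TM : {mfun _ >-> _} := HB.pack T (isMeasurableFun.Build _ _ _ _ T mT).
exists (distribution P0 TM) => u A mA.
pose u0 := u ord0 ord0; pose u' : 'rV[R]_d := rsubmx (u : 'rV_(1 + d)).
pose c := u0 + a^-1 * dotmul b u'; pose w := (u' *m C' *m u'^T) ord0 ord0.
have w0 : 0 <= w by have [_] := psdC'; exact.
have uE : u = row_mx u0%:M u'.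
  rewrite -[LHS]hsubmxK; congr row_mx; apply/matrixP => i j.
  by rewrite !ord1 !mxE eqxx mulr1n /u0; congr (u _ _); apply/val_inj.
have varE : (u *m S *m u^T) ord0 ord0 = c ^+ 2 * a + w.
  rewrite uE quadE /w C'E; have := abE u'; rewrite /c; set y := a^-1 * _ => ay.
  have -> : a^-1 * dotmul b u' ^+ 2 = y * dotmul b u' by rewrite /y; ring.
  by rewrite -ay; ring.
have dotT p : dotmul u (T p) = c * p.1 + dotmul u' p.2.
  rewrite !dotmulE big_ord_recl /T mxE unlift_none -/u0.
  rewrite /c (dotmulC b) dotmulE mulrDl mulr_sumr mulr_suml -addrA -big_split/=; congr (_ + _).
  apply: eq_bigr => j _; rewrite !mxE liftK !mxE.
  have -> : u 0 (lift 0 j) = u' 0 j by rewrite /u' mxE; congr (u _ _); apply/val_inj.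
  by rewrite !mxE; ring.
rewrite linear0 mulmx0 mxE varE -normal_measureE -(normal_measure_add _ w0 mA); last first.
  by rewrite mulr_ge0 ?sqr_ge0.
transitivity (P0 [set p | A (c * p.1 + dotmul u' p.2)]).
  by rewrite /distribution/= /pushforward; congr (P0 _); apply/seteqP; split=> p /=;
    rewrite -[(u *m _) _ _]/(dotmul u (T p)) dotT.
pose B : set (measurableTypeR R * measurableTypeR R) := [set p | A (p.1 + p.2)].
have mB : measurable B.
  rewrite -[B]setTI.
  exact: (measurable_funD (@measurable_fst _ _ _ _) (@measurable_snd _ _ _ _)).
have mc : measurable_fun setT (fun x : measurableTypeR R => c * x : measurableTypeR R).
  by apply: (@measurable_funM _ _ _ _ (cst c) id).
rewrite /P0 /product_measure1/=.
pose G (x : measurableTypeR R) : \bar R := N w (xsection B x).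
transitivity (\int[N a]_x G (c * x)%R)%E.
  apply: eq_integral => x _.
  have mBx : measurable (xsection B (c * x)) by exact: measurable_xsection.
  have := nu'N u' _ mBx; rewrite linear0 mulmx0 mxE -/w -normal_measureE => H.
  apply: etrans H.
  by congr (nu' _); apply/seteqP; split=> y; rewrite /xsection/B/= !inE.
apply: (@ge0_integral_same_law R _ _ _ (measurableTypeR R) (measurableTypeR R) (measurableTypeR R)
  (N a) (N (c ^+ 2 * a)) _ id mc (@measurable_id _ _ _) _ G) => //.
- by move=> D mD; exact: normal_measure_scale.
- exact: measurable_fun_xsection.
Qed.

End normal_vector.

(** * Convergence in distribution by trigonometric polynomials *)

Section bernstein.
Context {R : realType} {d : nat}.
Implicit Types (F G : 'rV[R]_d -> R) (js : seq 'I_d) (k y t : 'rV[R]_d) (eta : R).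

(** Bernstein operator in several variables: the mean value of [F] at the end of a
    random walk started at [k] that makes, for each letter [j] of [js] and
    independently, a step [eta] in direction [j] with probability [y_j]. *)
Fixpoint bernstein eta F js k y : R :=
  if js is j :: js' then
    y ord0 j * bernstein eta F js' (k + eta *: delta_mx ord0 j) y +
    (1 - y ord0 j) * bernstein eta F js' k y
  else F k.

Lemma bernstein_affine eta F (a b : R) js k y :
  bernstein eta (fun k => a + b * F k) js k y = a + b * bernstein eta F js k y.
Proof. by elim: js k => [|j js IH] k //=; rewrite !IH; ring. Qed.

Lemma bernsteinD eta F G js k y :
  bernstein eta (fun k => F k + G k) js k y = bernstein eta F js k y + bernstein eta G js k y.
Proof. by elim: js k => [|j js IH] k //=; rewrite !IH; ring. Qed.

Lemma bernstein_cst eta (a : R) js k y : bernstein eta (fun=> a) js k y = a.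
Proof. by elim: js k => [|j js IH] k //=; rewrite !IH; ring. Qed.

Lemma bernstein_sum eta (I : Type) (s : seq I) (F : I -> 'rV[R]_d -> R) js k y :
  bernstein eta (fun k => \sum_(i <- s) F i k) js k y = \sum_(i <- s) bernstein eta (F i) js k y.
Proof.
elim: s => [|i s IH].
  rewrite big_nil -[RHS](bernstein_cst eta 0 js k y); congr bernstein.
  by apply/funext => k'; rewrite big_nil.
rewrite big_cons -IH -bernsteinD; congr bernstein.
by apply/funext => k'; rewrite big_cons.
Qed.

Lemma bernstein_le eta F G js k y : (forall j, 0 <= y ord0 j <= 1) ->
  (forall k, F k <= G k) -> bernstein eta F js k y <= bernstein eta G js k y.
Proof.
move=> y01 FG; elim: js k => [|j js IH] k //=.
have /andP[y0 y1] := y01 j.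
by rewrite lerD// ler_wpM2l// subr_ge0.
Qed.

Lemma bernstein_norm_le eta F G js k y : (forall j, 0 <= y ord0 j <= 1) ->
  (forall k, `|F k| <= G k) -> `|bernstein eta F js k y| <= bernstein eta G js k y.
Proof.
move=> y01 FG; rewrite ler_norml; apply/andP; split.
  rewrite -mulN1r -[leLHS]add0r -bernstein_affine bernstein_le// => k'.
  by rewrite add0r mulN1r; have := FG k'; rewrite ler_norml => /andP[].
by rewrite bernstein_le// => k'; rewrite (le_trans (ler_norm _)).
Qed.

(** Bias and variance of the end point of the walk. *)
Lemma bernstein_var1 eta i (t : R) js k y :
  bernstein eta (fun k => (k ord0 i - t) ^+ 2) js k y =
  (k ord0 i + eta * (count_mem i js)%:R * y ord0 i - t) ^+ 2 +
  eta ^+ 2 * (count_mem i js)%:R * (y ord0 i * (1 - y ord0 i)).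
Proof.
elim: js k => [|j js IH] k /=; first by rewrite !(mulr0, mul0r, addr0).
rewrite !IH !mxE eqxx /= eq_sym natrD; case: eqP => [->|_] /=; ring.
Qed.

(** The law of large numbers: with [m] steps of size [1 / m] in each direction
    the walk ends near [y], its variance being at most [d / m]. *)
Lemma bernstein_approx F (B e : R) (m : nat) js y :
  (forall j, 0 <= y ord0 j <= 1) -> 0 <= B -> (0 < m)%N ->
  (forall i, count_mem i js = m) ->
  (forall k, `|F k - F y| <= e + B * \sum_j (k ord0 j - y ord0 j) ^+ 2) ->
  `|bernstein m%:R^-1 F js 0 y - F y| <= e + B * (d%:R / m%:R).
Proof.
move=> y01 B0 m0 jsm Fe; set eta := _^-1.
have mN0 : m%:R != 0 :> R by rewrite pnatr_eq0 -lt0n.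
pose Q k : R := \sum_j (k ord0 j - y ord0 j) ^+ 2.
have QE : bernstein eta Q js 0 y <= d%:R / m%:R.
  rewrite bernstein_sum (_ : d%:R / m%:R = \sum_(j < d) m%:R^-1); last first.
    by rewrite sumr_const card_ord -[RHS]mulr_natl.
  apply: ler_sum => j _; rewrite bernstein_var1 jsm mxE add0r /eta mulVf// mul1r subrr expr0n/= add0r.
  rewrite expr2 -[X in X * _]mulrA mulVf// mulr1 -[leRHS]mulr1 ler_wpM2l ?invr_ge0//.
  by have /andP[y0 y1] := y01 j; rewrite mulr_ile1 ?subr_ge0// gerBl.
have -> : bernstein eta F js 0 y - F y = bernstein eta (fun k => - F y + 1 * F k) js 0 y.
  by rewrite bernstein_affine; ring.
apply: (@le_trans _ _ (bernstein eta (fun k => e + B * Q k) js 0 y)).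
  by apply: bernstein_norm_le => // k; rewrite mul1r addrC.
by rewrite bernstein_affine lerD2l ler_wpM2l.
Qed.

End bernstein.

Section trig_poly.
Context {R : realType} {d : nat}.
Implicit Types (p q : 'rV[R]_d -> R) (u x : 'rV[R]_d).

Lemma dotmul0l x : dotmul 0 x = 0.
Proof. by rewrite /dotmul mul0mx mxE. Qed.

Lemma dotmulDl u u' x : dotmul (u + u') x = dotmul u x + dotmul u' x.
Proof. by rewrite /dotmul mulmxDl mxE. Qed.

Lemma dotmulBl u u' x : dotmul (u - u') x = dotmul u x - dotmul u' x.
Proof. by rewrite /dotmul mulmxBl !mxE. Qed.

Lemma dotmulDr u x x' : dotmul u (x + x') = dotmul u x + dotmul u x'.
Proof. by rewrite !(dotmulC u) dotmulDl. Qed.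

Lemma dotmulZr u (c : R) x : dotmul u (c *: x) = c * dotmul u x.
Proof. by rewrite /dotmul linearZ/= -scalemxAr mxE. Qed.

(** Sums of shifted cosines only: a sine is a shifted cosine. *)
Inductive trig_poly : ('rV[R]_d -> R) -> Prop :=
| trig_cos a b u : trig_poly (fun x => a * cos (b + dotmul u x))
| trig_add p q : trig_poly p -> trig_poly q -> trig_poly (fun x => p x + q x).

Lemma trig_poly_cst (a : R) : trig_poly (fun=> a).
Proof.
have := trig_cos a 0 0; congr trig_poly; apply/funext => x.
by rewrite dotmul0l addr0 cos0 mulr1.
Qed.

(** Product-to-sum formula. *)
Lemma trig_poly_cosM p (a b : R) u : trig_poly p ->
  trig_poly (fun x => a * cos (b + dotmul u x) * p x).
Proof.
elim=> {p} [a' b' u'|p q _ IHp _ IHq]; last first.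
  have := trig_add IHp IHq; congr trig_poly; apply/funext => x; ring.
have := trig_add (trig_cos (a * a' / 2) (b + b') (u + u')) (trig_cos (a * a' / 2) (b - b') (u - u')).
congr trig_poly; apply/funext => x.
have -> : b + b' + dotmul (u + u') x = (b + dotmul u x) + (b' + dotmul u' x).
  by rewrite dotmulDl; ring.
have -> : b - b' + dotmul (u - u') x = (b + dotmul u x) - (b' + dotmul u' x).
  by rewrite dotmulBl; ring.
by rewrite cosB cosD; field.
Qed.

Definition sin_coord (c : R) x : 'rV[R]_d := \row_j ((1 + sin (c * x ord0 j)) / 2).

Lemma sin_coord01 c x j : 0 <= sin_coord c x ord0 j <= 1.
Proof.
rewrite mxE; have := sin_max (c * x ord0 j); rewrite ler_norml => /andP[? ?].
by apply/andP; split; lra.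
Qed.

Lemma trig_poly_bernstein c eta F js k : trig_poly (fun x => bernstein eta F js k (sin_coord c x)).
Proof.
elim: js k => [|j js IH] k /=; first exact: trig_poly_cst.
have dotE x (a : R) : dotmul (a *: delta_mx ord0 j) x = a * x ord0 j.
  rewrite dotmulE (bigD1 j)//= !mxE !eqxx/= mulr1 big1 ?addr0// => i ij.
  by rewrite !mxE eqxx/= (negbTE ij) mulr0 mul0r.
pose p x := bernstein eta F js (k + eta *: delta_mx ord0 j) (sin_coord c x).
pose q x := bernstein eta F js k (sin_coord c x).
have tp : trig_poly p by exact: IH.
have tq : trig_poly q by exact: IH.
have S x : cos (- (pi / 2) + dotmul (c *: delta_mx ord0 j) x) = sin (c * x ord0 j).
  by rewrite addrC cosBpihalf dotE.
have half r : trig_poly r -> trig_poly (fun x => 2^-1 * r x).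
  move=> tr; have := trig_poly_cosM 2^-1 0 0 tr; congr trig_poly; apply/funext => x.
  by rewrite dotmul0l addr0 cos0 mulr1.
have := trig_add (trig_add (half _ tp) (half _ tq))
  (trig_add (trig_poly_cosM 2^-1 (- (pi / 2)) (c *: delta_mx ord0 j) tp)
            (trig_poly_cosM (- 2^-1) (- (pi / 2)) (c *: delta_mx ord0 j) tq)).
congr trig_poly; apply/funext => x; rewrite S /sin_coord mxE -/(sin_coord c x).
by rewrite -/(p x) -/(q x); field.
Qed.

End trig_poly.

Section trig_approximation.
Context {R : realType} {d : nat}.
Implicit Types (F g : 'rV[R]_d -> R).

Lemma cvg_row (T : Type) (G : set_system T) {FG : Filter G} (f : T -> 'rV[R]_d) (l : 'rV[R]_d) :
  (forall j, f t ord0 j @[t --> G] --> l ord0 j) -> f @ G --> l.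
Proof.
move=> fl; apply/cvg_ballP => e e0.
have : \forall t \near G, forall j, `|l ord0 j - f t ord0 j| < e.
  apply: filter_forall => j.
  by have /cvgrPdist_lt /(_ e e0) := fl j.
by apply: filterS => t tl; exact: rV_ballP.
Qed.

Lemma compact_uniform_continuous (K : set 'rV[R]_d) F : compact K -> continuous F ->
  forall e : R, 0 < e -> exists2 del : R, 0 < del &
    forall x y : 'rV[R]_d, K x -> (forall j, `|x ord0 j - y ord0 j| < del) -> `|F x - F y| < e.
Proof.
move=> /compact_near_coveringP cK cF e e0.
have := cK R^o (0^'+) (fun del x => forall y, ball x del y -> `|F x - F y| < e).
have /[swap] /[apply] : forall x, K x -> \forall x' \near x & i \near 0^'+,
    forall y, ball x' i y -> `|F x' - F y| < e.
  move=> x Kx.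
  have /cvgrPdist_lt /(_ (e / 2)) := cF x; rewrite divr_gt0// => /(_ isT) /nbhs_ballP[r /= r0 rF].
  exists (ball x (r / 2), [set i | i < r / 2]) => /=.
    split; first by apply: nbhsx_ballx; rewrite divr_gt0.
    by apply: nbhs_right_lt; rewrite divr_gt0.
  move=> [x' i] [/= x'x ir] y yx'.
  have Fx' : `|F x - F x'| < e / 2.
    by apply: rF; apply: le_ball x'x; rewrite ler_pdivrMr// ler_peMr ?ler1n// ltW.
  have Fy : `|F x - F y| < e / 2.
    apply: rF; rewrite [r]splitr; apply: ball_triangle x'x _.
    exact: le_ball (ltW ir) _ yx'.
  rewrite [e]splitr (_ : F x' - F y = - (F x - F x') + (F x - F y)); last by ring.
  by rewrite (le_lt_trans (ler_normD _ _))// normrN ltrD.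
move=> H.
have [del [del0 Hdel]] : exists del : R, 0 < del /\
    (forall x, K x -> forall y, ball x del y -> `|F x - F y| < e).
  near (0 : R)^'+ => del; exists del; split=> //.
  by near: del.
exists del => // x y Kx xy; apply: (Hdel x Kx).
exact: rV_ballP.
Unshelve. all: by end_near.
Qed.

Definition clamp (s : R) (t : R) : R := Num.max (- s) (Num.min t s).

Lemma clamp_bound s t : 0 <= s -> - s <= clamp s t <= s.
Proof.
move=> s0; rewrite /clamp le_max lexx/= ge_max ge_min lexx orbT andbT.
by rewrite (le_trans _ s0)// oppr_le0.
Qed.

Lemma clamp_id s t : - s <= t <= s -> clamp s t = t.
Proof. by move=> /andP[s1 s2]; rewrite /clamp min_l// max_r. Qed.

Lemma continuous_clamp s : continuous (clamp s).
Proof.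
move=> t; apply: (@continuous_max _ _ (cst (- s)) (fun t => Num.min t s)).
  exact: cvg_cst.
by apply: (@continuous_min _ _ id (cst s)) => //; exact: cvg_cst.
Qed.

(** Around [0] the sine is undone by a globally continuous function, so that a
    continuous function on a cube is a continuous function of the sines. *)
Lemma sin_continuous_section : exists tau : R -> R, continuous tau /\
  forall t, - 2^-1 <= t <= 2^-1 -> tau (sin t) = t.
Proof.
have pi1 := @pihalf_ge1 R.
have i12 t : - 2^-1 <= t <= 2^-1 -> t \in `[(- (pi / 2)), (pi / 2) : R].
  by move=> /andP[t1 t2]; rewrite in_itv/=; apply/andP; split; lra.
pose s : R := sin 2^-1.
have s0 : 0 < s by apply: sin_gt0_pihalf; apply/andP; split; lra.
have s1 : s < 1.
  apply: lt_le_trans (sin_le1 (1 : R)); rewrite ltr_sin ?in_itv/=; first by lra.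
    by apply/andP; split; lra.
  by apply/andP; split; lra.
(* The clamping keeps the argument of [asin] away from the points [-1] and [1]. *)
exists (fun t => asin (clamp s t)); split=> [t|t t12].
  apply: (@continuous_comp _ _ _ (clamp s) asin); first exact: continuous_clamp.
  apply: continuous_asin; have /andP[c1 c2] := clamp_bound t (ltW s0).
  by apply/andP; split; lra.
have le_sin (x y : R) : - 2^-1 <= x <= 2^-1 -> - 2^-1 <= y <= 2^-1 -> x <= y -> sin x <= sin y.
  by move=> xi yi xy; rewrite leNgt ltr_sin ?i12// -leNgt.
have h : - 2^-1 <= (2^-1 : R) <= 2^-1 by apply/andP; split; lra.
have hN : - 2^-1 <= (- 2^-1 : R) <= 2^-1 by apply/andP; split; lra.
rewrite clamp_id ?sinK ?i12// /s -sinN.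
by have /andP[t1 t2] := t12; rewrite !le_sin.
Qed.

(** Near the origin [g] is a continuous function of the sines of the coordinates.
    Its Bernstein polynomials in these sines are trigonometric polynomials; they are
    bounded by [M] on the whole space because sines are bounded everywhere. *)
Lemma trig_poly_dense g (M r e : R) : continuous g -> (forall x, `|g x| <= M) ->
  0 < r -> 0 < e -> exists q, [/\ trig_poly q, (forall x, `|q x| <= M) &
    forall x, cube r x -> `|g x - q x| <= e].
Proof.
move=> cg gM r0 e0.
have [tau [ctau tauK]] := sin_continuous_section.
(* The scale at which the cube of half side [r] is mapped into the interval where
   [tau] inverts the sine; [F] reads [g] in the variables [(1 + sin (c x_j)) / 2]. *)
pose c := (2 * r)^-1; have c0 : 0 < c by rewrite invr_gt0 mulr_gt0.
pose F (k : 'rV[R]_d) := g (\row_j (c^-1 * tau (2 * k ord0 j - 1))).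
have cF : continuous F.
  move=> k; apply: (@continuous_comp _ _ _ (fun k : 'rV[R]_d => \row_j (c^-1 * tau (2 * k ord0 j - 1))) g); last exact: cg.
  apply: (@cvg_row _ (nbhs k) _) => j; rewrite !mxE; under eq_cvg do rewrite mxE.
  apply: cvgM; first exact: cvg_cst.
  apply: (cvg_comp (fun x : 'rV[R]_d => 2 * x ord0 j - 1) tau _ (ctau _)).
  apply: cvgB; last exact: cvg_cst.
  by apply: cvgM; [exact: cvg_cst|exact: coord_continuous].
have FM k : `|F k| <= M by exact: gM.
have M0 : 0 <= M by exact: le_trans (FM 0).
have FE x : cube r x -> F (sin_coord c x) = g x.
  move=> xr; congr g; apply/rowP => j; rewrite !mxE.
  have -> : 2 * ((1 + sin (c * x ord0 j)) / 2) - 1 = sin (c * x ord0 j) by field.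
  rewrite tauK ?mulKf ?gt_eqF//.
  have /andP[x1 x2] := xr j; have cr : c * r = 2^-1 by rewrite /c; field; rewrite gt_eqF.
  by rewrite -cr -mulrN !ler_pM2l// x1.
pose K1 := [set y : 'rV[R]_d | forall j, 0 <= y ord0 j <= 1].
have cK1 : compact K1.
  have -> : K1 = [set v | forall i, `[0, 1]%classic (v ord0 i)].
    by apply/seteqP; split=> v /= h i; have := h i; rewrite in_itv.
  by apply: (@rV_compact R d (fun=> `[0, 1]%classic)) => i; exact: segment_compact.
have [del del0 Hdel] := compact_uniform_continuous cK1 cF (divr_gt0 e0 (ltr0n R 2)).
(* Where [k] is further than [del] from the sines, the oscillation of [F], at most
   [2 M], is paid for by the squared distance; its mean value is a variance. *)
pose B := 2 * M / del ^+ 2.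
have B0 : 0 <= B by apply: divr_ge0; [exact: mulr_ge0|exact: sqr_ge0].
have [m m0 mB] : exists2 m, (0 < m)%N & B * (d%:R / m%:R) <= e / 2.
  exists (Num.truncn (2 * (B * d%:R) / e)).+1 => //.
  have := truncnS_gt (2 * (B * d%:R) / e); set k := (Num.truncn _).+1.
  rewrite ltr_pdivrMr// => BT.
  have T0 : 0 < k%:R :> R by rewrite ltr0n.
  rewrite (mulrA B) (ler_pdivrMr _ _ T0); move: BT; set D := B * d%:R => BT.
  by rewrite mulrAC ler_pdivlMr// mulrC [e * _]mulrC ltW.
pose js := flatten (nseq m (enum 'I_d)).
have jsm i : count_mem i js = m.
  rewrite count_flatten map_nseq sumn_nseq count_uniq_mem ?enum_uniq// mem_enum mul1n//.
exists (fun x => bernstein m%:R^-1 F js 0 (sin_coord c x)); split.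
- exact: trig_poly_bernstein.
- move=> x; rewrite -[leRHS](bernstein_cst m%:R^-1 M js 0 (sin_coord c x)).
  by apply: bernstein_norm_le => //; exact: sin_coord01.
move=> x xr; rewrite -(FE x xr) distrC [e]splitr.
apply: le_trans (lerD (lexx _) mB).
apply: (bernstein_approx (sin_coord01 c x) B0 m0 jsm) => k.
have S0 : 0 <= \sum_j (k ord0 j - sin_coord c x ord0 j) ^+ 2.
  by apply: sumr_ge0 => j _; exact: sqr_ge0.
have [near|/existsNP[j /negP]] := pselect (forall j, `|sin_coord c x ord0 j - k ord0 j| < del).
  rewrite distrC (le_trans (ltW (Hdel _ _ (sin_coord01 c x) near)))// lerDl mulr_ge0//.
rewrite -leNgt => far; apply: (@le_trans _ _ (2 * M)).
  by rewrite (le_trans (ler_normB _ _))// mulr_natl mulr2n lerD.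
rewrite (@le_trans _ _ (B * del ^+ 2))//.
  by rewrite /B divfK// expf_eq0/= gt_eqF.
apply: ler_wpDl; first by rewrite divr_ge0// ltW.
rewrite ler_wpM2l//.
rewrite (bigD1 j)//= -[leLHS]addr0 lerD//.
  by rewrite -[leRHS]real_normK ?num_real// distrC lerXn2r ?nnegrE// ltW.
by apply: sumr_ge0 => i _; exact: sqr_ge0.
Qed.

End trig_approximation.

Section weak_convergence.
Context {R : realType} {dO : measure_display} {O : measurableType dO} (P : probability O R).
Context {d : nat} (nu : probability 'rV[R]_d R).
Variable Y : nat -> O -> 'rV[R]_d.
Implicit Types (q : 'rV[R]_d -> R) (u : 'rV[R]_d) (b : R).
Hypothesis mY : forall N, measurable_fun setT (Y N).
Hypothesis cosY : forall b u, \int[P]_w cos (b + dotmul u (Y N w)) @[N --> \oo] -->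
  \int[nu]_x cos (b + dotmul u x).

Lemma measurable_cos_dotmul b u : measurable_fun setT (fun x : 'rV[R]_d => cos (b + dotmul u x)).
Proof.
apply: (measurableT_comp measurable_cos).
by apply: (@measurable_funD _ _ _ _ (cst b)) => //; exact: measurable_dotmul.
Qed.

Lemma trig_poly_bmeas q : trig_poly q -> measurable_fun setT q /\ exists M, forall x, `|q x| <= M.
Proof.
elim=> {q} [a b u|p q _ [mp [M pM]] _ [mq [M' qM]]].
  split.
    by apply: (@measurable_funM _ _ _ _ (cst a)) => //; exact: measurable_cos_dotmul.
  by exists `|a| => x; rewrite normrM ler_piMr// cos_max.
split; first exact: measurable_funD.
by exists (M + M') => x; rewrite (le_trans (ler_normD _ _))// lerD.
Qed.

Lemma trig_poly_integrable {dT} {T : measurableType dT} (Q : probability T R) (Z : T -> 'rV[R]_d) q :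
  measurable_fun setT Z -> trig_poly q -> Q.-integrable setT (EFin \o (q \o Z)).
Proof.
move=> mZ /trig_poly_bmeas[mq [M qM]].
by apply: (@integrable_bounded _ _ _ _ _ M) => [|x]; [exact: measurableT_comp|exact: qM].
Qed.

Lemma trig_poly_cvg q : trig_poly q ->
  \int[P]_w q (Y N w) @[N --> \oo] --> \int[nu]_x q x.
Proof.
elim=> {q} [a b u|p q tp IHp tq IHq].
  rewrite RintegralZl//; last first.
    apply: (@integrable_bounded _ _ _ _ _ 1) => [|x]; first exact: measurable_cos_dotmul.
    exact: cos_max.
  under eq_cvg => N.
    rewrite RintegralZl//; last first.
      apply: (@integrable_bounded _ _ _ _ _ 1) => [|x]; last exact: cos_max.
      exact: measurableT_comp (measurable_cos_dotmul b u) (mY N).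
    over.
  by apply: cvgM; [exact: cvg_cst|exact: cosY].
rewrite RintegralD//; [|exact: (trig_poly_integrable nu (@measurable_id _ _ _) tp)
  |exact: (trig_poly_integrable nu (@measurable_id _ _ _) tq)].
under eq_cvg => N.
  rewrite RintegralD//; [|exact: (trig_poly_integrable P (mY N) tp)
    |exact: (trig_poly_integrable P (mY N) tq)].
  over.
exact: cvgD.
Qed.

Lemma cube_tail (e : R) : 0 < e -> exists2 r : R, 0 < r & \int[nu]_x \1_(~` cube r) x <= e.
Proof.
move=> e0.
have mC k : measurable (@cube R d k%:R) by exact: measurable_cube.
have ndC : nondecreasing_seq (fun k => @cube R d k%:R).
  move=> m n mn; apply/subsetPset => x xm j; have /andP[x1 x2] := xm j.
  have mnR : m%:R <= n%:R :> R by rewrite ler_nat.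
  by rewrite (le_trans x2)// andbT (le_trans _ x1)// lerN2.
have CT : \bigcup_k @cube R d k%:R = setT.
  rewrite -subTset => x _; exists (Num.truncn (\sum_j `|x ord0 j|)).+1 => // j.
  rewrite -ler_norml (@le_trans _ _ (\sum_j `|x ord0 j|))//; last by rewrite ltW// truncnS_gt.
  by rewrite (bigD1 j)//= lerDl sumr_ge0.
have : nu \o (fun k => @cube R d k%:R) @ \oo --> nu (\bigcup_k @cube R d k%:R).
  by apply: nondecreasing_cvg_mu => //; rewrite CT.
rewrite CT probability_setT => nuC.
have : \forall k \near \oo, ((1 - e)%:E < nu (@cube R d k%:R))%E.
  have : fine (nu (@cube R d k%:R)) @[k --> \oo] --> (1 : R) by exact: fine_cvg nuC.
  move=> /cvgr_gt /(_ (1 - e)); rewrite gtrBl => /(_ e0); apply: filterS => k ke.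
  by rewrite -(fineK (fin_num_measure nu _ (mC k))) lte_fin.
move=> [k _ /(_ k.+1 (leqnSn k)) /= kC].
exists k.+1%:R => //.
have mc : measurable (~` @cube R d k.+1%:R) by apply: measurableC; exact: measurable_cube.
rewrite /Rintegral integral_indic// setIT.
rewrite [X in fine X](_ : _ = (1 - nu (@cube R d k.+1%:R))%E); last first.
  exact: probability_setC (mC k.+1).
have fC : nu (@cube R d k.+1%:R) \is a fin_num by exact: fin_num_measure.
move: kC; rewrite -(fineK fC) lte_fin -EFinB/=; lra.
Qed.

(** Convergence of the Fourier transforms and tightness give convergence in
    distribution: a bounded continuous function is uniformly close, on a large
    cube, to a trigonometric polynomial with the same bound. *)
Lemma cvg_in_distribution_cos :
  (forall e : R, 0 < e -> exists2 r : R, 0 < r &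
     \forall N \near \oo, \int[P]_w \1_(~` cube r) (Y N w) <= e) ->
  cvg_in_distribution P Y nu.
Proof.
move=> tight g cg [M0 [_ gM0]].
have [M gM] : exists M, forall x, `|g x| <= M by exists (M0 + 1) => x; apply: gM0 => //; rewrite ltrDl.
have M_ge0 : 0 <= M by exact: le_trans (gM 0).
have mg : measurable_fun setT g by exact: continuous_measurable_rV.
have ig N : P.-integrable setT (EFin \o (g \o Y N)).
  by apply: (@integrable_bounded _ _ _ _ _ M) => [|w]; [exact: measurableT_comp|exact: gM].
have inu : nu.-integrable setT (EFin \o g) by apply: (@integrable_bounded _ _ _ _ _ M).
have EE N : 'E_P[fun w => g (Y N w)]%E = (\int[P]_w g (Y N w))%:E.
  by rewrite unlock EFin_Rintegral//; exact: ig.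
under eq_cvg do rewrite EE.
rewrite -EFin_Rintegral//; apply: cvg_EFin; first by near=> N.
apply/cvgrPdist_le => e e0 /=.
pose a := e / (6 * (1 + 2 * M)).
have a0 : 0 < a by rewrite divr_gt0// mulr_gt0// ltr_wpDr// mulr_ge0.
have [r1 r10 tailnu] := cube_tail a0.
have [r2 r20 tailP] := tight a a0.
pose r := Num.max r1 r2.
have r0 : 0 < r by rewrite lt_max r10.
have cube_sub s : s <= r -> @cube R d s `<=` cube r.
  move=> sr x xs j; have /andP[x1 x2] := xs j.
  by rewrite (le_trans x2)// andbT (le_trans _ x1)// lerN2.
have indic_sub s x : s <= r -> \1_(~` @cube R d r) x <= \1_(~` cube s) x :> R.
  move=> sr; rewrite !indicE ler_nat; case: (boolP (x \in ~` cube r)) => //; rewrite inE => xr.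
  by rewrite mem_set// => /(cube_sub _ sr).
have [q [tq qM gq]] := trig_poly_dense cg gM r0 a0.
have [mq _] := trig_poly_bmeas tq.
have diff x : `|g x - q x| <= a + 2 * M * \1_(~` cube r) x.
  have [xr|xr] := pselect (cube r x).
    by rewrite (le_trans (gq x xr))// lerDl mulr_ge0// mulr_ge0.
  rewrite indicE mem_set// mulr1 -[leLHS]add0r lerD ?(ltW a0)//.
  by rewrite (le_trans (ler_normB _ _))// mulr_natl mulr2n lerD.
have bound (dT : measure_display) (T : measurableType dT) (Q : probability T R) (Z : T -> 'rV[R]_d) s :
    measurable_fun setT Z -> s <= r -> \int[Q]_w \1_(~` cube s) (Z w) <= a ->
    `|\int[Q]_w g (Z w) - \int[Q]_w q (Z w)| <= a * (1 + 2 * M).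
  move=> mZ sr Qs.
  have i1 : Q.-integrable setT (EFin \o (g \o Z)).
    by apply: (@integrable_bounded _ _ _ _ _ M) => [|w]; [exact: measurableT_comp|exact: gM].
  have i2 : Q.-integrable setT (EFin \o (q \o Z)).
    by apply: (@integrable_bounded _ _ _ _ _ M) => [|w]; [exact: measurableT_comp|exact: qM].
  have mi s' : measurable_fun setT (fun w => \1_(~` @cube R d s') (Z w) : R).
    have mc : measurable (~` @cube R d s') by apply: measurableC; exact: measurable_cube.
    exact: (measurableT_comp (measurable_indic mc) mZ).
  have i3 s' : Q.-integrable setT (EFin \o (fun w => \1_(~` @cube R d s') (Z w) : R)).
    by apply: (@integrable_bounded _ _ _ _ _ 1) => // w; rewrite indicE; case: (_ \in _); rewrite ?normr1 ?normr0.
  have i4 : Q.-integrable setT (EFin \o cst a) by exact: finite_measure_integrable_cst.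
  rewrite -RintegralB//.
  apply: (@le_trans _ _ (\int[Q]_w (a + 2 * M * \1_(~` cube s) (Z w)))).
    apply: le_normr_Rintegral_le.
    - exact: integrable_subr.
    - by apply: integrable_addr => //; exact: integrable_scaler.
    - move=> w; apply: le_trans (diff _) _; rewrite lerD2l ler_wpM2l ?mulr_ge0//.
      exact: indic_sub.
  rewrite RintegralD//; last by exact: integrable_scaler.
  have -> : \int[Q]_w a = a by exact: Rintegral_prob_cst.
  rewrite RintegralZl// mulrDr mulr1 lerD2l [leRHS]mulrC ler_wpM2l ?mulr_ge0//.
have r1r : r1 <= r by rewrite le_max lexx.
have r2r : r2 <= r by rewrite le_max lexx orbT.
have a6 : a * (1 + 2 * M) = e / 6 by rewrite /a; field; rewrite gt_eqF// ltr_wpDr// mulr_ge0.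
have bnu := bound _ _ nu id r1 (@measurable_id _ _ _) r1r tailnu.
have := trig_poly_cvg tq => /cvgrPdist_le /(_ (e / 6)); rewrite divr_gt0// => /(_ isT) qcvg.
near=> N.
have bP : `|\int[P]_w g (Y N w) - \int[P]_w q (Y N w)| <= a * (1 + 2 * M).
  by apply: (bound _ _ P (Y N) r2) => //; near: N.
have bq : `|\int[nu]_x q x - \int[P]_w q (Y N w)| <= e / 6 by near: N.
move: bnu bP bq; rewrite a6 /=.
set A := \int[nu]_x g x; set B := \int[P]_w g _; set C := \int[nu]_x q x; set D := \int[P]_w q _.
rewrite !ler_norml => /andP[? ?] /andP[? ?] /andP[? ?]; apply/andP; split; lra.
Unshelve. all: by end_near.
Qed.

End weak_convergence.

(** * A central limit theorem for triangular arrays *)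

Section cos_sum_normal.
Context {R : realType} {dO : measure_display} {O : measurableType dO} (P : probability O R).
Context {dT : measure_display} {T : measurableType dT}.
Variables (N : nat) (X : 'I_N -> {RV P >-> T}).
Hypothesis indepX : independent_RVs X.
Hypothesis idX : forall i j A, measurable A -> P (X i @^-1` A) = P (X j @^-1` A).
Variables (c : T -> R) (B V v : R).
Hypotheses (mc : measurable_fun setT c) (cB : forall x, `|c x| <= B).
Hypothesis c0 : forall i, \int[P]_w c (X i w) = 0.
Hypothesis cV : forall i, \int[P]_w (c (X i w)) ^+ 2 = V / N%:R.
Hypothesis v0 : 0 <= v.

(** Both the summand and a normal variable of variance [v / N] have a
    characteristic function equal to [1 - v / 2N] up to a small multiple of [1 / N]. *)
Lemma cos_sum_normal (b : R) : (0 < N)%N ->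
  `|\int[P]_w cos (b + \sum_i c (X i w)) - normal_cf v * cos b| <=
  (B ^+ 2 + B) * V + `|V - v| / 2 + @normal_moment4 R * v ^+ 2 / N%:R.
Proof.
move=> N0; pose i0 := Ordinal N0.
have NR : 0 < N%:R :> R by rewrite ltr0n.
have B0 : 0 <= B by exact: le_trans (cB point).
have mF (F : measurableTypeR R -> R) : measurable_fun setT F -> measurable_fun setT (fun x => F (c x)).
  by move=> mF; exact: measurableT_comp.
have E_id (F : measurableTypeR R -> R) (M : R) i : measurable_fun setT F -> (forall t, `|F t| <= M) ->
    \int[P]_w F (c (X i w)) = \int[P]_w F (c (X i0 w)).
  move=> mFF FM; apply: (@Rintegral_same_law R _ _ _ _ _ _ P P (X i) (X i0) _ _ _ (fun x => F (c x)) M) => //.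
  - by move=> A mA; exact: idX.
  - exact: mF.
have mX : measurable_fun setT (fun w => c (X i0 w)) by exact: measurableT_comp.
have ic : P.-integrable setT (EFin \o (fun w => c (X i0 w))).
  by apply: (@integrable_bounded _ _ _ _ _ B).
have ic2 : P.-integrable setT (EFin \o (fun w => c (X i0 w) ^+ 2)).
  apply: (@integrable_bounded _ _ _ _ _ (B ^+ 2)) => [|w]; first exact: measurable_funX.
  by rewrite normrX lerXn2r ?nnegrE.
have icos : P.-integrable setT (EFin \o (fun w => cos (c (X i0 w)))).
  apply: (@integrable_bounded _ _ _ _ _ 1) => [|w]; last exact: cos_max.
  exact: measurableT_comp measurable_cos mX.
have isin : P.-integrable setT (EFin \o (fun w => sin (c (X i0 w)))).
  apply: (@integrable_bounded _ _ _ _ _ 1) => [|w]; last exact: sin_max.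
  exact: measurableT_comp measurable_sin mX.
set r := \int[P]_w cos (c (X i0 w)); set s := \int[P]_w sin (c (X i0 w)).
have rE i : \int[P]_w cos (c (X i w)) = r by exact: E_id measurable_cos (@cos_max R).
have sE i : \int[P]_w sin (c (X i w)) = s by exact: E_id measurable_sin (@sin_max R).
have VN : 0 <= V / N%:R by rewrite -(cV i0); apply: Rintegral_ge0 => w _; exact: sqr_ge0.
have rhoX : normal_cf (v / N%:R) ^+ N = normal_cf v.
  by have := normal_cfX N.-1 v0; rewrite prednK.
rewrite -rhoX; apply: le_trans (expectation_cos_sum indepX mc rE sE b (normal_cf_le1 _)) _.
have r1 : `|r - 1 + V / N%:R / 2| <= B ^+ 2 * (V / N%:R).
  have P1 : \int[P]_w (1 : R) = 1 by exact: Rintegral_prob_cst.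
  rewrite -[X in r - X]P1 -(cV i0) [_ / 2]mulrC -[B ^+ 2 * _]RintegralZl//.
  rewrite -RintegralB//; last exact: finite_measure_integrable_cst.
  have i1 : P.-integrable setT (EFin \o (fun w => cos (c (X i0 w)) - 1)).
    by apply: integrable_subr => //; exact: finite_measure_integrable_cst.
  have i2 : P.-integrable setT (EFin \o (fun w => 2^-1 * c (X i0 w) ^+ 2)) by exact: integrable_scaler.
  rewrite -[2^-1 * _]RintegralZl// -RintegralD//.
  apply: le_normr_Rintegral_le; [exact: integrable_addr|exact: integrable_scaler|].
  move=> w; rewrite [2^-1 * _]mulrC (le_trans (ler_norm_cos_quad _))//.
  rewrite -[c _ ^+ 2]real_normK ?num_real// (exprD _ 2 2) ler_wpM2r ?sqr_ge0//.
  by rewrite lerXn2r ?nnegrE.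
have s1 : `|s| <= B * (V / N%:R).
  rewrite -[s]subr0 -[X in _ - X](c0 i0) -RintegralB// -(cV i0) -RintegralZl//.
  apply: le_normr_Rintegral_le; [exact: integrable_subr|exact: integrable_scaler|].
  move=> w; rewrite (le_trans (ler_norm_sin_id _))//.
  by rewrite -[c _ ^+ 2]real_normK ?num_real// exprS ler_wpM2r ?sqr_ge0.
have rho1 := normal_cf_quad (divr_ge0 v0 (ltW NR)).
have rrho : `|r - normal_cf (v / N%:R)| <= B ^+ 2 * (V / N%:R) + `|V - v| / 2 / N%:R + normal_moment4 * (v / N%:R) ^+ 2.
  have -> : r - normal_cf (v / N%:R) = (r - 1 + V / N%:R / 2) + ((v - V) / 2 / N%:R) -
      (normal_cf (v / N%:R) - 1 + v / N%:R / 2) by field; rewrite gt_eqF.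
  rewrite (le_trans (ler_normB _ _))// lerD// (le_trans (ler_normD _ _))// lerD//.
  by rewrite !normrM !normfV distrC !(@ger0_norm _ _%:R).
apply: (@le_trans _ _ (N%:R * (B ^+ 2 * (V / N%:R) + `|V - v| / 2 / N%:R + normal_moment4 * (v / N%:R) ^+ 2 + B * (V / N%:R)))).
  by apply: (ler_wpM2l (ltW NR)); exact: lerD.
rewrite le_eqVlt; apply/orP; left; apply/eqP; field; exact: lt0r_neq0.
Qed.

End cos_sum_normal.

Lemma cvg_sumr {R : realType} (I : finType) (f : I -> nat -> R) (l : I -> R) :
  (forall i, f i N @[N --> \oo] --> l i) -> \sum_i f i N @[N --> \oo] --> \sum_i l i.
Proof. by move=> fl; apply: cvg_big => [|i _]; [exact: add_continuous|exact: fl]. Qed.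

Section clt.
Context {R : realType} {dO : measure_display} {O : measurableType dO} (P : probability O R).
Context {dT : measure_display} {T : measurableType dT} {d : nat}.
Variable X : forall N, 'I_N -> {RV P >-> T}.
Arguments X : clear implicits.
Hypothesis indepX : forall N, independent_RVs (X N).
Hypothesis idX : forall N i j A, measurable A -> P (X N i @^-1` A) = P (X N j @^-1` A).
Variables (xi : nat -> T -> 'rV[R]_d) (B : nat -> R) (V : nat -> 'rV[R]_d -> R).
Variables (S : 'M[R]_d) (shift : nat -> 'rV[R]_d).
Hypothesis mxi : forall N, measurable_fun setT (xi N).
Hypothesis xiB : forall N x j, `|xi N x ord0 j| <= B N.
Hypothesis B0 : B N @[N --> \oo] --> 0.
Hypothesis xi0 : forall N i j, \int[P]_w xi N (X N i w) ord0 j = 0.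
Hypothesis xiV : forall N i u, \int[P]_w (dotmul u (xi N (X N i w))) ^+ 2 = V N u / N%:R.
Hypothesis VS : forall u, V N u @[N --> \oo] --> (u *m S *m u^T) ord0 ord0.
Hypothesis S0 : forall u : 'rV[R]_d, 0 <= (u *m S *m u^T) ord0 ord0.
Hypothesis shift0 : shift N @[N --> \oo] --> (0 : 'rV[R]_d).

Let Y N w := \sum_i xi N (X N i w) + shift N.

Lemma shift_coord j : shift N ord0 j @[N --> \oo] --> 0.
Proof.
have -> : 0 = (0 : 'rV[R]_d) ord0 j by rewrite mxE.
by apply: (cvg_comp shift (fun x : 'rV[R]_d => x ord0 j) shift0); exact: coord_continuous.
Qed.

Lemma dotmul_shift u : dotmul u (shift N) @[N --> \oo] --> 0.
Proof.
under eq_cvg do rewrite dotmulE.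
have : \sum_j u ord0 j * shift N ord0 j @[N --> \oo] --> \sum_j u ord0 j * 0.
  apply: (cvg_sumr (f := fun j N => u ord0 j * shift N ord0 j)) => j.
  by apply: cvgM; [exact: cvg_cst|exact: shift_coord].
by rewrite big1// => j _; rewrite mulr0.
Qed.

Let xi_dot N u x : `|dotmul u (xi N x)| <= (\sum_j `|u ord0 j|) * B N.
Proof.
rewrite dotmulE (le_trans (ler_norm_sum _ _ _))// mulr_suml ler_sum// => j _.
by rewrite normrM ler_wpM2l.
Qed.

Let mdot N u : measurable_fun setT (fun x => dotmul u (xi N x)).
Proof. exact: measurableT_comp (measurable_dotmul u) (mxi N). Qed.

Let mX N i : measurable_fun setT (X N i). Proof. exact: measurable_funP. Qed.

Let mxij N i j : measurable_fun setT (fun w => xi N (X N i w) ord0 j : measurableTypeR R).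
Proof.
have /measurable_fun_rVP mx := mxi N.
exact: (measurableT_comp (mx j) (mX i)).
Qed.

Let ixi N i j : P.-integrable setT (EFin \o (fun w => xi N (X N i w) ord0 j)).
Proof.
apply: (@integrable_bounded _ _ _ _ _ (B N)) => [|w]; last exact: xiB.
exact: mxij.
Qed.

Let dot0 N u i : \int[P]_w dotmul u (xi N (X N i w)) = 0.
Proof.
under eq_Rintegral do rewrite dotmulE.
rewrite Rintegral_sumr => [|j _]; last exact/integrable_scaler/ixi.
by rewrite big1// => j _; rewrite RintegralZl// xi0 mulr0.
Qed.

Let dotY N u w : dotmul u (Y N w) = dotmul u (shift N) + \sum_i dotmul u (xi N (X N i w)).
Proof.
rewrite /Y dotmulDr addrC; congr (_ + _).
rewrite dotmulE; under eq_bigr do rewrite summxE mulr_sumr.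
by rewrite exchange_big; apply: eq_bigr => i _; rewrite dotmulE.
Qed.

Let mY N : measurable_fun setT (Y N).
Proof.
apply/measurable_fun_rVP => j; rewrite /Y; under eq_fun do rewrite mxE summxE.
apply: measurable_funD => //; apply: measurable_sum => i.
exact: mxij.
Qed.

(** The summands are those of [cos_sum_normal], whose error bound does not depend
    on the phase; the deterministic shift only moves the phase. *)
Lemma cos_clt (b : R) u : \int[P]_w cos (b + dotmul u (Y N w)) @[N --> \oo] -->
  normal_cf ((u *m S *m u^T) ord0 ord0) * cos b.
Proof.
set v := (_ *m _) _ _; pose D := \sum_j `|u ord0 j|.
pose err N := ((D * B N) ^+ 2 + D * B N) * V N u + `|V N u - v| / 2 + @normal_moment4 R * v ^+ 2 / N%:R.
have DB0 : D * B N @[N --> \oo] --> 0.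
  by rewrite -(mulr0 D); apply: cvgM => //; exact: cvg_cst.
have err0 : err N @[N --> \oo] --> 0.
  have -> : 0 = (0 * 0 + 0) * v + `|v - v| / 2 + @normal_moment4 R * v ^+ 2 * 0 :> R.
    by rewrite subrr normr0; ring.
  apply: cvgD; first apply: cvgD.
  - apply: cvgM; last exact: VS.
    by apply: cvgD => //; under eq_cvg do rewrite expr2; apply: cvgM.
  - apply: cvgM; last exact: cvg_cst.
    by apply: cvg_norm; apply: cvgB; [exact: VS|exact: cvg_cst].
  - apply: cvgM; first exact: cvg_cst.
    by apply/gtr0_cvgV0; [exists 1%N => // n /=; rewrite ltr0n|exact: cvgr_idn].
have cosb : normal_cf v * cos (b + dotmul u (shift N)) @[N --> \oo] --> normal_cf v * cos b.
  apply: cvgM; first exact: cvg_cst.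
  apply: (cvg_comp (fun N => b + dotmul u (shift N)) cos _ (@continuous_cos R b)).
  have := cvgD (cvg_cst b) (dotmul_shift u); rewrite addr0; exact.
have close N : (0 < N)%N -> `|normal_cf v * cos (b + dotmul u (shift N)) - \int[P]_w cos (b + dotmul u (Y N w))| <= err N.
  move=> N0; rewrite distrC; under eq_Rintegral do rewrite dotY addrA.
  exact: (cos_sum_normal (@indepX N) (@idX N) (@mdot N u) (@xi_dot N u) (@dot0 N u)
    (fun i => @xiV N i u) (@S0 u)).
rewrite -[X in _ --> X]subr0.
have -> : (fun N => \int[P]_w cos (b + dotmul u (Y N w))) = (fun N =>
    normal_cf v * cos (b + dotmul u (shift N)) -
    (normal_cf v * cos (b + dotmul u (shift N)) - \int[P]_w cos (b + dotmul u (Y N w)))).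
  by apply/funext => N; ring.
apply: cvgB => //; apply/norm_cvg0P.
apply: (@squeeze_cvgr _ _ _ _ (cst 0) err) => //; last exact: cvg_cst.
by exists 1%N => // N /= N0; rewrite normr_ge0 close.
Qed.

Lemma second_moment N u : \int[P]_w (\sum_i dotmul u (xi N (X N i w))) ^+ 2 <= `|V N u|.
Proof.
rewrite (expectation_sum_sq (@indepX N) (c := fun x => dotmul u (xi N x))).
- under eq_bigr do rewrite xiV; rewrite sumr_const card_ord -[_ *+ N]mulr_natr.
  by case: (posnP N) => [->|N0]; [rewrite mulr0|rewrite divfK ?ler_norm// pnatr_eq0 -lt0n].
- by split; [exact: mdot|exists ((\sum_j `|u ord0 j|) * B N); exact: xi_dot].
- exact: dot0.
Qed.

(** Chebyshev's inequality: the second moments are bounded. *)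
Lemma tight_array (e : R) : 0 < e -> exists2 r : R, 0 < r &
  \forall N \near \oo, \int[P]_w \1_(~` cube r) (Y N w) <= e.
Proof.
move=> e0; pose E j : 'rV[R]_d := delta_mx ord0 j.
have EE j (x : 'rV[R]_d) : dotmul (E j) x = x ord0 j.
  rewrite dotmulE (bigD1 j)//= mxE !eqxx mul1r big1 ?addr0// => i ij.
  by rewrite mxE (negbTE ij) andbF mul0r.
pose a N := \sum_j 2 * (`|V N (E j)| + shift N ord0 j ^+ 2).
pose al := \sum_j 2 * (`|(E j *m S *m (E j)^T) ord0 ord0| + 0 * 0).
have acvg : a N @[N --> \oo] --> al.
  apply: (cvg_sumr (f := fun j N => 2 * (`|V N (E j)| + shift N ord0 j ^+ 2))) => j.
  apply: cvgM; first exact: cvg_cst.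
  apply: cvgD; first by apply: cvg_norm; exact: VS.
  by under eq_cvg do rewrite expr2; apply: cvgM; exact: shift_coord.
have al0 : 0 <= al by apply: sumr_ge0 => j _; rewrite mulr_ge0// addr_ge0// mul0r.
pose r := Num.sqrt ((al + 1) / e).
have r2 : r ^+ 2 = (al + 1) / e by rewrite sqr_sqrtr// divr_ge0 ?addr_ge0// ltW.
have r0 : 0 < r by rewrite sqrtr_gt0 divr_gt0// ltr_wpDl.
exists r => //.
have : \forall N \near \oo, a N <= al + 1.
  by apply: (cvgr_le _ acvg); rewrite ltrDl.
apply: filterS => N aN.
have r20 : 0 < r ^+ 2 by rewrite exprn_gt0.
pose W j w : R := \sum_i dotmul (E j) (xi N (X N i w)).
have WY j w : Y N w ord0 j = W j w + shift N ord0 j.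
  by rewrite -(EE j (Y N w)) dotY EE addrC.
have iW j : P.-integrable setT (EFin \o (fun w => W j w ^+ 2)).
  have mW : measurable_fun setT (W j).
    by apply: measurable_sum => i; exact: measurableT_comp (mdot N (E j)) (mX i).
  apply: (@integrable_bounded _ _ _ _ _ ((N%:R * ((\sum_k `|E j ord0 k|) * B N)) ^+ 2)) => [|w].
    exact: measurable_funX.
  have Wle : `|W j w| <= N%:R * ((\sum_k `|E j ord0 k|) * B N).
    rewrite (le_trans (ler_norm_sum _ _ _))//.
    rewrite mulr_natl -[X in _ <= _ *+ X](card_ord N) -sumr_const.
    by apply: ler_sum => i _; exact: xi_dot.
  by rewrite normrX lerXn2r// nnegrE// (le_trans _ Wle).
pose H w := (r ^+ 2)^-1 * \sum_j 2 * (W j w ^+ 2 + shift N ord0 j ^+ 2).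
have iH : P.-integrable setT (EFin \o H).
  apply: integrable_scaler; apply: integrable_sumr => j _; apply: integrable_scaler.
  by apply: integrable_addr => //; exact: finite_measure_integrable_cst.
have mC : measurable (~` @cube R d r) by apply: measurableC; exact: measurable_cube.
have i1 : P.-integrable setT (EFin \o (fun w => \1_(~` @cube R d r) (Y N w) : R)).
  apply: (@integrable_bounded _ _ _ _ _ 1) => [|w].
    exact: (measurableT_comp (measurable_indic mC) (mY N)).
  by rewrite indicE; case: (_ \in _); rewrite ?normr1 ?normr0.
apply: (@le_trans _ _ (\int[P]_w H w)).
  apply: le_Rintegral => // w _; rewrite indicE; case: (boolP (_ \in _)) => [|_]; last first.
    rewrite /H mulr_ge0 ?invr_ge0 ?(ltW r20)//; apply: sumr_ge0 => j _.
    by rewrite mulr_ge0// addr_ge0// sqr_ge0.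
  rewrite inE => /existsNP[j /negP]; rewrite -ler_norml -ltNge => rY.
  rewrite /H ler_pdivlMl// mulr1 (bigD1 j)//= -[leLHS]addr0 lerD//; last first.
    by apply: sumr_ge0 => k _; rewrite mulr_ge0// addr_ge0// sqr_ge0.
  apply: (@le_trans _ _ (Y N w ord0 j ^+ 2)).
    by rewrite -[leRHS]real_normK ?num_real// lerXn2r ?nnegrE ?(ltW r0)// ltW.
  by rewrite WY; have := sqr_ge0 (W j w - shift N ord0 j); lra.
rewrite RintegralZl//; last first.
  apply: integrable_sumr => j _; apply: integrable_scaler.
  by apply: integrable_addr => //; exact: finite_measure_integrable_cst.
rewrite ler_pdivrMl// r2 divfK ?gt_eqF//; apply: le_trans aN.
rewrite Rintegral_sumr => [|j _]; last first.
  by apply: integrable_scaler; apply: integrable_addr => //; exact: finite_measure_integrable_cst.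
apply: ler_sum => j _; rewrite RintegralZl//; last first.
  by apply: integrable_addr => //; exact: finite_measure_integrable_cst.
rewrite ler_wpM2l// RintegralD//; last exact: finite_measure_integrable_cst.
have -> : \int[P]_w shift N ord0 j ^+ 2 = shift N ord0 j ^+ 2 by exact: Rintegral_prob_cst.
by rewrite lerD2r second_moment.
Qed.

(** Under [nu] the functional [dotmul u] is normal with variance [u S u'], so the
    limits found in [cos_clt] are the integrals of cosines against [nu]. *)
Theorem array_clt (nu : probability 'rV[R]_d R) : is_normal_rV 0 S nu ->
  cvg_in_distribution P Y nu.
Proof.
move=> nuS; apply: cvg_in_distribution_cos => //; last exact: tight_array.
move=> b u; have := @cos_clt b u; set v := (_ *m _) _ _ => H.
suff -> : \int[nu]_x cos (b + dotmul u x) = normal_cf v * cos b by [].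
rewrite -(integral_normal_cosD _ (S0 u)).
have mcb : measurable_fun setT (fun t : measurableTypeR R => cos (b + t)).
  apply: (measurableT_comp measurable_cos).
  by apply: (@measurable_funD _ _ _ _ (cst b) id).
apply: (@Rintegral_same_law R _ _ _ _ (measurableTypeR R) (measurableTypeR R) nu (normal_measure v)
  (dotmul u) id (measurable_dotmul u) (@measurable_id _ _ _) _ (fun t => cos (b + t)) 1 mcb).
  by move=> A mA; rewrite normal_measureE; have := nuS u A mA; rewrite linear0 mulmx0 mxE.
by move=> t; exact: cos_max.
Qed.

End clt.

(** * Taylor expansion and the bias *)

Section directional_derivatives.
Context {R : realType} {d : nat}.
Implicit Types (g : 'rV[R]_d -> R) (x v : 'rV[R]_d) (s : seq 'I_d).

(** The [k]-th derivative of [g] at [x], applied to [k] copies of [v]. *)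
Fixpoint dir_derive (k : nat) g x v : R :=
  if k is k'.+1 then \sum_j v ord0 j * dir_derive k' (partial j g) x v else g x.

Lemma derive_partials g x v : differentiable g x -> 'D_v g x = \sum_j v ord0 j * partial j g x.
Proof.
move=> dg; rewrite deriveE// {1}(row_sum_delta v) linear_sum; apply: eq_bigr => j _.
by rewrite linearZ/= /partial deriveE.
Qed.

Lemma times_differentiable_le k k' g : (k <= k')%N ->
  times_differentiable k' g -> times_differentiable k g.
Proof.
elim: k k' g => [//|k IH] [//|k'] g kk' [dg tg]; split=> // j.
exact: IH (tg j).
Qed.

Lemma is_derive_dir_derive k g x v (t : R) : times_differentiable k.+1 g ->
  is_derive t 1 (fun t : R => dir_derive k g (x + t *: v) v) (dir_derive k.+1 g (x + t *: v) v).
Proof.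
elim: k g => [|k IH] g [dg tg].
  rewrite /= -derive_partials//; apply: is_derive_line.
  exact/diff_derivable.
rewrite /= -/(dir_derive k.+1).
have -> : (fun t0 : R => \sum_j v ord0 j * dir_derive k (partial j g) (x + t0 *: v) v) =
    \sum_j (fun t0 : R => v ord0 j * dir_derive k (partial j g) (x + t0 *: v) v).
  by apply/funext => t0; rewrite fct_sumE.
apply: is_derive_sum => j.
exact: (is_deriveZ (v ord0 j) (IH _ (tg j))).
Qed.

(** The multi-indices of length [k], as lists so that sums over them unfold along
    with [dir_derive]. *)
Fixpoint words (k : nat) : seq (seq 'I_d) :=
  if k is k'.+1 then [seq j :: s | j <- enum 'I_d, s <- words k'] else [:: [::]].

Lemma words1 : words 1 = [seq [:: j] | j <- enum 'I_d].
Proof. by rewrite /= /allpairs_dep; elim: (enum _) => //= j s ->. Qed.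

Lemma size_words k s : s \in words k -> size s = k.
Proof.
elim: k s => [|k IH] s /=; first by rewrite inE => /eqP->.
by move=> /allpairsP[[j t] [_ /IH/= tk ->]]; rewrite /= tk.
Qed.

Lemma dir_deriveE k g x v : dir_derive k g x v =
  \sum_(s <- words k) (\prod_(j <- s) v ord0 j) * iter_partial (rev s) g x.
Proof.
elim: k g => [|k IH] g /=; first by rewrite big_seq1 big_nil mul1r.
rewrite big_allpairs_dep big_enum/=; apply: eq_bigr => j _.
rewrite IH mulr_sumr; apply: eq_bigr => s _.
by rewrite big_cons mulrA rev_cons /iter_partial foldr_rcons.
Qed.

(** Induction on [m] with the mean value theorem; the last derivative enters through
    its oscillation at [0] only. *)
Lemma taylor_bound (m : nat) (F : nat -> R -> R) (h B : R) :
  (forall k (t : R), (k < m)%N -> is_derive t 1 (F k) (F k.+1 t)) ->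
  (forall t : R, `|t| <= `|h| -> `|F m t - F m 0| <= B) ->
  `|F 0%N h - \sum_(k < m.+1) h ^+ k / k`!%:R * F k 0| <= B * `|h| ^+ m.
Proof.
elim: m F h => [|m IH] F h dF FB.
  by rewrite big_ord1 !expr0 fact0 divr1 mul1r mulr1 FB.
pose G k := F k.+1.
pose D t := F 0%N t - \sum_(k < m.+2) t ^+ k / k`!%:R * F k 0.
have dD (t : R) : is_derive t 1 D (F 1%N t - \sum_(k < m.+1) t ^+ k / k`!%:R * F k.+1 0).
  apply: is_deriveB; first exact: dF.
  have -> : (fun t : R => \sum_(k < m.+2) t ^+ k / k`!%:R * F k 0) =
      (fun t => F 0%N 0 + \sum_(k < m.+1) (F k.+1 0 / (k.+1)`!%:R) * t ^+ k.+1).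
    apply/funext => u; rewrite big_ord_recl expr0 fact0 divr1 mul1r; congr (_ + _).
    by apply: eq_bigr => k _; rewrite /= /bump/= add1n; ring.
  have dm k : is_derive t 1 (fun t : R => (F k.+1 0 / (k.+1)`!%:R) * t ^+ k.+1)
      (t ^+ k / k`!%:R * F k.+1 0).
    have dX := is_deriveZ (F k.+1 0 / (k.+1)`!%:R) (@is_deriveX _ _ id k.+1 t 1 1 (is_derive_id t 1)).
    apply: is_derive_eq.
      have -> : (fun t : R => (F k.+1 0 / (k.+1)`!%:R) * t ^+ k.+1) = (F k.+1 0 / (k.+1)`!%:R) \*: id ^+ k.+1.
        by apply/funext => u; rewrite /= exprfctE.
      exact: dX.
    rewrite factS natrM /GRing.scale/=.
    have : k.+1%:R != 0 :> R by rewrite pnatr_eq0.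
    have : k`!%:R != 0 :> R by rewrite pnatr_eq0 -lt0n fact_gt0.
    move: (k.+1%:R) (k`!%:R) => a b b0 a0.
    by field; rewrite a0 b0.
  have dsum := @is_derive_sum _ _ _ m.+1 (fun (k : 'I_m.+1) (t : R) => (F k.+1 0 / (k.+1)`!%:R) * t ^+ k.+1) t 1 _ (fun k => dm k).
  rewrite fct_sumE in dsum.
  rewrite -[X in is_derive _ _ _ X]add0r; exact: is_deriveD.
have D0 : D 0 = 0.
  rewrite /D big_ord_recl expr0 fact0 divr1 mul1r big1 ?addr0 ?subrr// => k _.
  by rewrite expr0n/= mul0r mul0r.
have := mvt_bound0 dD (B := B * `|h| ^+ m) (x := h).
rewrite D0 subr0 -mulrA -exprSr; apply => c ch.
apply: le_trans (_ : B * `|c| ^+ m <= _).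
  apply: (IH G) => [k t km|t tc]; first exact: dF.
  by apply: FB; exact: le_trans ch.
have B0 : 0 <= B by apply: le_trans (FB 0 _); rewrite ?subrr normr0.
by rewrite ler_wpM2l// lerXn2r ?nnegrE.
Qed.

End directional_derivatives.

Section kernel_moments.
Context {R : realType} {d : nat}.
Implicit Types (s t : seq 'I_d) (i j : 'I_d).
Local Notation V := 'rV[R]_d.

Definition monomial s (l : V) : R := \prod_(j <- s) l ord0 j.

(** The terms of the derivative of a monomial in direction [i]. *)
Fixpoint dmonomial i s : seq (seq 'I_d) :=
  if s is j :: s' then (if j == i then [:: s'] else [::]) ++ [seq j :: t | t <- dmonomial i s']
  else [::].

Lemma size_dmonomial i s t : t \in dmonomial i s -> (size t).+1 = size s.
Proof.
elim: s t => [|j s IH] t //=; rewrite mem_cat => /orP[|/mapP[u /IH us ->]]; last by rewrite /= us.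
by case: ifP => // _; rewrite inE => /eqP->.
Qed.

Lemma is_derive_monomial i s (x : V) : is_derive x (delta_mx ord0 i : V) (monomial s)
  (\sum_(t <- dmonomial i s) monomial t x).
Proof.
elim: s => [|j s IH].
  rewrite big_nil; have -> : monomial [::] = cst 1 by apply/funext => l; rewrite /monomial big_nil.
  exact: is_derive_cst.
have -> : monomial (j :: s) = (fun l : V => l ord0 j) * monomial s.
  by apply/funext => l; rewrite /monomial big_cons.
have dc : is_derive x (delta_mx ord0 i : V) (fun l : V => l ord0 j) ((j == i)%:R).
  have @f : {linear V -> R}.
    by exists (fun l : V => l ord0 j); do 2![eexists]; do ?[constructor];
       rewrite ?mxE// => ? *; rewrite ?mxE//; move=> ?; rewrite !mxE.
  have fE : (fun l : V => l ord0 j) = f by [].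
  have cf : continuous f by rewrite -fE; exact: coord_continuous.
  rewrite fE; apply: DeriveDef; first exact/diff_derivable/linear_differentiable.
  rewrite deriveE; last exact: linear_differentiable.
  by rewrite diff_lin// /f/= mxE eqxx.
have := is_deriveM dc IH; congr is_derive.
rewrite /= big_cat big_map /GRing.scale/= mulr_sumr addrC; congr (_ + _).
  by apply: eq_bigr => t _; rewrite /monomial big_cons.
by case: ifP => _; rewrite ?big_seq1 ?big_nil ?mulr0 ?mulr1.
Qed.

Lemma differentiable_monomial s (x : V) : differentiable (monomial s) x.
Proof.
elim: s => [|j s IH].
  have -> : monomial [::] = cst 1 by apply/funext => l; rewrite /monomial big_nil.
  exact: differentiable_cst.
have -> : monomial (j :: s) = (fun l : V => l ord0 j) * monomial s.
  by apply/funext => l; rewrite /monomial big_cons.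
by apply: differentiableM => //; exact: differentiable_coord.
Qed.

Lemma continuous_mul (g h : V -> R) : continuous g -> continuous h -> continuous (fun x => g x * h x).
Proof. by move=> cg ch x; exact: (continuousM (cg x) (ch x)). Qed.

Lemma continuous_add (g h : V -> R) : continuous g -> continuous h -> continuous (fun x => g x + h x).
Proof. by move=> cg ch x; exact: (continuousD (cg x) (ch x)). Qed.

Lemma continuous_sum (I : Type) (r : seq I) (g : I -> V -> R) : (forall k : I, continuous (g k)) ->
  continuous (fun x => \sum_(k <- r) g k x).
Proof.
move=> cg; elim: r => [|i r IH].
  by under eq_fun do rewrite big_nil; exact: cst_continuous.
by under eq_fun do rewrite big_cons; exact: continuous_add.
Qed.

Lemma continuous_monomial s : continuous (monomial s : V -> R).
Proof. by move=> x; apply: differentiable_continuous; exact: differentiable_monomial. Qed.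

Variable K : V -> R.
Hypothesis C1K : C1 K.
Hypothesis K0 : forall x, ~ cube 1 x -> K x = 0.

Lemma integrable_kernel s : (lebesgue_rV d).-integrable setT (EFin \o (fun l => monomial s l * K l)).
Proof.
apply: (@integrable_on_cube _ _ _ 1); last by move=> x /K0 ->; rewrite mulr0.
apply: continuous_mul; first exact: continuous_monomial.
by move=> x; apply: differentiable_continuous; have [dK _] := C1K; exact: dK.
Qed.

Lemma integrable_partial_kernel i s :
  (lebesgue_rV d).-integrable setT (EFin \o (fun l => partial i K l * monomial s l)).
Proof.
apply: (@integrable_on_cube _ _ _ 1); last by move=> x /(partial_eq0 i K0) ->; rewrite mul0r.
apply: continuous_mul; last exact: continuous_monomial.
by have [_ cK] := C1K; exact: cK.
Qed.

(** Integration by parts: [K] times a monomial is compactly supported. *)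
Lemma moment_partial i s :
  \int[lebesgue_rV d]_l (partial i K l * monomial s l) = - \sum_(t <- dmonomial i s) moment K t.
Proof.
have [dK cK] := C1K.
pose G : V -> R := K * monomial s.
have dG x : differentiable G x by apply: differentiableM => //; exact: differentiable_monomial.
have pG j : partial j G = fun l => partial j K l * monomial s l +
    \sum_(t <- dmonomial j s) monomial t l * K l.
  apply/funext => x; rewrite /partial.
  have dKx : derivable K x (delta_mx ord0 j) by exact: diff_derivable.
  have [dm dmE] := is_derive_monomial j s x.
  rewrite deriveM// dmE addrC /GRing.scale/= mulr_sumr; congr (_ + _); first by rewrite mulrC.
  by apply: eq_bigr => t _; rewrite mulrC.
have C1G : C1 G.
  split=> // j; rewrite pG.
  apply: continuous_add; first by apply: continuous_mul; [exact: cK|exact: continuous_monomial].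
  apply: continuous_sum => t; apply: continuous_mul; first exact: continuous_monomial.
  by move=> x; exact: differentiable_continuous.
have := integral_partial_eq0 i ler01 C1G.
have G0 x : ~ cube 1 x -> G x = 0 by move=> /K0 H; transitivity (K x * monomial s x); rewrite // H mul0r.
move=> /(_ G0); rewrite pG RintegralD//; last 2 first.
- exact: integrable_partial_kernel.
- by apply: integrable_sumr => t _; exact: integrable_kernel.
rewrite Rintegral_sumr => [|t _]; last exact: integrable_kernel.
by move/eqP; rewrite addr_eq0 => /eqP.
Qed.

Variable p : nat.
Hypothesis intK : \int[lebesgue_rV d]_l K l = 1.
Hypothesis orderK : forall s, (0 < size s < p)%N -> moment K s = 0.

(** Integration by parts lowers the degree by one, into the range where the moments
    of [K] vanish, except for degree [1] where it meets [\int K = 1]. *)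
Lemma moment_partial_words i k : (k <= p)%N -> k != 1%N -> forall s, s \in words k ->
  \int[lebesgue_rV d]_l (partial i K l * monomial s l) = 0.
Proof.
move=> kp k1 s /size_words sk; rewrite moment_partial big_seq big1 ?oppr0// => t /size_dmonomial st.
by apply: orderK; move: st k1 kp; rewrite sk => <-; case: (size t).
Qed.

Lemma moment_partial1 i j : \int[lebesgue_rV d]_l (partial i K l * l ord0 j) = - (j == i)%:R.
Proof.
transitivity (\int[lebesgue_rV d]_l (partial i K l * monomial [:: j] l)).
  by apply: eq_Rintegral => l _; rewrite /monomial big_seq1.
rewrite moment_partial /= cats0; case: eqP => _; rewrite ?big_seq1 ?big_nil//.
congr (- _); rewrite -intK; apply: eq_Rintegral => l _; by rewrite big_nil mul1r.
Qed.

End kernel_moments.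

Section measurable_derivatives.
Context {R : realType} {d n : nat}.
Implicit Types (G : 'rV[R]_d -> 'rV[R]_n -> R).

(** A partial derivative is a limit of a sequence of difference quotients. *)
Lemma measurable_partial G (j : 'I_d) l : (forall z x, differentiable (G ^~ z) x) ->
  (forall l, measurable_fun setT (G l)) -> measurable_fun setT (fun z => partial j (G ^~ z) l).
Proof.
move=> dG mG.
pose q (k : nat) z := k.+1%:R * (G (l + k.+1%:R^-1 *: delta_mx ord0 j) z - G l z).
apply: (@measurable_fun_cvg _ _ R setT q) => [k|z _].
  by apply: (@measurable_funM _ _ _ _ (cst k.+1%:R)) => //; apply: measurable_funB.
by apply: cvg_diff_quotient; exact/diff_derivable.
Qed.

Lemma measurable_iter_partial k G (s : seq 'I_d) l : (forall z, times_differentiable k (G ^~ z)) ->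
  (forall l, measurable_fun setT (G l)) -> (size s <= k)%N ->
  measurable_fun setT (fun z => iter_partial (rev s) (G ^~ z) l).
Proof.
elim: s k G => [|j s IH] k G tG mG; first by move=> _; exact: mG.
case: k tG => // k tG sk; rewrite rev_cons; under eq_fun do rewrite /iter_partial foldr_rcons.
apply: (IH k (fun l z => partial j (G ^~ z) l)) => //.
- by move=> z; have [_] := tG z; exact.
- by move=> l'; apply: measurable_partial => // z x; have [dG _] := tG z; exact: dG.
Qed.

End measurable_derivatives.

Section bias.
Context {R : realType} {d n p : nat}.
Variables (f : 'rV[R]_d -> 'rV[R]_n -> R) (psi : 'rV[R]_n -> R) (l0 : 'rV[R]_d).
Variables (K : 'rV[R]_d -> R) (i : 'I_d) (g : 'rV[R]_n -> R) (r0 : R).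
Hypotheses (C1K : C1 K) (K0 : forall x, ~ cube 1 x -> K x = 0).
Hypothesis intK : \int[lebesgue_rV d]_l K l = 1.
Hypothesis orderK : forall s : seq 'I_d, (0 < size s < p)%N -> moment K s = 0.
Hypothesis p0 : (0 < p)%N.
Hypothesis smooth : forall z, times_differentiable p.+1 (f ^~ z).
Hypothesis mf : forall l, measurable_fun setT (f l).
Hypothesis mpsi : measurable_fun setT psi.
Hypothesis gi : (lebesgue_rV n).-integrable setT (EFin \o g).
Hypothesis g0 : forall z, 0 <= g z.
Hypothesis dom : forall z (js : seq 'I_d) (l : 'rV[R]_d), size js = p.+1 -> (forall j, `|l ord0 j - l0 ord0 j| <= r0) ->
  `|psi z| * `|iter_partial js (f ^~ z) l - iter_partial js (f ^~ z) l0| <= g z.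

Local Notation mu := (lebesgue_rV d).
Local Notation nu := (lebesgue_rV n).

(** By an integration by parts, this is [h] times the derivative in direction [i] of
    the average of [f (.) z] around [l0] with weight [K] at scale [h]. *)
Definition smoothed h z : R := \int[mu]_l (partial i K l * f (l0 - h *: l) z).

Let m s : R := \int[mu]_l (partial i K l * monomial s l).
Let D s z := iter_partial (rev s) (f ^~ z) l0.
Let coef k z : R := \sum_(s <- words k) (- 1) ^+ k * m s * D s z.

Lemma dir_derive_opp k (h : 'rV[R]_d -> R) l : dir_derive k h l0 (- l) =
  \sum_(s <- words k) (- 1) ^+ k * iter_partial (rev s) h l0 * monomial s l.
Proof.
rewrite dir_deriveE big_seq [RHS]big_seq; apply: eq_bigr => s /size_words sk.
suff -> : \prod_(j <- s) (- l) ord0 j = (- 1) ^+ k * monomial s l by ring.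
rewrite -sk /monomial; elim: s {sk} => [|j s IH]; first by rewrite !big_nil mulr1.
by rewrite !big_cons IH !mxE /= exprS; ring.
Qed.

Lemma coef_integral k z :
  mu.-integrable setT (EFin \o (fun l => partial i K l * dir_derive k (f ^~ z) l0 (- l))) /\
  \int[mu]_l (partial i K l * dir_derive k (f ^~ z) l0 (- l)) = coef k z.
Proof.
have E l : partial i K l * dir_derive k (f ^~ z) l0 (- l) =
    \sum_(s <- words k) (- 1) ^+ k * D s z * (partial i K l * monomial s l).
  by rewrite dir_derive_opp mulr_sumr; apply: eq_bigr => s _; rewrite /D; ring.
have I s : mu.-integrable setT (EFin \o (fun l => (- 1) ^+ k * D s z * (partial i K l * monomial s l))).
  by apply: integrable_scaler; exact: integrable_partial_kernel.
have -> : (fun l => partial i K l * dir_derive k (f ^~ z) l0 (- l)) =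
   (fun l => \sum_(s <- words k) (- 1) ^+ k * D s z * (partial i K l * monomial s l)).
  by apply/funext.
split; first exact: integrable_sumr.
rewrite Rintegral_sumr//; apply: eq_bigr => s _.
rewrite RintegralZl//; last exact: integrable_partial_kernel.
by rewrite -/(m s); ring.
Qed.

Lemma coef_small k z : (k <= p)%N -> coef k z = if k == 1%N then partial i (f ^~ z) l0 else 0.
Proof.
move=> kp; case: (eqVneq k 1%N) => [->|k1]; last first.
  rewrite /coef big_seq big1// => s sk.
  by rewrite /m (moment_partial_words C1K K0 orderK i kp k1 sk) mulr0 mul0r.
rewrite /coef words1 big_map big_enum/= (bigD1 i)//=.
have m1 j : m [:: j] = - (j == i)%:R.
  by rewrite -(moment_partial1 C1K K0 intK); apply: eq_Rintegral => l _; rewrite /monomial big_seq1.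
rewrite m1 eqxx big1 ?addr0 => [|j ji]; first by rewrite /D/=; ring.
by rewrite m1 (negbTE ji) oppr0 mulr0 mul0r.
Qed.

Let a z := coef p.+1 z / (p.+1)`!%:R.
Let rho h z := smoothed h z - (h * partial i (f ^~ z) l0 + h ^+ p.+1 * a z).

Let remainder h z l := f (l0 - h *: l) z - \sum_(k < p.+2) h ^+ k / k`!%:R * dir_derive k (f ^~ z) l0 (- l).

Lemma integrable_smoothed h z :
  mu.-integrable setT (EFin \o (fun l => partial i K l * f (l0 - h *: l) z)).
Proof.
apply: (@integrable_on_cube _ _ _ 1); last by move=> x /(partial_eq0 i K0) ->; rewrite mul0r.
apply: continuous_mul; first by have [_ cK] := C1K; exact: cK.
have cf : continuous (f ^~ z) by move=> x; apply: differentiable_continuous; have [df _] := smooth z; exact: df.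
move=> x; apply: (@continuous_comp _ _ _ (fun l : 'rV[R]_d => l0 - h *: l) (f ^~ z)); last exact: cf.
apply: (@continuousB _ _ _ (cst l0) (fun l => h *: l)); first exact: cst_continuous.
exact: scaler_continuous.
Qed.

Lemma rho_remainder h z :
  mu.-integrable setT (EFin \o (fun l => partial i K l * remainder h z l)) /\
  rho h z = \int[mu]_l (partial i K l * remainder h z l).
Proof.
have E l : partial i K l * remainder h z l = partial i K l * f (l0 - h *: l) z -
    \sum_(k < p.+2) h ^+ k / k`!%:R * (partial i K l * dir_derive k (f ^~ z) l0 (- l)).
  by rewrite /remainder mulrBr mulr_sumr; congr (_ - _); apply: eq_bigr => k _; ring.
have I (k : 'I_p.+2) : mu.-integrable setT (EFin \o (fun l => h ^+ k / k`!%:R * (partial i K l * dir_derive k (f ^~ z) l0 (- l)))).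
  by apply: integrable_scaler; have [] := coef_integral k z.
have Is : mu.-integrable setT (EFin \o (fun l => \sum_(k < p.+2) h ^+ k / k`!%:R * (partial i K l * dir_derive k (f ^~ z) l0 (- l)))).
  exact: integrable_sumr.
have If := integrable_smoothed h z.
have -> : (fun l => partial i K l * remainder h z l) = fun l => partial i K l * f (l0 - h *: l) z -
    \sum_(k < p.+2) h ^+ k / k`!%:R * (partial i K l * dir_derive k (f ^~ z) l0 (- l)) by apply/funext.
split; first exact: integrable_subr.
rewrite RintegralB// /rho; congr (_ - _); rewrite Rintegral_sumr//.
under eq_bigr => k _.
  rewrite RintegralZl//; last by have [] := coef_integral k z.
  rewrite (coef_integral k z).2; over.
rewrite big_ord_recr /=; congr (_ + _); last by rewrite /a; ring.
have p1 : (1 < p.+1)%N by rewrite ltnS.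
rewrite (bigD1 (Ordinal p1))//= coef_small// eqxx divr1 expr1 big1 ?addr0// => k k1.
rewrite coef_small; last by rewrite -ltnS.
by rewrite ifN ?mulr0//; apply: contra k1 => /eqP k1; apply/eqP/val_inj.
Qed.

(** Taylor's formula along the segment from [l0] to [l0 - h l]. The modulus [g]
    bounds the oscillation of the derivatives multiplied by [psi z], which suffices
    since the bound is trivial where [psi z = 0]. *)
Lemma remainder_bound : exists2 C, 0 <= C & forall h z, `|h| <= r0 ->
  `|psi z * rho h z| <= C * `|h| ^+ p.+1 * g z.
Proof.
have [M M0 KM] : exists2 M, 0 <= M & forall x, `|partial i K x| <= M * \1_(cube 1) x.
  apply: bounded_on_cube; first by have [_ cK] := C1K; exact: cK.
  by move=> x /(partial_eq0 i K0).
pose c : R := \int[mu]_l (M * \1_(cube 1) l); pose w : R := (size (@words d p.+1))%:R.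
have c0 : 0 <= c by apply: Rintegral_ge0 => l _; rewrite mulr_ge0.
exists (c * w) => [|h z hr]; first by rewrite mulr_ge0.
have [->|psi0] := eqVneq (psi z) 0.
  by rewrite mul0r normr0 !mulr_ge0// exprn_ge0.
have psi_gt0 : 0 < `|psi z| by rewrite normr_gt0.
pose B := w * (g z / `|psi z|).
have [Ir ->] := rho_remainder h z.
have rem l : cube 1 l -> `|remainder h z l| <= B * `|h| ^+ p.+1.
  move=> l1; pose F k t := dir_derive k (f ^~ z) (l0 + t *: (- l)) (- l).
  have := @taylor_bound R p.+1 F h B.
  have -> : F 0%N h = f (l0 - h *: l) z by rewrite /F/= scalerN.
  have -> : \sum_(k < p.+2) h ^+ k / k`!%:R * F k 0 =
      \sum_(k < p.+2) h ^+ k / k`!%:R * dir_derive k (f ^~ z) l0 (- l).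
    by apply: eq_bigr => k _; rewrite /F scale0r addr0.
  apply => [k t kp|t th].
    by apply: is_derive_dir_derive; exact: times_differentiable_le (smooth z).
  rewrite /F scale0r addr0 !dir_deriveE -sumrB (le_trans (ler_norm_sum _ _ _))//.
  rewrite /B /w -sum1_size natr_sum mulr_suml big_seq [leRHS]big_seq; apply: ler_sum => s sw.
  rewrite mul1r -mulrBr normrM -[leRHS]mul1r ler_pM//.
    rewrite normr_prod; apply: prodr_ile1 => j _; rewrite normr_ge0/= mxE normrN ler_norml.
    exact: l1.
  rewrite ler_pdivlMr// mulrC; apply: dom; first by rewrite size_rev (size_words sw).
  move=> j; rewrite !mxE addrAC subrr add0r normrM normrN.
  have lj : `|l ord0 j| <= 1 by rewrite ler_norml; exact: l1.
  apply: le_trans (_ : `|t| * 1 <= _); first by rewrite ler_wpM2l.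
  by rewrite mulr1 (le_trans th).
have B0 : 0 <= B by rewrite mulr_ge0// divr_ge0.
rewrite normrM (_ : c * w * _ * _ = `|psi z| * (B * `|h| ^+ p.+1 * c)); last first.
  by rewrite /B; field; rewrite gt_eqF.
rewrite ler_wpM2l// /c -RintegralZl//; last exact: integrable_cube.
apply: le_normr_Rintegral_le => //; first by apply: integrable_scaler; exact: integrable_cube.
move=> l; rewrite normrM; have [l1|l1] := pselect (cube 1 l); last first.
  by rewrite (partial_eq0 i K0 l1) normr0 mul0r !mulr_ge0// exprn_ge0.
by rewrite mulrC ler_pM// rem.
Qed.

Hypothesis gradi : nu.-integrable setT (EFin \o (fun z => psi z * partial i (f ^~ z) l0)).

(** The moment conditions on [K] kill every Taylor term of [f] between the
    first order, which gives the derivative, and order [p + 1]. *)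
Lemma bias_bound h1 : 0 < h1 <= r0 ->
  nu.-integrable setT (EFin \o (fun z => psi z * smoothed h1 z)) ->
  exists C, forall h, 0 < h <= r0 ->
    nu.-integrable setT (EFin \o (fun z => psi z * smoothed h z)) ->
    `|h^-1 * \int[nu]_z (psi z * smoothed h z) - \int[nu]_z (psi z * partial i (f ^~ z) l0)| <= C * h ^+ p.
Proof.
have [C C0 rhoC] := remainder_bound.
have ma : measurable_fun setT a.
  apply: (@measurable_funM _ _ _ _ _ (cst _)) => //; rewrite /coef.
  rewrite (_ : (fun z => _) = fun z => \sum_(s <- words p.+1) (if (size s <= p.+1)%N then (- 1) ^+ p.+1 * m s * D s z else 0)).
    apply: measurable_sum => s; case: (boolP (size s <= p.+1)%N) => sp; last exact: measurable_cst.
    apply: (@measurable_funM _ _ _ _ (cst _)) => //.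
    exact: measurable_iter_partial smooth mf sp.
  by apply/funext => z; rewrite big_seq [RHS]big_seq; apply: eq_bigr => s /size_words ->; rewrite leqnn.
have rhoI h : 0 < h <= r0 -> nu.-integrable setT (EFin \o (fun z => psi z * smoothed h z)) ->
    nu.-integrable setT (EFin \o (fun z => psi z * rho h z)).
  move=> /andP[h0 hr] Ih.
  have mpa : measurable_fun setT (fun z => psi z * a z) by exact: measurable_funM.
  have mrho : measurable_fun setT (fun z => psi z * rho h z).
    rewrite (_ : (fun z => _) = fun z => psi z * smoothed h z - (h * (psi z * partial i (f ^~ z) l0) + h ^+ p.+1 * (psi z * a z))); last first.
      by apply/funext => z; rewrite /rho; ring.
    apply: measurable_funB; first by apply/measurable_EFinP; exact: measurable_int Ih.
    apply: measurable_funD; first by apply: (@measurable_funM _ _ _ _ (cst h)) => //; apply/measurable_EFinP; exact: measurable_int gradi.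
    by apply: (@measurable_funM _ _ _ _ (cst _)).
  apply: (le_integrable measurableT _ _ (integrable_scaler (C * `|h| ^+ p.+1) gi)).
    exact/measurable_EFinP.
  move=> z _ /=; rewrite lee_fin [leRHS]ger0_norm ?mulr_ge0 ?exprn_ge0//.
  by apply: rhoC; rewrite gtr0_norm.
move=> h1r I1.
(* The coefficient of order [p + 1] is integrable as a combination, at the single
   bandwidth [h1], of three functions known to be so. *)
have ai : nu.-integrable setT (EFin \o (fun z => psi z * a z)).
  have /andP[h10 _] := h1r.
  have := integrable_scaler (h1 ^- p.+1) (integrable_subr (integrable_subr I1 (integrable_scaler h1 gradi)) (rhoI _ h1r I1)).
  apply: eq_integrable => // z _ /=; congr EFin; rewrite /rho.
  by field; rewrite -/(h1 ^+ p.+1) expf_neq0// gt_eqF.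
exists (`|\int[nu]_z (psi z * a z)| + C * \int[nu]_z g z) => h hr Ih.
have /andP[h0 hr0] := hr.
have -> : \int[nu]_z (psi z * smoothed h z) = h * \int[nu]_z (psi z * partial i (f ^~ z) l0) +
    h ^+ p.+1 * \int[nu]_z (psi z * a z) + \int[nu]_z (psi z * rho h z).
  rewrite -RintegralZl// -[h ^+ p.+1 * _]RintegralZl// -RintegralD//; last 2 first.
  - exact: integrable_scaler.
  - exact: integrable_scaler.
  rewrite -RintegralD//; last 2 first.
  - by apply: integrable_addr; exact: integrable_scaler.
  - exact: rhoI.
  by apply: eq_Rintegral => z _; rewrite /rho; ring.
have bR : `|\int[nu]_z (psi z * rho h z)| <= C * h ^+ p.+1 * \int[nu]_z g z.
  rewrite -RintegralZl//; apply: le_normr_Rintegral_le; [exact: rhoI|exact: integrable_scaler|].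
  by move=> z; rewrite -{2}(gtr0_norm h0); apply: rhoC; rewrite gtr0_norm.
move: bR; set A := \int[nu]_z (_ * a _); set E := \int[nu]_z (_ * rho _ _); set b := \int[nu]_z (_ * partial _ _ _).
set G := \int[nu]_z g z => bR.
have -> : h^-1 * (h * b + h ^+ p.+1 * A + E) - b = h ^+ p * A + h^-1 * E.
  by rewrite exprS; field; rewrite gt_eqF.
rewrite (le_trans (ler_normD _ _))// mulrDl; apply: lerD.
  by rewrite normrM (ger0_norm (exprn_ge0 _ (ltW h0))) mulrC.
have hV : 0 <= h^-1 by rewrite invr_ge0 ltW.
rewrite normrM (ger0_norm hV) ler_pdivrMl// (le_trans bR)//.
by rewrite le_eqVlt; apply/orP; left; apply/eqP; rewrite exprS; ring.
Qed.

End bias.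

(** * Null sets, Fubini and kernel smoothing *)

Section almost_everywhere.
Context {R : realType} {dT : measure_display} {T : measurableType dT}.

Lemma Rintegral_ae_eq (mu : {measure set T -> \bar R}) (f g : T -> R) :
  measurable_fun setT f -> measurable_fun setT g -> {ae mu, forall x, f x = g x} ->
  \int[mu]_x f x = \int[mu]_x g x.
Proof.
move=> mf mg fg; rewrite /Rintegral; congr fine; apply: ae_eq_integral => //.
- exact/measurable_EFinP.
- exact/measurable_EFinP.
- by apply: filterS fg => x /= ->.
Qed.

Lemma Lfun_oo_bounded (mu : {measure set T -> \bar R}) (f : T -> R) :
  f \in Lfun mu +oo%E ->
  measurable_fun setT f /\ exists2 C, 0 <= C & {ae mu, forall x, `|f x| <= C}.
Proof.
move=> fL; split; first exact: set_mem (sub_Lfun_mfun fL).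
have := set_mem (sub_Lfun_finLfun fL); rewrite /finite_norm unlock /Lnorm/=.
case: ifPn => [mu0 fin|]; last first.
  rewrite lt0e measure_ge0 andbT negbK => /eqP mu0 _.
  by exists 0 => //; exists setT; split.
have [C C0 fC] : exists2 C : R, 0 <= C & (ess_sup mu (abse \o (EFin \o f)) <= C%:E)%E.
  move: fin; case: (ess_sup _ _) => [r _|//|_]; last by exists 0; rewrite ?leNye.
  by exists `|r| => //; rewrite lee_fin ler_norm.
exists C => //; have /ess_supP := fC; apply: filterS => x /=.
by rewrite lee_fin.
Qed.

(** If one of the two parts of [f] had an infinite integral, the difference would
    not be finite. *)
Lemma integrable_of_integral (mu : {measure set T -> \bar R}) (f : T -> R) (r : R) :
  measurable_fun setT f -> (\int[mu]_x (f x)%:E = r%:E)%E -> mu.-integrable setT (EFin \o f).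
Proof.
move=> mf; rewrite integralE => fr.
have mE : measurable_fun setT (EFin \o f) by exact/measurable_EFinP.
have p0 : (0 <= \int[mu]_x (EFin \o f)^\+ x)%E by apply: integral_ge0.
have n0 : (0 <= \int[mu]_x (EFin \o f)^\- x)%E by apply: integral_ge0.
apply/integrableP; split => //.
have -> : (\int[mu]_x `|(EFin \o f) x| = \int[mu]_x (EFin \o f)^\+ x + \int[mu]_x (EFin \o f)^\- x)%E.
  rewrite -ge0_integralD//; last 2 first.
  - exact: measurable_funepos.
  - exact: measurable_funeneg.
  by apply: eq_integral => x _; exact: (congr1 (@^~ x) (fune_abse (EFin \o f))).
move: fr p0 n0; case: (\int[mu]_x _)%E => [a| |]; case: (\int[mu]_x _)%E => [b| |]//=.
by rewrite -EFinD ltry.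
Qed.

End almost_everywhere.

Section real_fubini.
Context {R : realType} {d1 d2 : measure_display} {T1 : measurableType d1} {T2 : measurableType d2}.
Variables (m1 : {sigma_finite_measure set T1 -> \bar R}) (m2 : {sigma_finite_measure set T2 -> \bar R}).
Variable F : T1 * T2 -> R.
Hypothesis Fi : (m1 \x m2)%E.-integrable setT (EFin \o F).

Lemma Rintegral_fubini12 : (forall x, m2.-integrable setT (EFin \o (fun y => F (x, y)))) ->
  m1.-integrable setT (EFin \o (fun x => \int[m2]_y F (x, y))) /\
  \int[(m1 \x m2)%E]_p F p = \int[m1]_x \int[m2]_y F (x, y).
Proof.
move=> Fx; have E : fubini_F m2 (EFin \o F) = EFin \o (fun x => \int[m2]_y F (x, y)).
  by apply/funext => x; rewrite /= EFin_Rintegral//; exact: Fx.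
have H : m1.-integrable setT (EFin \o (fun x => \int[m2]_y F (x, y))).
  by rewrite -E; exact: integrable_fubini_F.
split=> //; rewrite [LHS]/Rintegral -integral12_prod_meas1// E//.
Qed.

Lemma Rintegral_fubini21 : (forall y, m1.-integrable setT (EFin \o (fun x => F (x, y)))) ->
  m2.-integrable setT (EFin \o (fun y => \int[m1]_x F (x, y))) /\
  \int[(m1 \x m2)%E]_p F p = \int[m2]_y \int[m1]_x F (x, y).
Proof.
move=> Fy; have E : fubini_G m1 (EFin \o F) = EFin \o (fun y => \int[m1]_x F (x, y)).
  by apply/funext => y; rewrite /= EFin_Rintegral//; exact: Fy.
have H : m2.-integrable setT (EFin \o (fun y => \int[m1]_x F (x, y))).
  have mF : measurable_fun setT (EFin \o F) by exact: measurable_int Fi.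
  have mG : measurable_fun setT (fubini_G m1 (EFin \o F)).
    rewrite (_ : fubini_G m1 (EFin \o F) = (fun y => fubini_G m1 ((EFin \o F)^\+) y - fubini_G m1 ((EFin \o F)^\-) y)%E).
      apply: emeasurable_funB; apply: measurable_fun_fubini_tonelli_G => //.
      - exact: measurable_funepos.
      - exact: measurable_funeneg.
    by apply/funext => y; rewrite /fubini_G [LHS]integralE; congr (_ - _)%E;
      apply: eq_integral => x _; rewrite ?funeposE ?funenegE.
  rewrite -E; apply/integrableP; split=> //.
  apply: le_lt_trans ((integrable21ltyP m1 m2 mF).1 Fi).
  apply: ge0_le_integral => //.
  - exact: measurableT_comp.
  - apply: (@measurable_fun_fubini_tonelli_G _ _ _ _ _ m1 (abse \o (EFin \o F))).
      exact: measurableT_comp.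
    by move=> x; rewrite /= lee_fin normr_ge0.
  - move=> y _; rewrite /fubini_G; apply: le_abse_integral => //.
    exact: measurable_int (Fy y).
split=> //; rewrite [LHS]/Rintegral -integral21_prod_meas1// E//.
Qed.

End real_fubini.

Section density_null.
Context {R : realType} {dO : measure_display} {O : measurableType dO} (P : probability O R).
Context {dT : measure_display} {T : measurableType dT} (nu : {measure set T -> \bar R}).

Lemma density_null (X : {RV P >-> T}) (g : T -> R) (A : set T) : has_density nu X g ->
  measurable A -> nu A = 0%E -> P (X @^-1` A) = 0%E.
Proof.
move=> [mg g0 gE] mA A0; have := gE A mA; rewrite /distribution/= /pushforward => ->.
apply: null_set_integral => //; apply/measurable_EFinP.
exact: measurable_funTS.
Qed.

(** A law with a density charges no null set. *)
Lemma density_ae (X : {RV P >-> T}) (g : T -> R) (Q : T -> Prop) : has_density nu X g ->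
  {ae nu, forall x, Q x} -> {ae P, forall w, Q (X w)}.
Proof.
move=> Xg [A [mA A0 AQ]]; exists (X @^-1` A); split.
- by rewrite -[_ @^-1` _]setTI; exact: measurable_funP.
- exact: density_null Xg mA A0.
- by move=> w /= nQ; apply: AQ.
Qed.

End density_null.

Section kernel_limit.
Context {R : realType} {d n : nat}.
Variables (f : 'rV[R]_d -> 'rV[R]_n -> R) (l0 : 'rV[R]_d) (h : nat -> R).
Local Notation mu := (@lebesgue_rV R d \x @lebesgue_rV R n)%E.
Hypothesis mf : forall l, measurable_fun setT (f l).
Hypothesis f0 : forall l z, 0 <= f l z.
Hypothesis fi : forall l, (lebesgue_rV n).-integrable setT (EFin \o f l).
Hypothesis f1 : forall l, \int[lebesgue_rV n]_z f l z = 1.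
Hypothesis cf : forall z, continuous (f ^~ z).
Hypothesis h0 : h N @[N --> \oo] --> 0.
Hypothesis ri : forall N, mu.-integrable setT (EFin \o (rescaled_density f l0 (h N))).

(** For fixed [l] the density at [l0 - h l] tends to the density at [l0] in L^1, by
    Scheffe; the integrals over [z] are bounded, so that [k] dominates. *)
Lemma kernel_limit (k : 'rV[R]_d -> R) (w : 'rV[R]_n -> R) (W : R) : continuous k ->
  (forall x, ~ cube 1 x -> k x = 0) -> measurable_fun setT w -> (forall z, `|w z| <= W) ->
  \int[mu]_lz (k lz.1 * w lz.2 * rescaled_density f l0 (h N) lz) @[N --> \oo] -->
  \int[lebesgue_rV d]_l k l * \int[lebesgue_rV n]_z (w z * f l0 z).
Proof.
move=> ck k0 mw wW.
have ik := integrable_on_cube ck k0.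
have mk := continuous_measurable_rV ck.
have [M M0 kM] := bounded_on_cube ck k0.
have iwf l : (lebesgue_rV n).-integrable setT (EFin \o (fun z => w z * f l z)).
  exact: integrable_bounded_mul mw wW (fi l).
have Fi N : mu.-integrable setT (EFin \o (fun lz => k lz.1 * w lz.2 * rescaled_density f l0 (h N) lz)).
  apply: (integrable_bounded_mul (M := M * W)) => //.
    by apply: measurable_funM; apply: measurableT_comp.
  move=> lz; rewrite normrM ler_pM// (le_trans (kM _))// indicE.
  by case: (lz.1 \in cube 1); rewrite ?mulr1// mulr0.
pose q N l := k l * \int[lebesgue_rV n]_z (w z * f (l0 - h N *: l) z).
have E N l z : k l * w z * rescaled_density f l0 (h N) (l, z) = k l * (w z * f (l0 - h N *: l) z).
  rewrite /rescaled_density/= -mulrA; have [l1|l1] := pselect (cube 1 l).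
    by rewrite indicE mem_set// mul1r.
  by rewrite k0// !mul0r.
have Fx N l : (lebesgue_rV n).-integrable setT (EFin \o (fun z => k l * w z * rescaled_density f l0 (h N) (l, z))).
  under eq_fun do rewrite E; exact: integrable_scaler.
have qE N l : \int[lebesgue_rV n]_z (k l * w z * rescaled_density f l0 (h N) (l, z)) = q N l.
  under eq_Rintegral do rewrite E; by rewrite RintegralZl.
have fub N : (lebesgue_rV d).-integrable setT (EFin \o q N) /\
    \int[mu]_lz (k lz.1 * w lz.2 * rescaled_density f l0 (h N) lz) = \int[lebesgue_rV d]_l q N l.
  have [i1 i2] := Rintegral_fubini12 (Fi N) (Fx N).
  rewrite i2; split; last by apply: eq_Rintegral => l _; exact: qE.
  by apply: eq_integrable i1 => // l _ /=; rewrite qE.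
rewrite (_ : (fun N => _) = fun N => \int[lebesgue_rV d]_l q N l); last first.
  by apply/funext => N; have [_] := fub N.
rewrite mulrC -RintegralZl//.
apply: (@Rintegral_dominated_cvg _ _ _ _ q _ (fun l => W * `|k l|)).
- by move=> N; apply/measurable_EFinP; have [i1 _] := fub N; exact: measurable_int i1.
- by apply: (@measurable_funM _ _ _ _ (cst _)).
- move=> l; rewrite mulrC; apply: cvgM; first exact: cvg_cst.
  apply: (@scheffe _ _ _ (lebesgue_rV n) (fun N => f (l0 - h N *: l)) (f l0) w W) => // [N|z].
    by rewrite !f1.
  apply: (cvg_comp (fun N => l0 - h N *: l) (f ^~ z)); last exact: cf.
  have : l0 - h N *: l @[N --> \oo] --> l0 - 0 *: l.
    apply: cvgB; first exact: cvg_cst.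
    by apply: cvgZr_tmp.
  by rewrite scale0r subr0.
- apply: integrable_scaler; have := integrable_norm ik.
  by apply: eq_integrable.
- move=> N l; rewrite /q normrM mulrC ler_wpM2r//.
  rewrite -[W]mulr1 -(f1 (l0 - h N *: l)) -RintegralZl//.
  apply: le_normr_Rintegral_le => //; first exact: integrable_scaler.
  by move=> z; rewrite normrM (ger0_norm (f0 _ _)) ler_wpM2r.
Qed.

End kernel_limit.

(** * The estimator *)

Section ae_distribution.
Context {R : realType} {dO : measure_display} {O : measurableType dO} (P : probability O R) {d : nat}.

Lemma cvg_in_distribution_ae (Y Y' : nat -> O -> 'rV[R]_d) (nu : set 'rV[R]_d -> \bar R) :
  (forall N, measurable_fun setT (Y N)) -> (forall N, measurable_fun setT (Y' N)) ->
  (\forall N \near \oo, {ae P, forall w, Y N w = Y' N w}) ->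
  cvg_in_distribution P Y' nu -> cvg_in_distribution P Y nu.
Proof.
move=> mY mY' YY' cY' g cg bg; have := cY' g cg bg.
apply: cvg_trans; apply: near_eq_cvg; apply: filterS YY' => N YN.
rewrite unlock; apply: ae_eq_integral => //.
- apply/measurable_EFinP; apply: measurableT_comp => //; exact: continuous_measurable_rV.
- apply/measurable_EFinP; apply: measurableT_comp => //; exact: continuous_measurable_rV.
- by apply: filterS YN => w /= ->.
Qed.

Lemma measurable_scale_rV {T : measurableType dO} (c : R) (Y : T -> 'rV[R]_d) (b : 'rV[R]_d) :
  measurable_fun setT Y -> measurable_fun setT (fun w => c *: (Y w + b)).
Proof.
move=> /measurable_fun_rVP mY; apply/measurable_fun_rVP => j; under eq_fun do rewrite !mxE.
apply: (@measurable_funM _ _ _ _ (cst c)) => //.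
by apply: (@measurable_funD _ _ _ _ _ (cst (b ord0 j))) => //; exact: mY.
Qed.

End ae_distribution.

Section estimator.
Context {R : realType} {d n p : nat}.
Context {dO : measure_display} {O : measurableType dO} (P : probability O R).
Variables (f : 'rV[R]_d -> 'rV[R]_n -> R) (phi psi : 'rV[R]_n -> R) (C : R).
Variables (l0 : 'rV[R]_d) (K : 'rV[R]_d -> R) (h : nat -> R).
Variable Z0 : {RV P >-> 'rV[R]_n}.
Variable X : forall N : nat, 'I_N -> {RV P >-> ('rV[R]_d * 'rV[R]_n)%type}.
Arguments X : clear implicits.
Local Notation mu := (@lebesgue_rV R d \x @lebesgue_rV R n)%E.
Hypothesis mf : forall l, measurable_fun setT (f l).
Hypothesis f0 : forall l z, 0 <= f l z.
Hypothesis fi : forall l, (lebesgue_rV n).-integrable setT (EFin \o f l).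
Hypothesis f1 : forall l, \int[lebesgue_rV n]_z f l z = 1.
Hypothesis smooth : forall z, times_differentiable p.+1 (f ^~ z).
Hypothesis Z0dens : has_density (lebesgue_rV n) Z0 (f l0).
Hypotheses (C1K : C1 K) (K0 : forall x, ~ cube 1 x -> K x = 0).
Hypothesis h_gt0 : forall N, 0 < h N.
Hypothesis Xdens : forall N i, has_density mu (X N i)
  (fun lz => cube_pdf (h N) (l0 - lz.1) * f lz.1 lz.2).
Hypothesis Xindep : forall N, independent_RVs (X N).
Hypotheses (mphi : measurable_fun setT phi) (mpsi : measurable_fun setT psi).
Hypothesis psiC : forall z, `|psi z| <= C.
Hypothesis phipsi : {ae lebesgue_rV n, forall z, phi z = psi z}.

Local Notation bhat N := (beta_hat K phi l0 (h N) (X N)).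
Local Notation rate N := (Num.sqrt (N%:R * h N ^+ 2)).
Local Notation resc N := (@rescaled_parameter R d n l0 (h N)).
Local Notation rd N := (rescaled_density f l0 (h N)).

Let cf z : continuous (f ^~ z).
Proof. by move=> x; apply: differentiable_continuous; have [df _] := smooth z; exact: df. Qed.

Let dK j : continuous (partial j K). Proof. by have [_ cK] := C1K; exact: cK. Qed.

Let C0 : 0 <= C. Proof. exact: le_trans (psiC 0). Qed.

(** [psi] is an everywhere bounded version of [phi], so that each term of the sum is
    a bounded function of the rescaled pair. *)
Definition summand (lz : 'rV[R]_d * 'rV[R]_n) : 'rV[R]_d := psi lz.2 *: grad K lz.1.

Lemma summandE lz j : summand lz ord0 j = psi lz.2 * partial j K lz.1.
Proof. by rewrite /summand !mxE. Qed.

Lemma dot_summand u lz : dotmul u (summand lz) = (\sum_j u ord0 j * partial j K lz.1) * psi lz.2.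
Proof.
rewrite dotmulE mulr_suml; apply: eq_bigr => j _; rewrite summandE; ring.
Qed.

Lemma partial_kernel_bound : exists2 M, 0 <= M & forall j x, `|partial j K x| <= M.
Proof.
have B j : exists M, forall x, `|partial j K x| <= M.
  have [M M0 KM] := bounded_on_cube (@dK j) (partial_eq0 j K0).
  exists M => x; apply: le_trans (KM x) _; rewrite indicE.
  by case: (x \in cube 1); rewrite ?mulr1// mulr0.
have [M MP] := choice B.
exists (\sum_j `|M j|) => [|j x]; first exact: sumr_ge0.
rewrite (le_trans (MP j x))// (le_trans (ler_norm _))// (bigD1 j)//= lerDl.
exact: sumr_ge0.
Qed.

Lemma measurable_summand j : measurable_fun setT (fun lz => summand lz ord0 j).
Proof.
under eq_fun do rewrite summandE; apply: measurable_funM.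
  by apply: measurableT_comp => //; exact: measurable_snd.
exact: (measurableT_comp (continuous_measurable_rV (@dK j)) measurable_fst).
Qed.

Lemma summand_bound : exists2 M, 0 <= M & forall lz j, `|summand lz ord0 j| <= M.
Proof.
have [M M0 KM] := partial_kernel_bound; exists (C * M) => [|lz j]; first exact: mulr_ge0.
by rewrite summandE normrM ler_pM.
Qed.

Definition summand_mean N : 'rV[R]_d := \row_j (2 ^- d * \int[mu]_lz (summand lz ord0 j * rd N lz)).

Lemma rescaled_sample_law N i : mu.-integrable setT (EFin \o rd N) /\
  forall (F : 'rV[R]_d * 'rV[R]_n -> R) (M : R), measurable_fun setT F ->
    (forall x, `|F x| <= M) ->
    \int[P]_w F (resc N (X N i w)) = 2 ^- d * \int[mu]_lz (F lz * rd N lz).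
Proof. exact: rescaled_law (h_gt0 N) (Xdens i). Qed.

Lemma expectation_summand N i j : \int[P]_w summand (resc N (X N i w)) ord0 j = summand_mean N ord0 j.
Proof.
have [M _ zM] := summand_bound; have [_ H] := rescaled_sample_law i.
by rewrite (H (fun lz => summand lz ord0 j) M)// ?mxE//; exact: measurable_summand.
Qed.

Let mresc N i : measurable_fun setT (fun w => resc N (X N i w)).
Proof. exact: (measurableT_comp (measurable_rescaled_parameter _ _) (measurable_funP _)). Qed.

Let msummandX N i j : measurable_fun setT (fun w => summand (resc N (X N i w)) ord0 j).
Proof. exact: (measurableT_comp (measurable_summand j) (mresc i)). Qed.

Let isummandX N i j : P.-integrable setT (EFin \o (fun w => summand (resc N (X N i w)) ord0 j)).
Proof.
have [M _ zM] := summand_bound.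
by apply: (@integrable_bounded _ _ _ _ _ M).
Qed.

Lemma ae_product : {ae mu, forall lz, phi lz.2 = psi lz.2}.
Proof.
have [A [mA A0 AQ]] := phipsi; exists (setT `*` A); split.
- exact: measurableX.
- by rewrite product_measure1E// A0 mule0.
- by move=> [l z] /= Q; split=> //; exact: AQ.
Qed.

(** The values of [phi] on a null set are almost surely not sampled. *)
Lemma ae_bhat N : {ae P, forall w, bhat N w =
  (2 ^+ d / (N%:R * h N)) *: \sum_i summand (resc N (X N i w))}.
Proof.
have : {ae P, forall w, forall i : 'I_N, phi (X N i w).2 = psi (X N i w).2}.
  by apply: filter_forall => i; exact: density_ae (Xdens i) ae_product.
apply: filterS => w H; rewrite /beta_hat; congr (_ *: _); apply: eq_bigr => i _.
by rewrite H.
Qed.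

Lemma measurable_bhat N : measurable_fun setT (bhat N).
Proof.
apply/measurable_fun_rVP => j; under eq_fun do rewrite /beta_hat mxE summxE.
apply: (@measurable_funM _ _ _ _ (cst _)) => //; apply: measurable_sum => i.
under eq_fun do rewrite !mxE.
apply: measurable_funM.
  by apply: measurableT_comp => //; apply: measurableT_comp => //; exact: measurable_snd.
exact: (measurableT_comp (continuous_measurable_rV (@dK j)) (measurableT_comp measurable_fst (mresc i))).
Qed.

Lemma expectation_bhat N : (0 < N)%N -> expectation_rV P (bhat N) = (2 ^+ d / h N) *: summand_mean N.
Proof.
move=> N0; apply/rowP => j; rewrite [LHS]mxE unlock [RHS]mxE.
have NR : N%:R != 0 :> R by rewrite pnatr_eq0 -lt0n.
transitivity (\int[P]_w ((2 ^+ d / (N%:R * h N)) * \sum_i summand (resc N (X N i w)) ord0 j)).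
  apply: Rintegral_ae_eq.
  - by have /measurable_fun_rVP := measurable_bhat N; exact.
  - by apply: (@measurable_funM _ _ _ _ (cst _)) => //; apply: measurable_sum => i; exact: msummandX.
  - by apply: filterS (ae_bhat N) => w ->; rewrite mxE summxE.
rewrite RintegralZl//; last by apply: integrable_sumr => i _; exact: isummandX.
rewrite Rintegral_sumr => [|i _]; last exact: isummandX.
under eq_bigr do rewrite expectation_summand.
rewrite sumr_const card_ord -[_ *+ N]mulr_natr.
by field; rewrite NR gt_eqF.
Qed.

(** Fubini, integrating over the parameter first. *)
Lemma expectation_bhat_smoothed N j : (0 < N)%N ->
  (lebesgue_rV n).-integrable setT (EFin \o (fun z => psi z * smoothed f l0 K j (h N) z)) /\
  expectation_rV P (bhat N) ord0 j = (h N)^-1 * \int[lebesgue_rV n]_z (psi z * smoothed f l0 K j (h N) z).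
Proof.
move=> N0; have [ri _] := rescaled_sample_law (Ordinal N0); have [M M0 zM] := summand_bound.
have zi : mu.-integrable setT (EFin \o (fun lz => summand lz ord0 j * rd N lz)).
  by apply: (integrable_bounded_mul (M := M)) => //; exact: measurable_summand.
have E l z : summand (l, z) ord0 j * rd N (l, z) = psi z * (partial j K l * f (l0 - h N *: l) z).
  rewrite summandE /rescaled_density /= -mulrA; congr (_ * _).
  have [l1|l1] := pselect (cube 1 l); first by rewrite indicE mem_set// mul1r.
  by rewrite (partial_eq0 j K0 l1) !mul0r.
have ii z : (lebesgue_rV d).-integrable setT (EFin \o (fun l => summand (l, z) ord0 j * rd N (l, z))).
  under eq_fun do rewrite E; apply: integrable_scaler.
  exact: (integrable_smoothed l0 j C1K K0 smooth).
have [i1 i2] := Rintegral_fubini21 zi ii.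
have G z : \int[lebesgue_rV d]_l (summand (l, z) ord0 j * rd N (l, z)) = psi z * smoothed f l0 K j (h N) z.
  under eq_Rintegral do rewrite E; rewrite RintegralZl//.
  exact: (integrable_smoothed l0 j C1K K0 smooth).
split; first by apply: eq_integrable i1 => // z _ /=; rewrite G.
have EI : \int[lebesgue_rV n]_z (psi z * smoothed f l0 K j (h N) z) =
    \int[lebesgue_rV n]_z \int[lebesgue_rV d]_l (summand (l, z) ord0 j * rd N (l, z)).
  by apply: eq_Rintegral => z _; rewrite G.
rewrite expectation_bhat// 2!mxE i2 EI.
rewrite mulrA; congr (_ * _).
have : 2 ^+ d != 0 :> R by rewrite expf_neq0.
move: (2 ^+ d : R) => t t0; field; rewrite t0 gt_eqF//.
Qed.

Hypothesis h0 : h N @[N --> \oo] --> 0.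
Local Notation s2 := (\int[lebesgue_rV n]_z (psi z ^+ 2 * f l0 z)).
Local Notation gradK u := (fun l => \sum_j u ord0 j * partial j K l).
Local Notation Sigma := (Sigma_u P K phi Z0).
Implicit Types u : 'rV[R]_d.

Let cgradK u : continuous (gradK u).
Proof.
apply: continuous_sum => j; apply: continuous_mul; last exact: dK.
by move=> x; exact: cst_continuous.
Qed.

Let gradK0 u x : ~ cube 1 x -> gradK u x = 0.
Proof. by move=> x1 /=; rewrite big1// => j _; rewrite (partial_eq0 j K0 x1) mulr0. Qed.

Lemma variance_phi : fine 'E_P[fun w => (phi (Z0 w) ^+ 2)%R]%E = s2.
Proof.
rewrite unlock; transitivity (\int[P]_w (psi (Z0 w) ^+ 2)).
  apply: Rintegral_ae_eq.
  - by apply: measurable_funX; apply: measurableT_comp.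
  - by apply: measurable_funX; apply: measurableT_comp.
  - by apply: filterS (density_ae Z0dens phipsi) => w ->.
rewrite (expectation_density Z0dens (F := fun z => psi z ^+ 2) (M := C ^+ 2))//.
- exact: measurable_funX.
- by move=> z; rewrite normrX lerXn2r ?nnegrE.
Qed.

Let igg j k : (lebesgue_rV d).-integrable setT (EFin \o (fun l => partial j K l * partial k K l)).
Proof.
apply: (@integrable_on_cube _ _ _ 1); first by apply: continuous_mul; exact: dK.
by move=> x /(partial_eq0 j K0) ->; rewrite mul0r.
Qed.

Lemma Sigma_entry j k : Sigma j k = 2 ^+ d * s2 * \int[lebesgue_rV d]_l (partial j K l * partial k K l).
Proof.
rewrite /Sigma_u variance_phi mxE; congr (_ * _); rewrite mxE.
by apply: eq_Rintegral => l _; rewrite mxE big_ord1 !mxE.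
Qed.

Lemma Sigma_quad u : (u *m Sigma *m u^T) ord0 ord0 =
  2 ^+ d * s2 * \int[lebesgue_rV d]_l (gradK u l) ^+ 2.
Proof.
have -> : \int[lebesgue_rV d]_l (gradK u l) ^+ 2 =
    \sum_k \sum_j u ord0 k * u ord0 j * \int[lebesgue_rV d]_l (partial j K l * partial k K l).
  transitivity (\int[lebesgue_rV d]_l \sum_k \sum_j u ord0 k * u ord0 j * (partial j K l * partial k K l)).
    apply: eq_Rintegral => l _; rewrite expr2 mulr_suml; apply: eq_bigr => k _.
    by rewrite mulr_sumr; apply: eq_bigr => j _; ring.
  have ii k j : (lebesgue_rV d).-integrable setT (EFin \o (fun l => u ord0 k * u ord0 j * (partial j K l * partial k K l))).
    exact/integrable_scaler/igg.
  rewrite Rintegral_sumr => [|k _]; last by apply: integrable_sumr.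
  apply: eq_bigr => k _; rewrite Rintegral_sumr//; apply: eq_bigr => j _.
  by rewrite RintegralZl//; exact: igg.
rewrite mxE mulr_sumr; apply: eq_bigr => k _; rewrite !mxE mulr_suml mulr_sumr.
by apply: eq_bigr => j _; rewrite Sigma_entry; ring.
Qed.

Lemma s2_ge0 : 0 <= s2.
Proof. by apply: Rintegral_ge0 => z _; rewrite mulr_ge0// sqr_ge0. Qed.

Lemma psd_Sigma : psd Sigma.
Proof.
split=> [|u]; last first.
  rewrite Sigma_quad; apply: mulr_ge0; first by rewrite mulr_ge0 ?s2_ge0 ?exprn_ge0.
  by apply: Rintegral_ge0 => l _; exact: sqr_ge0.
have ggC j k : \int[lebesgue_rV d]_l (partial j K l * partial k K l) =
    \int[lebesgue_rV d]_l (partial k K l * partial j K l).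
  by apply: eq_Rintegral => l _; rewrite mulrC.
apply/matrixP => j k; apply: (etrans (mxE _ _ _ _)).
apply: (etrans (Sigma_entry k j)); apply/esym; apply: (etrans (Sigma_entry j k)).
by rewrite ggC.
Qed.

Definition centered N lz : 'rV[R]_d := (2 ^+ d * Num.sqrt N%:R^-1) *: (summand (resc N lz) + (- summand_mean N)).

(** The variance of the functional [dotmul u] of a whole row, that is [N] times that
    of one entry, written with the law of the rescaled pair because [kernel_limit] is
    about this form. *)
Definition row_variance N u : R := (2 ^+ d) ^+ 2 *
  (2 ^- d * \int[mu]_lz ((gradK u lz.1) ^+ 2 * psi lz.2 ^+ 2 * rd N lz) - dotmul u (summand_mean N) ^+ 2).

Lemma centeredE N lz j : centered N lz ord0 j =
  2 ^+ d * Num.sqrt N%:R^-1 * (summand (resc N lz) ord0 j - summand_mean N ord0 j).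
Proof. by rewrite /centered mxE; congr (_ * _); rewrite mxE; congr (_ + _); rewrite mxE. Qed.

Lemma measurable_centered N : measurable_fun setT (centered N).
Proof.
apply/measurable_fun_rVP => j; under eq_fun do rewrite centeredE.
apply: (@measurable_funM _ _ _ _ (cst _)) => //.
apply: (@measurable_funD _ _ _ _ _ (cst _)) => //.
exact: (measurableT_comp (measurable_summand j) (measurable_rescaled_parameter _ _)).
Qed.

Lemma centered_bound : exists2 B : nat -> R, B N @[N --> \oo] --> 0 &
  forall N x j, `|centered N x ord0 j| <= B N.
Proof.
have [M M0 zM] := summand_bound.
exists (fun N => 2 ^+ d * Num.sqrt N%:R^-1 * (2 * M)).
  have : Num.sqrt (N%:R^-1) @[N --> \oo] --> Num.sqrt (0 : R).
    apply: (cvg_comp (fun N => N%:R^-1) Num.sqrt); last exact: sqrt_continuous.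
    by apply/gtr0_cvgV0; [exists 1%N => // N /=; rewrite ltr0n|exact: cvgr_idn].
  rewrite sqrtr0 => H; have -> : 0 = 2 ^+ d * 0 * (2 * M) by ring.
  by apply: cvgM; [apply: cvgM => //|]; exact: cvg_cst.
move=> N x j; rewrite centeredE; case: (posnP N) => [->|N0].
  by rewrite invr0 sqrtr0 mulr0 !mul0r normr0.
rewrite normrM ger0_norm ?mulr_ge0 ?exprn_ge0 ?sqrtr_ge0//.
rewrite ler_wpM2l ?mulr_ge0 ?exprn_ge0 ?sqrtr_ge0//.
rewrite (le_trans (ler_normB _ _))// mulr_natl mulr2n lerD//.
rewrite -(expectation_summand (Ordinal N0) j).
rewrite -[M](Rintegral_prob_cst P); apply: le_normr_Rintegral_le => //.
exact: finite_measure_integrable_cst.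
Qed.

Let dot_meanX N i u : \int[P]_w dotmul u (summand (resc N (X N i w))) = dotmul u (summand_mean N).
Proof.
under eq_Rintegral do rewrite dotmulE.
rewrite Rintegral_sumr => [|j _]; last by apply: integrable_scaler; exact: isummandX.
rewrite dotmulE; apply: eq_bigr => j _; by rewrite RintegralZl ?expectation_summand//; exact: isummandX.
Qed.

Lemma centered_mean N i j : \int[P]_w centered N (X N i w) ord0 j = 0.
Proof.
under eq_Rintegral do rewrite centeredE.
have i1 := isummandX i j.
have ic : P.-integrable setT (EFin \o cst (- summand_mean N ord0 j)) by exact: finite_measure_integrable_cst.
rewrite RintegralZl//; last exact: integrable_addr.
rewrite RintegralD//.
rewrite expectation_summand.
have -> : \int[P]_w (- (summand_mean N ord0 j)) = - summand_mean N ord0 j by exact: Rintegral_prob_cst.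
by rewrite subrr mulr0.
Qed.

Let dot_bound u : exists2 M, 0 <= M & forall lz, `|dotmul u (summand lz)| <= M.
Proof.
have [M M0 zM] := summand_bound; exists (\sum_j `|u ord0 j| * M) => [|lz].
  by apply: sumr_ge0 => j _; rewrite mulr_ge0.
rewrite dotmulE (le_trans (ler_norm_sum _ _ _))//; apply: ler_sum => j _.
by rewrite normrM ler_wpM2l.
Qed.

Let mdot u : measurable_fun setT (fun lz => dotmul u (summand lz)).
Proof.
under eq_fun do rewrite dotmulE; apply: measurable_sum => j.
by apply: (@measurable_funM _ _ _ _ (cst _)) => //; exact: measurable_summand.
Qed.

Lemma centered_variance N i u :
  \int[P]_w (dotmul u (centered N (X N i w))) ^+ 2 = row_variance N u / N%:R.
Proof.
have [M M0 zM] := dot_bound u; have [ri lawF] := rescaled_sample_law i.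
have mX : measurable_fun setT (fun w => dotmul u (summand (resc N (X N i w)))).
  exact: (measurableT_comp (mdot u) (mresc i)).
have i1 : P.-integrable setT (EFin \o (fun w => dotmul u (summand (resc N (X N i w))))).
  by apply: (@integrable_bounded _ _ _ _ _ M).
have i2 : P.-integrable setT (EFin \o (fun w => dotmul u (summand (resc N (X N i w))) ^+ 2)).
  apply: (@integrable_bounded _ _ _ _ _ (M ^+ 2)) => [|w]; first exact: measurable_funX.
  by rewrite normrX lerXn2r ?nnegrE.
pose m := dotmul u (summand_mean N); pose c : R := 2 ^+ d * Num.sqrt N%:R^-1.
have E w : dotmul u (centered N (X N i w)) ^+ 2 =
    c ^+ 2 * (dotmul u (summand (resc N (X N i w))) ^+ 2 + - (2 * m) * dotmul u (summand (resc N (X N i w))) + m ^+ 2).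
  rewrite /centered dotmulZr dotmulDr -/c.
  have -> : dotmul u (- summand_mean N) = - m by rewrite dotmulC /dotmul mulNmx mxE -/(dotmul _ _) dotmulC.
  ring.
under eq_Rintegral do rewrite E.
have ic : P.-integrable setT (EFin \o cst (m ^+ 2)) by exact: finite_measure_integrable_cst.
have i3 := integrable_scaler (- (2 * m)) i1.
rewrite RintegralZl//; last by apply: integrable_addr => //; exact: integrable_addr.
rewrite RintegralD//; last exact: integrable_addr.
rewrite RintegralD// RintegralZl// dot_meanX -/m.
have -> : \int[P]_w (m ^+ 2) = m ^+ 2 by exact: Rintegral_prob_cst.
have -> : \int[P]_w dotmul u (summand (resc N (X N i w))) ^+ 2 =
    2 ^- d * \int[mu]_lz ((gradK u lz.1) ^+ 2 * psi lz.2 ^+ 2 * rd N lz).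
  rewrite (lawF (fun lz => dotmul u (summand lz) ^+ 2) (M ^+ 2)).
  - by congr (_ * _); apply: eq_Rintegral => lz _; rewrite dot_summand exprMn.
  - exact: measurable_funX.
  - by move=> lz; rewrite normrX lerXn2r ?nnegrE.
rewrite /row_variance -/m /c exprMn sqr_sqrtr ?invr_ge0//.
ring.
Qed.

(** By [kernel_limit] the second moments converge, while the means tend to [0]
    because [\int grad K = 0]. *)
Lemma row_variance_cvg u : row_variance N u @[N --> \oo] --> (u *m Sigma *m u^T) ord0 ord0.
Proof.
rewrite -cvg_shiftS.
have h0' : h N.+1 @[N --> \oo] --> 0 by rewrite cvg_shiftS.
have ri N : mu.-integrable setT (EFin \o rd N.+1) by have [] := rescaled_sample_law (@ord0 N).
have psi2C z : `|psi z ^+ 2| <= C ^+ 2 by rewrite normrX lerXn2r ?nnegrE.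
have gK2 : continuous (fun l => gradK u l ^+ 2).
  by under eq_fun do rewrite expr2; apply: continuous_mul; exact: cgradK.
have gK20 x : ~ cube 1 x -> gradK u x ^+ 2 = 0.
  by move=> /gradK0 ->; rewrite expr0n.
have mpsi2 : measurable_fun setT (fun z => psi z ^+ 2) by exact: measurable_funX.
have H2 := kernel_limit f0 fi f1 cf h0' ri gK2 gK20 mpsi2 psi2C.
have H1 := kernel_limit f0 fi f1 cf h0' ri (@cgradK u) (@gradK0 u) mpsi psiC.
have ipart j : (lebesgue_rV d).-integrable setT (EFin \o partial j K).
  by apply: (@integrable_on_cube _ _ _ 1); [exact: dK|exact: partial_eq0].
have g1 : \int[lebesgue_rV d]_l gradK u l = 0.
  rewrite Rintegral_sumr => [|j _]; last exact: integrable_scaler.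
  rewrite big1// => j _; rewrite RintegralZl// (integral_partial_eq0 j ler01 C1K K0) mulr0//.
rewrite g1 mul0r in H1.
have mE N : dotmul u (summand_mean N.+1) = 2 ^- d * \int[mu]_lz (gradK u lz.1 * psi lz.2 * rd N.+1 lz).
  have [M M0 zM] := dot_bound u; have [_ lawF] := rescaled_sample_law (@ord0 N).
  rewrite -(dot_meanX (@ord0 N)) (lawF (fun lz => dotmul u (summand lz)) M)//.
  by congr (_ * _); apply: eq_Rintegral => lz _; rewrite dot_summand.
rewrite Sigma_quad.
have -> : 2 ^+ d * s2 * \int[lebesgue_rV d]_l gradK u l ^+ 2 =
    (2 ^+ d) ^+ 2 * (2 ^- d * (\int[lebesgue_rV d]_l gradK u l ^+ 2 * s2) - (2 ^- d * 0) ^+ 2).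
  have : 2 ^+ d != 0 :> R by rewrite expf_neq0.
  move: (2 ^+ d : R) => t t0; field; exact: t0.
rewrite (_ : (fun N => row_variance N.+1 u) = fun N => (2 ^+ d) ^+ 2 *
  (2 ^- d * \int[mu]_lz ((gradK u lz.1) ^+ 2 * psi lz.2 ^+ 2 * rd N.+1 lz) -
   (2 ^- d * \int[mu]_lz (gradK u lz.1 * psi lz.2 * rd N.+1 lz)) ^+ 2)); last first.
  by apply/funext => N; rewrite -mE.
apply: cvgM; first exact: cvg_cst.
apply: cvgB; first by apply: cvgM; [exact: cvg_cst|exact: H2].
rewrite expr2; under eq_cvg do rewrite expr2.
by apply: cvgM; apply: cvgM => //; exact: cvg_cst.
Qed.

Lemma centered_sum N w : (0 < N)%N ->
  rate N *: ((2 ^+ d / (N%:R * h N)) *: \sum_i summand (resc N (X N i w)) - (2 ^+ d / h N) *: summand_mean N) =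
  \sum_i centered N (X N i w).
Proof.
move=> N0; have NR : 0 < N%:R :> R by rewrite ltr0n.
have hN := h_gt0 N.
have E : (2 ^+ d / h N) *: summand_mean N = (2 ^+ d / (N%:R * h N)) *: \sum_(i < N) summand_mean N.
  rewrite sumr_const card_ord -[summand_mean N *+ N]scaler_nat scalerA; congr (_ *: _).
  by field; rewrite !gt_eqF.
rewrite E -scalerBr scalerA -sumrB scaler_sumr; apply: eq_bigr => i _; congr (_ *: _).
rewrite sqrtrM ?ler0n// sqrtr_sqr gtr0_norm// sqrtrV ?ler0n//.
have cancelE (x q y t : R) : q != 0 -> y != 0 -> x = q * q -> q * y * (t / (x * y)) = t * q^-1.
  by move=> q0 y0 ->; field; rewrite q0 y0.
apply: cancelE; [by rewrite gt_eqF// sqrtr_gt0|by rewrite gt_eqF|].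
by rewrite -expr2 sqr_sqrtr// ler0n.
Qed.

Let sampleE N i A : measurable A ->
  distribution P (X N i) A = (\int[mu]_(x in A) (cube_pdf (h N) (l0 - x.1) * f x.1 x.2)%:E)%E.
Proof. by move=> mA; have [_ _] := Xdens i; exact. Qed.

(** Almost surely the left side is a row of the triangular array of the [centered]
    summands, plus the deterministic shift that tends to [0]. *)
Theorem estimator_cvg (b : nat -> 'rV[R]_d) :
  rate N *: (expectation_rV P (bhat N) - b N) @[N --> \oo] --> (0 : 'rV[R]_d) ->
  cvg_to_normal P (fun N w => rate N *: (bhat N w - b N)) 0 Sigma.
Proof.
move=> b0; have [nu nuS] := exists_normal_rV psd_Sigma.
exists nu => //.
have [B B0 cB] := centered_bound.
have S0 u : 0 <= (u *m Sigma *m u^T) ord0 ord0 by have [_] := psd_Sigma; exact.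
have idX N i j A : measurable A -> P (X N i @^-1` A) = P (X N j @^-1` A).
  move=> mA; have := sampleE i mA; have := sampleE j mA.
  by rewrite /distribution/= /pushforward => -> ->.
have clt := array_clt Xindep idX measurable_centered cB B0 centered_mean centered_variance
  row_variance_cvg S0 b0 nuS.
apply: cvg_in_distribution_ae clt => [N|N|].
- exact: measurable_scale_rV (measurable_bhat N).
- apply/measurable_fun_rVP => j; under eq_fun do rewrite mxE summxE.
  apply: (@measurable_funD _ _ _ _ _ (cst _)) => //; apply: measurable_sum => i.
  have /measurable_fun_rVP mc := measurable_centered N.
  exact: (measurableT_comp (mc j) (measurable_funP (X N i))).
- exists 1%N => // N /= N0; apply: filterS (ae_bhat N) => w E.
  rewrite -(centered_sum w N0) -(expectation_bhat N0) -scalerDr E.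
  by rewrite addrA subrK.
Qed.

End estimator.

(** * Asymptotic normality of the estimator *)

(** Removing a null set turns almost sure bounds into pointwise ones and changes no
    expectation under a law with a density. *)
Lemma ae_truncation {R : realType} {dT : measure_display} {T : measurableType dT}
  (mu : {measure set T -> \bar R}) (phi : T -> R) (C : R) (Q : T -> Prop) :
  measurable_fun setT phi -> 0 <= C -> {ae mu, forall z, `|phi z| <= C /\ Q z} ->
  exists psi : T -> R, [/\ measurable_fun setT psi, (forall z, `|psi z| <= C),
    {ae mu, forall z, phi z = psi z} & forall z, psi z = 0 \/ psi z = phi z /\ Q z].
Proof.
move=> mphi C0 [A [mA A0 AQ]].
have good z : ~ A z -> `|phi z| <= C /\ Q z by move=> nA; apply: contrapT => H; exact/nA/AQ.
exists (fun z => phi z * \1_(~` A) z); split.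
- by apply: measurable_funM => //; apply: measurable_indic; exact: measurableC.
- move=> z; rewrite indicE; case: (boolP (z \in ~` A)) => [|_]; last by rewrite mulr0 normr0.
  by rewrite inE => /good[+ _]; rewrite mulr1.
- exists A; split=> // z /= H; apply: contrapT => nA; apply: H.
  by rewrite indicE mem_set// mulr1.
- move=> z; rewrite indicE; case: (boolP (z \in ~` A)) => [|_]; last by left; rewrite mulr0.
  by rewrite inE => /good[_ Qz]; right; rewrite mulr1.
Qed.

Lemma rate_power {R : realType} (N p : nat) (h : R) : 0 < h ->
  Num.sqrt (N%:R * h ^+ 2) * h ^+ p = Num.sqrt (N%:R * h ^+ (2 * p + 2)).
Proof.
move=> h0; rewrite -[X in _ * X](ger0_norm (exprn_ge0 p (ltW h0))) -sqrtr_sqr.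
rewrite -sqrtrM ?mulr_ge0 ?ler0n ?exprn_ge0 ?ltW//; congr Num.sqrt.
by rewrite -mulrA -exprM -exprD mulnC addnC.
Qed.

Theorem theorem4p3 (R : realType) (d n p : nat)
  (dO : measure_display) (O : measurableType dO) (P : probability O R)
  (Z : 'rV[R]_d -> {RV P >-> 'rV[R]_n})
  (f : 'rV[R]_d -> 'rV[R]_n -> R) (phi : 'rV[R]_n -> R)
  (lambda0 beta : 'rV[R]_d) (K : 'rV[R]_d -> R) (h : nat -> R)
  (X : forall N : nat, 'I_N -> {RV P >-> ('rV[R]_d * 'rV[R]_n)%type})
  (Zdens : forall lambda, has_density (lebesgue_rV n) (Z lambda) (f lambda))
  (phiLoo : phi \in Lfun (lebesgue_rV n) +oo%E)
  (Vdiff : differentiable (value Z phi) lambda0)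
  (betaE : beta = grad (value Z phi) lambda0)
  (beta_score : forall j, ('E_P[fun w => (phi (Z lambda0 w) *
      score f lambda0 (Z lambda0 w) ord0 j)%R] = (beta ord0 j)%:E)%E)
  (beta_int : forall j, (\int[lebesgue_rV n]_z
      (phi z * grad (f ^~ z) lambda0 ord0 j)%:E = (beta ord0 j)%:E)%E)
  (score_L2 : ('E_P[fun w => (\sum_j
      score f lambda0 (Z lambda0 w) ord0 j ^+ 2)%R] < +oo)%E)
  (HK : assumptionK K p) (Ksupp : supp K `<=` cube 1)
  (HR3 : assumptionR3 p f phi lambda0)
  (h_gt0 : forall N, 0 < h N)
  (Xdens : forall N i,
      has_density (lebesgue_rV d \x lebesgue_rV n)%E (X N i)
        (fun lz => cube_pdf (h N) (lambda0 - lz.1) * f lz.1 lz.2))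
  (Xindep : forall N, independent_RVs (X N)) :
  let bhat N := beta_hat K phi lambda0 (h N) (X N) in
  let rate N := Num.sqrt (N%:R * h N ^+ 2) in
  let Sigma := Sigma_u P K phi (Z lambda0) in
  h N @[N --> \oo] --> 0 ->
  N%:R * h N ^+ 2 @[N --> \oo] --> +oo ->
  cvg_to_normal P
    (fun N w => rate N *: (bhat N w - expectation_rV P (bhat N))) 0 Sigma
  /\
  (dominated_modulus p f phi lambda0 ->
   N%:R * h N ^+ (2 * p + 2) @[N --> \oo] --> 0 ->
   (fun N => rate N *: (expectation_rV P (bhat N) - beta)) @ \oo
     --> (0 : 'rV[R]_d) /\
   cvg_to_normal P (fun N w => rate N *: (bhat N w - beta)) 0 Sigma).
Proof.
move=> bhat rate Sigma h0 _.
have mf l : measurable_fun setT (f l) by have [] := Zdens l.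
have f0 l z : 0 <= f l z by have [_ + _] := Zdens l; exact.
have fi l := (density_integrable (Zdens l)).1.
have f1 l := (density_integrable (Zdens l)).2.
have [smooth _] := HR3.
have [C1K _ EK [_ _ orderK] p2] := HK.
have K0 x : ~ cube 1 x -> K x = 0.
  move=> x1; apply: contrapT => /eqP Kx; apply: x1; apply: Ksupp; exact: subset_closure.
have intK : \int[lebesgue_rV d]_l K l = 1 by rewrite /Rintegral EK.
have [mphi [C C0 phiC]] := Lfun_oo_bounded phiLoo.
(* The central limit theorem needs a version of [phi] that is bounded everywhere. *)
have [psi [mpsi psiC phipsi _]] : exists psi : 'rV[R]_n -> R, [/\ measurable_fun setT psi,
    (forall z, `|psi z| <= C), {ae lebesgue_rV n, forall z, phi z = psi z} &
    forall z, psi z = 0 \/ psi z = phi z /\ True].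
  by apply: ae_truncation => //; apply: filterS phiC.
have cvgN b := estimator_cvg (b := b) f0 fi f1 smooth (Zdens lambda0) C1K K0 h_gt0 Xdens Xindep
  mphi mpsi psiC phipsi h0.
split.
  apply: cvgN; rewrite (_ : (fun N => _) = cst 0); first exact: cvg_cst.
  by apply/funext => N; rewrite subrr scaler0.
move=> [g gi [U U0 Ug]] Nh0.
suff bias0 : (fun N => rate N *: (expectation_rV P (bhat N) - beta)) @ \oo --> (0 : 'rV[R]_d).
  by split=> //; exact: cvgN.
(* The bias needs a version for which the modulus [g] is valid at every [z]. *)
have [chi [mchi chiC phichi chiQ]] : exists chi : 'rV[R]_n -> R, [/\ measurable_fun setT chi,
    (forall z, `|chi z| <= C), {ae lebesgue_rV n, forall z, phi z = chi z} &
    forall z, chi z = 0 \/ chi z = phi z /\ (forall js l, size js = p.+1 -> U l ->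
        `|phi z| * `|iter_partial js (f ^~ z) l - iter_partial js (f ^~ z) lambda0| <= g z)].
  by apply: ae_truncation => //; apply: filterS2 phiC Ug.
(* For bandwidths up to [r0] the points [lambda0 - h l] stay in [U]. *)
have [r0 r00 ball_U] : exists2 r0 : R, 0 < r0 & forall l : 'rV[R]_d,
    (forall j, `|l ord0 j - lambda0 ord0 j| <= r0) -> U l.
  have /nbhs_ballP[e /= e0 eU] := U0; exists (e / 2); first by rewrite divr_gt0.
  move=> l ll; apply: eU; apply: rV_ballP => // j.
  by rewrite distrC (le_lt_trans (ll j))// ltr_pdivrMr// ltr_pMr// ltr1n.
have gi' : (lebesgue_rV n).-integrable setT (EFin \o (fun z => `|g z|)).
  by have := integrable_norm gi; apply: eq_integrable.
have dom z (js : seq 'I_d) (l : 'rV[R]_d) : size js = p.+1 ->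
    (forall j, `|l ord0 j - lambda0 ord0 j| <= r0) ->
    `|chi z| * `|iter_partial js (f ^~ z) l - iter_partial js (f ^~ z) lambda0| <= `|g z|.
  move=> sj lr; have [->|[-> Q]] := chiQ z; first by rewrite normr0 mul0r.
  by rewrite (le_trans (Q js l sj (ball_U l lr)))// ler_norm.
have mpart j : measurable_fun setT (fun z => partial j (f ^~ z) lambda0).
  by apply: measurable_partial => // z x; have [df _] := smooth z; exact: df.
have beta_chi j : (lebesgue_rV n).-integrable setT (EFin \o (fun z => chi z * partial j (f ^~ z) lambda0)) /\
    beta ord0 j = \int[lebesgue_rV n]_z (chi z * partial j (f ^~ z) lambda0).
  have mF : measurable_fun setT (fun z => phi z * partial j (f ^~ z) lambda0) by exact: measurable_funM.
  have mG : measurable_fun setT (fun z => chi z * partial j (f ^~ z) lambda0) by exact: measurable_funM.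
  have intF : (\int[lebesgue_rV n]_z (phi z * partial j (f ^~ z) lambda0)%:E = (beta ord0 j)%:E)%E.
    by rewrite -(beta_int j); apply: eq_integral => z _; rewrite mxE.
  have iF := integrable_of_integral mF intF.
  split.
    apply: (le_integrable measurableT _ _ iF); first exact/measurable_EFinP.
    move=> z _ /=; rewrite lee_fin normrM; have [->|[-> _]] := chiQ z; last by rewrite normrM.
    by rewrite normr0 mul0r.
  rewrite -(Rintegral_ae_eq mF mG); first by rewrite /Rintegral intF.
  by apply: filterS phichi => z ->.
have Ebhat N j := expectation_bhat_smoothed smooth C1K K0 h_gt0 Xdens mphi mchi chiC phichi (N := N) j.
have hr0 : \forall N \near \oo, h N <= r0 by apply: (cvgr_le _ h0).
(* One bandwidth below [r0], at which the estimator has a finite expectation. *)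
have [N1 _ N1h] := hr0.
have hN1 : 0 < h N1.+1 <= r0 by rewrite h_gt0 N1h//= leqnSn.
apply: cvg_row => j; rewrite mxE.
have [iB bE] := beta_chi j.
have p0 : (0 < p)%N by rewrite ltnW.
have [B HB] := bias_bound C1K K0 intK orderK p0 smooth mf mchi gi' (fun z => normr_ge0 (g z)) dom iB hN1
  (Ebhat N1.+1 j isT).1.
have rate0 : Num.sqrt (N%:R * h N ^+ (2 * p + 2)) @[N --> \oo] --> 0.
  rewrite -(@sqrtr0 R); apply: (cvg_comp _ Num.sqrt Nh0); exact: sqrt_continuous.
apply/norm_cvg0P; apply: (@squeeze_cvgr _ _ _ _ (cst 0) (fun N => B * Num.sqrt (N%:R * h N ^+ (2 * p + 2)))).
- near=> N; rewrite normr_ge0/=.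
  have N0 : (0 < N)%N by near: N; exists 1%N.
  have hN : 0 < h N <= r0 by rewrite h_gt0/=; near: N.
  have [i2 E2] := Ebhat N j N0.
  have -> : (rate N *: (expectation_rV P (bhat N) - beta)) ord0 j =
      rate N * (expectation_rV P (bhat N) ord0 j - beta ord0 j).
    by rewrite mxE; congr (_ * _); rewrite mxE; congr (_ + _); rewrite mxE.
  rewrite normrM ger0_norm ?sqrtr_ge0// -rate_power//.
  have := HB (h N) hN i2; rewrite -bE -E2 => /(ler_wpM2l (sqrtr_ge0 (N%:R * h N ^+ 2))).
  by move=> H; apply: le_trans H _; rewrite mulrCA.
- exact: cvg_cst.
- by rewrite -(mulr0 B); apply: cvgM => //; exact: cvg_cst.
Unshelve. all: by end_near.
Qed.
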